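(* Let $H\in(0,1/2)$. There exist positive constants $\hat A_H\le 18$ and $\hat B_H$, depending only on $H$, such that for every $S>0$, every $c\in(0,S^H]$ and every $u>0$, $$\mathbf P\left(\left|\mathrm{UTV}^c(W^H,S)-\mathbf E\,\mathrm{UTV}^c(W^H,S)\right|>u\right)\le \hat A_H\exp\left(-\hat B_H\,S^{-1}c^{\frac1H-2}u^{1+2H}\min\left(Sc^{1-\frac1H},u\right)^{1-2H}\right),$$ or, equivalently (writing $u=Sc^{1-\frac1H}v$), for every $v>0$, $$\mathbf P\left(\left|\mathrm{UTV}^c(W^H,S)-\mathbf E\,\mathrm{UTV}^c(W^H,S)\right|>Sc^{1-\frac1H}v\right)\le \hat A_H\exp\left(-\hat B_H\,Sc^{-\frac1H}\min\left(v^{1+2H},v^2\right)\right).$$ The same estimates hold with $\mathrm{DTV}^c(W^H,S)$ in place of $\mathrm{UTV}^c(W^H,S)$.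
   Context: $W^H=(W^H_t)_{t\ge0}$ is a fractional Brownian motion with Hurst index $H\in(0,1)$, i.e. a centered Gaussian process with (a.s.) continuous trajectories and $\mathbf E(W^H_sW^H_t)=\frac12\{|s|^{2H}+|t|^{2H}-|t-s|^{2H}\}$ for $s,t\ge0$. For a path $f:[0,+\infty)\to\mathbb R$ that is right-continuous with left limits, $c\ge0$ and $0\le s<t$, the upward and downward truncated variations are $$\mathrm{UTV}^c(f,[s,t])=\sup_{n\ge1}\ \sup_{s\le s_1<t_1<s_2<t_2<\dots<s_n<t_n\le t}\ \sum_{i=1}^n\left(f(t_i)-f(s_i)-c\right)_+,$$ $$\mathrm{DTV}^c(f,[s,t])=\sup_{n\ge1}\ \sup_{s\le s_1<t_1<s_2<t_2<\dots<s_n<t_n\le t}\ \sum_{i=1}^n\left(f(s_i)-f(t_i)-c\right)_+,$$ with $(x)_+=\max(x,0)$; for $S>0$, $\mathrm{UTV}^c(f,S):=\mathrm{UTV}^c(f,[0,S])$ and $\mathrm{DTV}^c(f,S):=\mathrm{DTV}^c(f,[0,S])$. *)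

(* Defs.v *)
From HB Require Import structures.
From mathcomp Require Import all_boot all_order all_algebra.
From mathcomp Require Import all_classical all_reals all_analysis.

Set Implicit Arguments.
Unset Strict Implicit.
Unset Printing Implicit Defensive.

Import Order.TTheory GRing.Theory Num.Theory.
Import numFieldNormedType.Exports.

Local Open Scope classical_set_scope.
Local Open Scope ring_scope.

(* The chain s <= a 0 < b 0 < a 1 < b 1 < ... < a n < b n <= t of n + 1
   intervals; the values of a and b beyond index n are irrelevant. *)
Definition interval_chain (R : realType) (s t : R) (n : nat) (a b : nat -> R) :
  Prop :=
  [/\ s <= a 0%N,
      forall i, (i <= n)%N -> a i < b i,
      forall i, (i < n)%N -> b i < a i.+1 &
      b n <= t].

Definition UTV (R : realType) (c : R) (f : R -> R) (s t : R) : \bar R :=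
  ereal_sup [set x | exists n a b, interval_chain s t n a b /\
    x = (\sum_(i < n.+1) Num.max (f (b i) - f (a i) - c) 0)%:E].

Definition DTV (R : realType) (c : R) (f : R -> R) (s t : R) : \bar R :=
  ereal_sup [set x | exists n a b, interval_chain s t n a b /\
    x = (\sum_(i < n.+1) Num.max (f (a i) - f (b i) - c) 0)%:E].

(* Constant variables count as Gaussian; they need a separate case because
   normal_prob m 0 is the uniform law on [0, 1], not the Dirac mass at m. *)
Definition gaussian_rv (d : measure_display) (T : measurableType d)
  (R : realType) (P : probability T R) (X : T -> R) : Prop :=
  (exists m : R, {ae P, forall w, X w = m}) \/
  (exists m s : R, 0 < s /\
    forall A : set R, measurable A -> P (X @^-1` A) = normal_prob m s A).

(* Time is the half-line t >= 0: W t is unconstrained for t < 0. *)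
Definition gaussian_process (d : measure_display) (T : measurableType d)
  (R : realType) (P : probability T R) (W : R -> {RV P >-> R}) : Prop :=
  forall (n : nat) (t a : 'I_n -> R), (forall i, 0 <= t i) ->
    gaussian_rv P (fun w => \sum_(i < n) a i * W (t i) w).

Record fractional_brownian_motion (d : measure_display) (T : measurableType d)
  (R : realType) (P : probability T R) (H : R) (W : R -> {RV P >-> R}) : Prop :=
  { fbm_hurst : 0 < H < 1;
    fbm_gaussian : gaussian_process W;
    fbm_centered : forall t : R, 0 <= t -> 'E_P[W t]%E = 0%E;
    fbm_cov : forall s t : R, 0 <= s -> 0 <= t ->
      'E_P[W s \* W t]%E =
        (2^-1 * (`|s| `^ (2 * H) + `|t| `^ (2 * H) - `|t - s| `^ (2 * H)))%:E;
    fbm_continuous :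
      {ae P, forall w, {within `[(0 : R), +oo[, continuous (fun t : R => W t w)}} }.

(* Probability that the [0, +oo]-valued variable X deviates from its mean by
   more than u. As trajectories are only almost surely continuous and P need
   not be complete, truncated variations are only measurable for the completion
   of P. The outer measure mu_ext P agrees with the completion of P on the event
   (and with P itself if the event is measurable), and the integral of a
   nonnegative function, a supremum over measurable simple minorants, is the
   expectation for the completion. If the mean is +oo, then `|X w - E X| = +oo
   for all w, so a nontrivial bound on deviation_prob forces E X < +oo. *)
Definition deviation_prob (d : measure_display) (T : measurableType d)
  (R : realType) (P : probability T R) (X : T -> \bar R) (u : R) : \bar R :=
  mu_ext P [set w | (u%:E < `|X w - \int[P]_w' X w'|)%E].

(* The concentration estimate for X at level c on [0, S], in its two parametrizations
   of the deviation (u, and u = S c^(1 - 1/H) v). *)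
Definition truncated_variation_concentration (d : measure_display)
  (T : measurableType d) (R : realType) (P : probability T R) (H A B S c : R)
  (X : T -> \bar R) : Prop :=
  (forall u : R, 0 < u ->
    (deviation_prob P X u <=
     (A * expR (- (B * S^-1 * c `^ (H^-1 - 2) * u `^ (1 + 2 * H) *
        (Num.min (S * c `^ (1 - H^-1)) u) `^ (1 - 2 * H))))%:E)%E) /\
  (forall v : R, 0 < v ->
    (deviation_prob P X (S * c `^ (1 - H^-1) * v) <=
     (A * expR (- (B * S * c `^ (- H^-1) *
        Num.min (v `^ (1 + 2 * H)) (v ^+ 2))))%:E)%E).

(* Main.v *)
Require Import Defs.
From mathcomp Require Import all_boot all_order all_algebra.
From mathcomp Require Import all_classical all_reals all_analysis.
From mathcomp Require Import measurable_realfun.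
From mathcomp Require Import ring lra zify.

(* After division by c, the truncated variation is the limit, along dyadic grids, of the maximum
   over finite sets Q of disjoint grid intervals of (sum of the increments over Q) - #|Q|.

   For H < 1/2 increments over disjoint intervals are nonpositively correlated, so by concavity
   of x^(2H) the sum over k intervals has variance at most k^(1 - 2H) M^(2H), where M is of the
   order of S c^(-1/H). By dyadic chaining, the maximum of (sum over Q) - #|Q| / 2 has mean O(M).
   Consequently, if k exceeds a multiple of M, sets of k intervals have a positive gain only with
   probability exp(- b k^(1 + 2H) M^(-2H)), and the maximum over the sets of at most k ~ M (1 + v)
   intervals deviates by M v with probability exp(- b M v^2 / (1 + v)^(1 - 2H)). The two bounds
   combine to exp(- b M min(v^(1 + 2H), v^2)), uniformly in the grid.

   The Gaussian concentration inequality for maxima is proved by rotating one copy of the family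
   into an independent one: the derivative of the rotation is independent of the index at which
   the maximum is attained, because uncorrelated jointly Gaussian variables are independent. *)

Set Implicit Arguments.
Unset Strict Implicit.
Unset Printing Implicit Defensive.

Import Order.TTheory GRing.Theory Num.Theory.
Import numFieldNormedType.Exports.
Import HBNNSimple.

Local Open Scope classical_set_scope.
Local Open Scope ring_scope.

(** The number of selected intervals is unbounded as the grid is refined, and the variance bound
    grows with it, so the concentration inequality applied to the whole maximum has no uniform
    constant. The cost 1 per interval compensates. Half of it pays for the truncation levels of the
    chaining; the other half gives the best gain of exactly [n] intervals a mean of at most
    [- n / 4], once [n] exceeds a multiple of [M]. A positive gain is then a deviation by [n / 4]
    under a variance [n ^ (1 - h) * M ^ h], where [h = 2 * H]. The cutoff between few and many
    intervals moves with the deviation, which produces the two regimes of the bound. The sign of the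
    correlations serves only for this variance, not for the chaining.

    A Gaussian process is given through its linear combinations alone, so independence is extracted
    from real cosine transforms with a phase instead of joint densities.

    The prefactor obtained on the way is far larger than 18. As probabilities are at most 1, it can
    be lowered to any fixed constant above 1 at the price of a smaller rate. *)

Lemma le_of_eq d (T : porderType d) (x y : T) : x = y -> (x <= y)%O.
Proof. by move=> ->. Qed.

Section expR_norm.
Context (R : realType).
Implicit Types x m : R.

Lemma expR_norm_le x : expR `|x| <= expR x + expR (- x).
Proof.
have [x0|x0] := leP 0 x.
  by rewrite ger0_norm// lerDl expR_ge0.
by rewrite ltr0_norm// lerDr expR_ge0.
Qed.

Lemma le_expR_norm x : `|x| <= expR `|x|.
Proof. by rewrite (le_trans _ (expR_ge1Dx _))// lerDr. Qed.

Lemma ge1_expR_norm x : 1 <= expR `|x|.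
Proof. by rewrite -expR0 ler_expR. Qed.

Lemma normB_le_expR_norm m x : `|x - m| <= (1 + `|m|) * expR `|x|.
Proof.
rewrite (le_trans (ler_normB _ _))// mulrDl mul1r lerD// ?le_expR_norm//.
by rewrite ler_peMr// ge1_expR_norm.
Qed.
End expR_norm.

(** * Gaussian integrals *)

Section density.
Local Open Scope ereal_scope.
Context d (T : measurableType d) (R : realType).
Variables (mu nu : {measure set T -> \bar R}) (g : T -> R).
Hypothesis g0 : forall x, (0 <= g x)%R.
Hypothesis mg : measurable_fun setT g.
Hypothesis nuE : forall A, measurable A -> nu A = \int[mu]_(x in A) (g x)%:E.

Lemma ge0_integral_density (f : T -> \bar R) : (forall x, 0 <= f x) ->
  measurable_fun setT f -> \int[nu]_x f x = \int[mu]_x (f x * (g x)%:E).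
Proof.
move=> f0 mf; pose h := nnsfun_approx measurableT mf.
have nnE (s : {nnsfun T >-> R}) :
    \int[nu]_x (s x)%:E = \int[mu]_x ((s x)%:E * (g x)%:E).
  under [LHS]eq_integral do rewrite fimfunE -fsumEFin//.
  rewrite [LHS]ge0_integral_fsum//; last 2 first.
    - by move=> r; exact/measurable_EFinP/measurableT_comp.
    - by move=> n x _; rewrite EFinM nnfun_muleindic_ge0.
  under [RHS]eq_integral.
    move=> x xD; rewrite fimfunE -fsumEFin// ge0_mule_fsuml; last first.
      by move=> r; rewrite EFinM nnfun_muleindic_ge0.
    over.
  rewrite [RHS]ge0_integral_fsum//; last 2 first.
    - move=> r; apply: emeasurable_funM; last exact/measurable_EFinP.
      by apply/measurable_EFinP; do 2 apply/measurableT_comp => //.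
    - by move=> n x _; rewrite mule_ge0 ?lee_fin// -lee_fin EFinM nnfun_muleindic_ge0.
  apply: eq_fsbigr => r _.
  rewrite integralZl_indic_nnsfun//= integral_indic// setIT nuE//.
  have [r0|r0] := leP 0%R r.
    under [RHS]eq_integral do rewrite EFinM -muleA.
    rewrite ge0_integralZl//; last 2 first.
      - apply: emeasurable_funM; last exact/measurable_EFinP.
        by apply/measurable_EFinP; exact: measurable_indic.
      - by move=> x _; rewrite mule_ge0// lee_fin.
    congr (_ * _); rewrite integral_mkcond; apply: eq_integral => x _.
    by rewrite epatch_indic muleC.
  rewrite preimage_nnfun0// integral_set0 mule0.
  under [RHS]eq_integral do rewrite indic0 mulr0 mul0e.
  by rewrite integral0.
transitivity (limn (fun n => \int[nu]_x (h n x)%:E)).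
  rewrite -monotone_convergence//=.
  - apply: eq_integral => ? _; apply/esym/cvg_lim => //=.
    exact: cvg_nnsfun_approx.
  - by move=> n; exact/measurable_EFinP/measurable_funTS.
  - by move=> n ? _; rewrite lee_fin.
  - by move=> ? _ ? ? mn; rewrite lee_fin; exact/lefP/nd_nnsfun_approx.
transitivity (limn (fun n => \int[mu]_x ((h n x)%:E * (g x)%:E))).
  by apply: congr_lim; apply/funext => n; rewrite nnE.
rewrite -monotone_convergence//=.
- apply: eq_integral => x _; apply/cvg_lim => //.
  by apply: cvgeZr => //; exact: cvg_nnsfun_approx.
- move=> n; apply: emeasurable_funM; last exact/measurable_EFinP.
  exact/measurable_EFinP/measurable_funTS.
- by move=> n x _; rewrite mule_ge0// lee_fin.
- move=> x _ n m nm; rewrite lee_wpmul2r ?lee_fin//.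
  exact/lefP/nd_nnsfun_approx.
Qed.
End density.

Section density_signed.
Context d (T : measurableType d) (R : realType).
Variables (mu nu : {measure set T -> \bar R}) (g : T -> R).
Hypothesis g0 : forall x, (0 <= g x)%R.
Hypothesis mg : measurable_fun setT g.
Hypothesis nuE : forall A, measurable A -> nu A = (\int[mu]_(x in A) (g x)%:E)%E.

Lemma integrable_density (f : T -> R) : nu.-integrable setT (EFin \o f) ->
  mu.-integrable setT (EFin \o (fun x => f x * g x)).
Proof.
move=> /integrableP[mf fi]; apply/integrableP; split.
  by apply/measurable_EFinP; apply: measurable_funM => //; exact/measurable_EFinP.
rewrite (ge0_integral_density g0 mg nuE) in fi => //; last first.
  by apply: measurableT_comp => //.
apply: le_lt_trans fi; apply: ge0_le_integral => //=.
- apply/measurable_EFinP; apply: measurableT_comp => //; apply: measurable_funM => //.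
  exact/measurable_EFinP.
- apply: emeasurable_funM; last exact/measurable_EFinP.
  by apply/measurable_EFinP; apply: measurableT_comp => //; exact/measurable_EFinP.
- by move=> x _; rewrite normrM -EFinM lee_fin (ger0_norm (g0 x)).
Qed.

Lemma Rintegral_density (f : T -> R) : nu.-integrable setT (EFin \o f) ->
  \int[nu]_x f x = \int[mu]_x (f x * g x).
Proof.
move=> fi; have fgi := integrable_density fi.
have mf : measurable_fun setT (EFin \o f) by case/integrableP: fi.
rewrite /Rintegral integralE [in RHS]integralE; congr (fine (_ - _)%E).
- rewrite (ge0_integral_density g0 mg nuE)//; last exact: measurable_funepos.
  apply: eq_integral => x _; rewrite !funeposE /= -EFin_max -EFinM.
  by rewrite -EFin_max; congr EFin; rewrite maxr_pMl// mul0r.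
- rewrite (ge0_integral_density g0 mg nuE)//; last exact: measurable_funeneg.
  apply: eq_integral => x _; rewrite !funenegE /= -!EFin_max -EFinM.
  by congr EFin; rewrite maxr_pMl// mul0r mulNr.
Qed.
End density_signed.

Lemma bounded_integrable d (T : measurableType d) (R : realType)
    (P : probability T R) (f : T -> R) (M : R) :
  measurable_fun setT f -> (forall x, `|f x| <= M) ->
  P.-integrable setT (EFin \o f).
Proof.
move=> mf fM; apply/integrableP; split; first exact/measurable_EFinP.
apply: (@le_lt_trans _ _ (\int[P]_x M%:E)%E).
  apply: ge0_le_integral => //=.
  - exact/measurable_EFinP/measurableT_comp.
  - by move=> x _; rewrite lee_fin.
by rewrite integral_cst//= probability_setT mule1 ltry.
Qed.

Lemma cst_integrable d (T : measurableType d) (R : realType) (P : probability T R) (c : R) :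
  P.-integrable setT (EFin \o cst c).
Proof. exact: (@bounded_integrable _ _ _ _ _ `|c|). Qed.

Section normal_facts.
Context (R : realType) (m s : R).
Hypothesis s0 : 0 < s.
Let N := normal_prob m s.
Let p := normal_pdf m s.
Let leb := @lebesgue_measure R.

Let sn0 : s != 0. Proof. by rewrite gt_eqF. Qed.

(** Completing the square: an exponential weight only shifts the mean. The Laplace transform and the
    decay of the density at infinity are both read off from this. *)
Lemma normal_pdf_tilt (b x : R) :
  expR (b * x) * normal_pdf m s x =
  expR (m * b + s ^+ 2 * b ^+ 2 / 2) * normal_pdf (m + b * s ^+ 2) s x.
Proof.
rewrite !normal_pdfE// /normal_fun mulrCA [RHS]mulrCA -!expRD.
congr (_ * expR _); field.
by rewrite sn0.
Qed.

Lemma normal_mgf (b : R) :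
  (\int[normal_prob m s]_x (expR (b * x))%:E =
   (expR (m * b + s ^+ 2 * b ^+ 2 / 2))%:E)%E.
Proof.
rewrite (@ge0_integral_density _ _ _ leb _ (normal_pdf m s))//; last first.
  by apply/measurable_EFinP; apply: measurableT_comp => //; exact: mulrl_measurable.
- exact: measurable_normal_pdf.
- exact: normal_pdf_ge0.
under eq_integral do rewrite -EFinM normal_pdf_tilt EFinM.
rewrite ge0_integralZl//=.
- by rewrite integral_normal_pdf mule1.
- by apply/measurable_EFinP; exact: measurable_normal_pdf.
- by move=> x _; rewrite lee_fin normal_pdf_ge0.
Qed.

Lemma normal_expR_integrable (b : R) :
  (normal_prob m s).-integrable setT (fun x => (expR (b * x))%:E).
Proof.
apply/integrableP; split.
  by apply/measurable_EFinP; apply: measurableT_comp => //; exact: mulrl_measurable.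
under eq_integral do rewrite gee0_abs ?lee_fin ?expR_ge0//.
by rewrite normal_mgf ltry.
Qed.

(** Growth at most [C * expR |b * x|] is the standing domination: it covers polynomials,
    trigonometric functions and exponentials at once. *)
Lemma normal_expR_norm_integrable (f : R -> R) (C b : R) : measurable_fun setT f ->
  (forall x, `|f x| <= C * expR (`|b * x|)) ->
  (normal_prob m s).-integrable setT (fun x => (f x)%:E).
Proof.
move=> mf fC.
apply: (@le_integrable _ _ _ (normal_prob m s) _ measurableT _ (fun x => (C * (expR (b * x) + expR (- b * x)))%:E)) => //.
- exact/measurable_EFinP.
- move=> x _; rewrite /= lee_fin (le_trans (fC x))// (le_trans _ (ler_norm _))//.
  have C0 : 0 <= C.
    rewrite -(pmulr_lge0 C (expR_gt0 `|b * x|)).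
    by rewrite (le_trans _ (fC x)).
  by rewrite ler_wpM2l// mulNr expR_norm_le.
- exact: (integrableZl measurableT C (integrableD measurableT (normal_expR_integrable b) (normal_expR_integrable (- b)))).
Qed.
End normal_facts.

Section stein.
Context (R : realType) (m s : R).
Hypothesis s0 : 0 < s.
Let sn0 : s != 0. Proof. by rewrite gt_eqF. Qed.
Let leb := @lebesgue_measure R.

Lemma is_derive_normal_pdf (x : R) :
  is_derive x 1 (normal_pdf m s) (- (x - m) / s ^+ 2 * normal_pdf m s x).
Proof.
rewrite !normal_pdfE//.
pose q : R -> R := (- (s ^+ 2 *+ 2)^-1) *: ((id - cst m) ^+ 2).
have qE y : - (y - m) ^+ 2 / (s ^+ 2 *+ 2) = q y.
  have -> : q y = - (s ^+ 2 *+ 2)^-1 * ((y - m) ^+ 2) by [].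
  by rewrite !mulNr mulrC.
have -> : (fun y : R => normal_peak s * normal_fun m s y) =
    normal_peak s *: (expR \o q).
  by apply/funext => y; rewrite /= /normal_fun qE.
have dq : is_derive x 1 q (- (x - m) / s ^+ 2).
  apply: is_derive_eq; rewrite !fctE /=.
  rewrite -[LHS]/(- (s ^+ 2 *+ 2)^-1 * ((2 * (x - m) ^+ 1) * (1 - 0))).
  by field.
have de : is_derive x 1 (expR \o q) (expR (q x) * (- (x - m) / s ^+ 2)).
  exact: is_derive1_comp.
apply: is_derive_eq; rewrite /normal_fun qE /GRing.scale/=.
by ring.
Qed.

(** These are the boundary terms of the integration by parts in [normal_stein]. With [b + 1] in
    place of [b] the product is still bounded, by [normal_pdf_tilt], which leaves a factor
    [expR (- n)]. *)
Lemma expR_normal_pdf_cvg0 (b : R) :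
  expR (b * n%:R) * normal_pdf m s n%:R @[n --> \oo] --> 0 /\
  expR (b * n%:R) * normal_pdf m s (- n%:R) @[n --> \oo] --> 0.
Proof.
have aux (b' : R) : normal_pdf m s b' <= normal_peak s by exact: normal_pdf_ub.
have e0 : expR (- n%:R : R) @[n --> \oo] --> (0 : R).
  have : (expR (- 1) : R) ^+ n @[n --> \oo] --> 0.
    by apply: cvg_expr; rewrite ger0_norm ?expR_ge0// expR_lt1 oppr_lt0.
  by apply: cvg_trans; apply: near_eq_cvg; near=> n; rewrite -expRM_natr mulN1r.
have key (c : R) : exists K : R, 0 <= K /\
    forall y : R, expR (c * y) * normal_pdf m s y <= K.
  exists (expR (m * c + s ^+ 2 * c ^+ 2 / 2) * normal_peak s); split.
    by rewrite mulr_ge0 ?expR_ge0 ?normal_peak_ge0.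
  by move=> y; rewrite normal_pdf_tilt// ler_pM2l ?expR_gt0// normal_pdf_ub.
have gen (c : R) (f : nat -> R) : (forall n, 0 <= f n) ->
    (exists K : R, forall n, expR n%:R * f n <= K) -> f n @[n --> \oo] --> (0 : R).
  move=> f0 [K fK].
  apply: (@squeeze_cvgr _ _ _ _ (fun=> 0) (fun n => K * expR (- n%:R))) => //.
  - near=> n; rewrite f0 /= -(ler_pM2l (expR_gt0 n%:R)).
    by rewrite mulrCA -expRD subrr expR0 mulr1.
  - exact: cvg_cst.
  - by rewrite -[X in _ --> X](mulr0 K); apply: cvgMr.
split; apply: (gen 0).
- by move=> n; rewrite mulr_ge0 ?expR_ge0 ?normal_pdf_ge0.
- have [K [_ HK]] := key (b + 1); exists K => n.
  apply: le_trans (HK n%:R); rewrite mulrA -expRD.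
  by rewrite mulrDl mul1r addrC.
- by move=> n; rewrite mulr_ge0 ?expR_ge0 ?normal_pdf_ge0.
- have [K [_ HK]] := key (- (b + 1)); exists K => n.
  apply: le_trans (HK (- n%:R)); rewrite mulrA -expRD.
  by rewrite mulrNN mulrDl mul1r addrC.
Unshelve. all: by end_near.
Qed.

(** Integration by parts against the density. The mean, the variance and the cosine transform follow
    by taking for [f] the constant 1, [x - m] and a sine. *)
Lemma normal_stein (f df : R -> R) (C b : R) :
  (forall x : R, is_derive x (1 : R) f (df x)) -> continuous df ->
  (forall x, `|f x| <= C * expR `|b * x|) ->
  (forall x, `|df x| <= C * expR `|b * x|) ->
  \int[normal_prob m s]_x ((x - m) * f x) = s ^+ 2 * \int[normal_prob m s]_x df x.
Proof.
move=> fdf cdf fC dfC.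
have cf : continuous f.
  by move=> x; apply/differentiable_continuous/derivable1_diffP; exact: ex_derive.
have mf : measurable_fun setT f by exact: continuous_measurable_fun.
have mdf : measurable_fun setT df by exact: continuous_measurable_fun.
have C0 : 0 <= C.
  by rewrite -(pmulr_lge0 C (expR_gt0 `|b * 0|)) (le_trans _ (fC 0)).
have i1 : (normal_prob m s).-integrable setT (EFin \o (fun x => (x - m) * f x)).
  apply: (@normal_expR_norm_integrable _ m s s0 _ ((1 + `|m|) * C) (`|b| + 1)).
    by apply: measurable_funM => //; exact: measurable_funB.
  move=> x; rewrite normrM -mulrA (mulrC `|x - m|).
  rewrite (le_trans (ler_pM _ _ (fC x) (normB_le_expR_norm m x)))//.
  rewrite [leLHS]mulrCA -!mulrA ler_wpM2l ?addr_ge0// ler_wpM2l// -expRD.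
  by rewrite ler_expR !normrM (ger0_norm (addr_ge0 _ _))// mulrDl mul1r.
have i2 : (normal_prob m s).-integrable setT (EFin \o (fun x => s ^+ 2 * df x)).
  apply: (@normal_expR_norm_integrable _ m s s0 _ (s ^+ 2 * C) b).
    exact: measurable_funM.
  by move=> x; rewrite normrM (ger0_norm (sqr_ge0 _)) -mulrA ler_wpM2l// sqr_ge0.
have i3 : (normal_prob m s).-integrable setT (EFin \o df).
  exact: (@normal_expR_norm_integrable _ m s s0 _ C b).
rewrite -RintegralZl//; apply/eqP; rewrite -subr_eq0 -RintegralB//; apply/eqP.
have i4 := integrableB measurableT i1 i2.
pose h (x : R) : R := ((x - m) * f x - s ^+ 2 * df x) * normal_pdf m s x.
(* [F] is an antiderivative of [h], since [- s ^+ 2] times the logarithmic derivative of the density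
   is [x - m]. *)
pose F (x : R) : R := - s ^+ 2 * (f x * normal_pdf m s x).
have dF (x : R) : is_derive x (1 : R) F (h x).
  have dp := is_derive_normal_pdf x.
  have -> : F = (- s ^+ 2) *: (f * normal_pdf m s) by [].
  apply: is_derive_eq; rewrite /h /GRing.scale/=.
  by field.
have ch : continuous h.
  move=> x; apply: cvgM; last exact: continuous_normal_pdf.
  apply: cvgB; apply: cvgM; [|exact: cf|exact: cvg_cst|exact: cdf].
  by apply: cvgB; [exact: cvg_id|exact: cvg_cst].
have cF : continuous F.
  by move=> x; apply/differentiable_continuous/derivable1_diffP; exact: ex_derive.
rewrite (@Rintegral_density _ _ _ leb _ (normal_pdf m s))//; first last.
- exact: measurable_normal_pdf.
- exact: normal_pdf_ge0.
have ih : leb.-integrable setT (EFin \o h).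
  apply: (@integrable_density _ _ _ leb (normal_prob m s) (normal_pdf m s)) => //.
  - exact: normal_pdf_ge0.
  - exact: measurable_normal_pdf.
have lim1 : (\int[leb]_x ((h \_ `[- n%:R, n%:R]) x)%:E)%E @[n --> \oo] --> (\int[leb]_x (h x)%:E)%E.
  apply: (@dominated_cvg _ _ _ leb setT measurableT _ _ (fun x => `|h x|%:E)) => //.
  - move=> n; apply/measurable_EFinP; apply/(measurable_restrictT _ _).1 => //.
    by apply: measurable_funTS; exact: continuous_measurable_fun.
  - move=> x _; apply: cvg_EFin; first exact: nearW.
    apply: cvg_near_cst.
    near=> n.
    rewrite /= patchE ifT// inE/= in_itv/= -ler_norml.
    by near: n; exact: nbhs_infty_ger.
  - exact: integrable_norm.
  - move=> n x _; rewrite /= lee_fin patchE; case: ifP => // _.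
    by rewrite normr0.
have lim2 : (\int[leb]_x ((h \_ `[- n%:R, n%:R]) x)%:E)%E @[n --> \oo] --> 0%E.
  have e1 : \forall n \near \oo, (F n%:R - F (- n%:R))%:E =
      (\int[leb]_x ((h \_ `[- n%:R, n%:R]) x)%:E)%E.
    near=> n.
    rewrite EFinB -(@continuous_FTC2 _ h F (- n%:R) n%:R).
    - by rewrite [LHS]integral_mkcond restrict_EFin.
    - have n0 : (0 : R) < n%:R by rewrite ltr0n; near: n; exact: nbhs_infty_gt.
      by rewrite (@lt_trans _ _ 0)// oppr_lt0.
    - by apply: continuous_subspaceT.
    - split => //.
      + by apply: cvg_at_right_filter; exact: cF.
      + by apply: cvg_at_left_filter; exact: cF.
    - by move=> x _; rewrite derive1E derive_val.
  apply: cvg_trans; first exact: (near_eq_cvg e1).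
  apply: cvg_EFin; first exact: nearW.
  have Fb (x : R) : `|F x| <= s ^+ 2 * C * (expR (`|b| * `|x|) * normal_pdf m s x).
    rewrite /F normrM normrN (ger0_norm (sqr_ge0 _)) -mulrA ler_wpM2l ?sqr_ge0//.
    rewrite normrM (ger0_norm (normal_pdf_ge0 _ _ _)) mulrA ler_wpM2r ?normal_pdf_ge0//.
    by rewrite -normrM.
  have [c1 c2] := expR_normal_pdf_cvg0 `|b|.
  have F0 : F n%:R @[n --> \oo] --> 0.
    apply: norm_cvg0.
    apply: (@squeeze_cvgr _ _ _ _ (fun=> 0) (fun n => s ^+ 2 * C * (expR (`|b| * n%:R) * normal_pdf m s n%:R))) => //.
    - by near=> n; rewrite normr_ge0/= (le_trans (Fb _))// normr_nat.
    - exact: cvg_cst.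
    - by rewrite -[X in _ --> X](mulr0 (s ^+ 2 * C)); apply: cvgMr.
  have F1 : F (- n%:R) @[n --> \oo] --> 0.
    apply: norm_cvg0.
    apply: (@squeeze_cvgr _ _ _ _ (fun=> 0) (fun n => s ^+ 2 * C * (expR (`|b| * n%:R) * normal_pdf m s (- n%:R)))) => //.
    - by near=> n; rewrite normr_ge0/= (le_trans (Fb _))// normrN normr_nat.
    - exact: cvg_cst.
    - by rewrite -[X in _ --> X](mulr0 (s ^+ 2 * C)); apply: cvgMr.
  by rewrite -[X in _ --> X](subr0 0); apply: cvgB.
have := cvg_unique _ lim1 lim2.
by rewrite /Rintegral => ->.
Unshelve. all: by end_near.
Qed.
End stein.

(** The integrating factor [expR (k * t ^+ 2 / 2)] turns the solution into a constant. *)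
Lemma gaussian_ode (R : realType) (y : R -> R) (k : R) :
  (forall t : R, is_derive t (1 : R) y (- (k * t) * y t)) ->
  forall t, y t = y 0 * expR (- (k * t ^+ 2 / 2)).
Proof.
move=> dy t.
pose q : R -> R := (k / 2) *: (id ^+ 2).
have dq (x : R) : is_derive x (1 : R) q (k * x).
  apply: is_derive_eq.
  rewrite -[LHS]/(k / 2 * ((2 * x ^+ 1) * 1)).
  by field.
have de (x : R) : is_derive x (1 : R) (expR \o q) (expR (q x) * (k * x)).
  exact: is_derive1_comp.
have dz (x : R) : is_derive x (1 : R) (y * (expR \o q)) 0.
  apply: is_derive_eq.
  rewrite -[LHS]/(y x * (expR (q x) * (k * x)) + expR (q x) * (- (k * x) * y x)).
  by ring.
have := @is_derive_0_is_cst _ _ t 0 dz.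
rewrite -[LHS]/(y t * expR (q t)) -[X in _ = X -> _]/(y 0 * expR (q 0)).
have -> : q 0 = 0 by rewrite -[LHS]/(k / 2 * 0 ^+ 2) expr0n mulr0.
have -> : q t = k * t ^+ 2 / 2 by rewrite -[LHS]/(k / 2 * t ^+ 2); ring.
by rewrite expR0 mulr1 expRN => <-; rewrite mulfK// gt_eqF// expR_gt0.
Qed.

Lemma measurable_cos_comp d (T : measurableType d) (R : realType) (f : T -> R) :
  measurable_fun setT f -> measurable_fun setT (fun x => cos (f x)).
Proof.
by apply: measurableT_comp; apply: continuous_measurable_fun; exact: continuous_cos.
Qed.

Lemma measurable_sin_comp d (T : measurableType d) (R : realType) (f : T -> R) :
  measurable_fun setT f -> measurable_fun setT (fun x => sin (f x)).
Proof.
by apply: measurableT_comp; apply: continuous_measurable_fun; exact: continuous_sin.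
Qed.

Lemma norm_cos_le1 (R : realType) (x : R) : `|cos x| <= 1.
Proof. by rewrite ler_norml cos_geN1 cos_le1. Qed.

Lemma norm_sin_le1 (R : realType) (x : R) : `|sin x| <= 1.
Proof. by rewrite ler_norml sin_geN1 sin_le1. Qed.

#[local] Hint Resolve norm_cos_le1 norm_sin_le1 : core.

Section normal_moments.
Context (R : realType) (m s : R).
Hypothesis s0 : 0 < s.

Lemma normal_id_integrable :
  (normal_prob m s).-integrable setT (fun x : R => x%:E).
Proof.
apply: (@normal_expR_norm_integrable R m s s0 _ 1 1); first exact: measurable_id.
by move=> x; rewrite !mul1r le_expR_norm.
Qed.

Lemma normal_mean : \int[normal_prob m s]_x x = m.
Proof.
have := @normal_stein R m s s0 (cst 1) (cst 0) 1 1 _ _ _ _.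
move=> /(_ _ _ _ _)/wrap[].
- by move=> x; exact: cvg_cst.
- by move=> x; rewrite normr1 !mul1r ge1_expR_norm.
- by move=> x; rewrite normr0 mulr_ge0// expR_ge0.
under eq_Rintegral do rewrite mulr1.
rewrite RintegralB//; last 2 first.
- exact: normal_id_integrable.
- by apply: cst_integrable => //.
rewrite !Rintegral_cst//= probability_setT mul0r mulr0 mulr1.
by move/eqP; rewrite subr_eq0 => /eqP.
Qed.

Lemma normal_variance : \int[normal_prob m s]_x ((x - m) ^+ 2) = s ^+ 2.
Proof.
have := @normal_stein R m s s0 (id - cst m : R -> R) (cst 1) (1 + `|m|) 1 _ _ _ _.
move=> /(_ _ _ _ _)/wrap[].
- by move=> x; apply: is_derive_eq; rewrite subr0.
- by move=> x; exact: cvg_cst.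
- by move=> x; rewrite mul1r normB_le_expR_norm.
- by move=> x; rewrite normr1 mul1r mulr_ege1// ?lerDl// ge1_expR_norm.
under eq_Rintegral do rewrite -expr2.
by move=> ->; rewrite Rintegral_cst//= probability_setT !mulr1.
Qed.

Let N := normal_prob 0 s.

Let is_derive_affine (a b x : R) : is_derive x (1 : R) (fun y : R => a * y - b) a.
Proof.
rewrite (_ : (fun y => _) = a *: (id : R -> R) - cst b); last by apply/funext.
by apply: is_derive_eq; rewrite /GRing.scale/= mulr1 subr0.
Qed.

Let measurable_affine (a b : R) : measurable_fun setT (fun y : R => a * y - b).
Proof. by apply: measurable_funB => //; exact: mulrl_measurable. Qed.

Let is_derive_int (th t : R) :
  is_derive t (1 : R) (fun t => \int[N]_x cos (t * x - th)) (\int[N]_x (- sin (t * x - th) * x)).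
Proof.
pose f t x : R := cos (t * x - th).
have d1 (x y : R) : is_derive x (1 : R) (f^~ y) (- sin (x * y - th) * y).
  rewrite (_ : f^~ y = cos \o (fun t => y * t - th)) 1?mulrC; last first.
    by apply/funext => u; rewrite /f/= mulrC.
  by rewrite (mulrC x) mulrC; exact: is_derive1_comp.
have tI : `]t - 1, t + 1[%classic t by rewrite /= in_itv/= ltrBlDr ltrDl ltr01.
have hyp1 := @derivable_under_integral R _ _ N f setT measurableT t (t - 1) (t + 1) tI.
have hyp2 := @differentiation_under_integral R _ _ N f setT measurableT t (t - 1) (t + 1) tI.
have G0 : forall y : R, 0 <= `|y| by [].
have Gi : N.-integrable setT (EFin \o (fun y : R => `|y|)).
  apply: (@normal_expR_norm_integrable R 0 s s0 _ 1 1); first exact: normr_measurable.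
  by move=> x; rewrite !mul1r normr_id le_expR_norm.
have dd : forall x y : R, `]t - 1, t + 1[%classic x -> setT y -> derivable (f^~ y) x 1.
  by move=> x y _ _; exact: ex_derive.
have db : forall x y : R, `]t - 1, t + 1[%classic x -> setT y -> `|(f^~ y)^`()%classic x| <= `|y|.
  by move=> x y _ _; rewrite derive1E derive_val normrM normrN ler_piMl// norm_sin_le1.
have fi u : N.-integrable setT (EFin \o f u).
  apply: (@bounded_integrable _ _ _ _ _ 1) => [|x]; last exact: norm_cos_le1.
  exact: (measurable_cos_comp (measurable_affine u th)).
apply: DeriveDef; first exact: (hyp1 _ dd _ G0 Gi db).
rewrite -derive1E (hyp2 _ dd _ G0 Gi db)//.
by apply: eq_Rintegral => y _; rewrite /partial1of2 derive1E derive_val.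
Qed.

(** Differentiation under the integral, followed by Stein's identity for the sine, gives the
    equation of [gaussian_ode] with [k = s ^+ 2]; the value at [t = 0] is [cos th]. *)
Lemma normal_cos (t th : R) :
  \int[normal_prob 0 s]_x cos (t * x - th) = cos th * expR (- (s ^+ 2 * t ^+ 2 / 2)).
Proof.
transitivity ((\int[N]_x cos (0 * x - th)) * expR (- (s ^+ 2 * t ^+ 2 / 2))); last first.
  under eq_Rintegral do rewrite mul0r sub0r cosN.
  by rewrite Rintegral_cst//= probability_setT mulr1.
apply: (@gaussian_ode _ (fun t => \int[N]_x cos (t * x - th)) (s ^+ 2)) => {}t.
apply: is_derive_eq; first exact: is_derive_int.
have := @normal_stein R 0 s s0 (fun x => sin (t * x - th)) (fun x => cos (t * x - th) * t) (1 + `|t|) 1 _ _ _ _.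
move=> /(_ _ _ _ _)/wrap[].
- by move=> x; exact: is_derive1_comp.
- move=> x; apply: cvgM; last exact: cvg_cst.
  apply: continuous_comp; last exact: continuous_cos.
  by apply: cvgB; [exact: mulrl_continuous|exact: cvg_cst].
- move=> x; rewrite (@le_trans _ _ 1) ?norm_sin_le1//.
  by rewrite mulr_ege1// ?lerDl// ge1_expR_norm.
- move=> x; rewrite normrM (@le_trans _ _ `|t|) ?ler_piMl ?norm_cos_le1//.
  by rewrite (@le_trans _ _ (1 + `|t|))// ?lerDr// ler_peMr// ?addr_ge0// ge1_expR_norm.
under eq_Rintegral do rewrite subr0.
rewrite RintegralZr//; last first.
  by apply: (@bounded_integrable _ _ _ _ _ 1) => //; apply: measurable_cos_comp; exact: measurable_affine.
move=> e; rewrite mulNr -mulrA (mulrC t) -e.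
rewrite (_ : (fun x : R => _) = (fun x => (- 1) * (x * sin (t * x - th)))).
  rewrite RintegralZl ?mulN1r//.
  apply: (@normal_expR_norm_integrable R 0 s s0 _ 1 1).
    by apply: measurable_funM => //; apply: measurable_sin_comp; exact: measurable_affine.
  by move=> x; rewrite normrM !mul1r (le_trans _ (le_expR_norm _))// ler_piMr// norm_sin_le1.
by apply/funext => x; rewrite mulN1r mulrC mulrN.
Qed.
End normal_moments.

(** * Centered Gaussian variables *)

(* [X] is a centered Gaussian variable of variance [v], possibly degenerate. The phase [th]
   encodes the cosine and the sine transform at once. *)
Definition cgauss d (T : measurableType d) (R : realType) (P : probability T R)
    (X : T -> R) (v : R) : Prop :=
  [/\ measurable_fun setT X,
      forall a th, \int[P]_w cos (a * X w - th) = cos th * expR (- (v * a ^+ 2 / 2)) &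
      forall a, (\int[P]_w (expR (a * X w))%:E = (expR (v * a ^+ 2 / 2))%:E)%E].

Section law_transfer.
Context d (T : measurableType d) (R : realType) (P : probability T R).
Context (X : T -> R) (N : {measure set (measurableTypeR R) -> \bar R}).
Hypothesis mX : measurable_fun setT X.
Hypothesis XN : forall A : set R, measurable A -> P (X @^-1` A) = N A.

Lemma ge0_integral_law (f : R -> \bar R) : (forall x, 0 <= f x)%E ->
  measurable_fun setT f -> (\int[P]_w f (X w) = \int[N]_x f x)%E.
Proof.
move=> f0 mf.
have := @ge0_integral_pushforward _ _ T (measurableTypeR R) R X mX P setT f measurableT mf _.
move=> /(_ _)/wrap[]; first by move=> x _; exact: f0.
rewrite preimage_setT => <-.
by apply: eq_measure_integral => A mA _; exact: XN.
Qed.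

Lemma integrable_law (f : R -> R) : N.-integrable setT (EFin \o f) ->
  P.-integrable setT (EFin \o (f \o X)).
Proof.
move=> /integrableP[mf fi]; apply/integrableP; split.
  exact: measurableT_comp mf mX.
have := @ge0_integral_law (fun x => `|(f x)%:E|%E) _ _.
by move=> /(_ _ _)/wrap[]//; [exact: measurableT_comp | move=> /= ->].
Qed.

Lemma Rintegral_law (f : R -> R) : N.-integrable setT (EFin \o f) ->
  \int[P]_w f (X w) = \int[N]_x f x.
Proof.
move=> fi; have fXi := integrable_law fi.
have mf : measurable_fun setT (EFin \o f) by case/integrableP : fi.
have := @integral_pushforward _ _ T (measurableTypeR R) R X mX P setT (EFin \o f) mf.
rewrite preimage_setT => /(_ fXi measurableT) e.
rewrite /Rintegral; congr fine; rewrite -[LHS]e.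
by apply: eq_measure_integral => A mA _; exact: XN.
Qed.
End law_transfer.

Section cgauss_of_gaussian.
Context d (T : measurableType d) (R : realType) (P : probability T R).

(** The variance is expressed as the integral of [X ^+ 2], so the parameters of the normal law
    disappear. In the degenerate case the centering forces the constant to be 0. *)
Lemma gaussian_rv_cgauss (X : T -> R) : measurable_fun setT X ->
  gaussian_rv P X -> (\int[P]_w (X w)%:E = 0)%E ->
  P.-integrable setT (EFin \o (fun w => X w ^+ 2)) /\
  cgauss P X (\int[P]_w X w ^+ 2).
Proof.
move=> mX + EX; case=> [[m Xm]|[m [s [s0 XN]]]].
  have ae_int (f : R -> R) : measurable_fun setT f ->
      (\int[P]_w (f (X w))%:E = (f m)%:E)%E.
    move=> mf; rewrite (ae_eq_integral (cst (f m)%:E))//=.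
    - by rewrite integral_cst//= probability_setT mule1.
    - by apply/measurable_EFinP; exact: measurableT_comp.
    - by case: Xm => A [mA A0 XA]; exists A; split => // w /= /not_implyP[_ h]; apply: XA => /= wm; apply: h; rewrite wm.
  have m0 : m = 0.
    by have := ae_int id (@measurable_id _ _ _); rewrite EX => -[].
  rewrite {}m0 in Xm ae_int.
  have m2 : measurable_fun setT (fun x : R => x ^+ 2) by exact: exprn_measurable.
  have e2 : \int[P]_w X w ^+ 2 = 0.
    by rewrite /Rintegral (ae_int _ m2) expr0n.
  rewrite e2; split.
    apply/integrableP; split.
      by apply/measurable_EFinP; exact: (measurableT_comp m2).
    under eq_integral do rewrite /= ger0_norm ?sqr_ge0//.
    by rewrite (ae_int _ m2) ltry.
  split => //.
  - move=> a th; rewrite /Rintegral (ae_int (fun x => cos (a * x - th))).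
      by rewrite mulr0 sub0r cosN !mul0r oppr0 expR0 mulr1.
    by apply: measurable_cos_comp; apply: measurable_funB => //; exact: mulrl_measurable.
  - move=> a; rewrite (ae_int (fun x => expR (a * x))).
      by rewrite mulr0 !mul0r expR0.
    by apply: measurableT_comp => //; exact: mulrl_measurable.
have m0 : m = 0.
  have := @Rintegral_law _ _ _ P X (normal_prob m s) mX XN _ (@normal_id_integrable R m s s0).
  by rewrite normal_mean// /Rintegral EX.
rewrite {}m0 in XN.
have i2 : (normal_prob 0 s).-integrable setT (EFin \o (fun x : R => x ^+ 2)).
  apply: (@normal_expR_norm_integrable R 0 s s0 _ 1 2); first exact: exprn_measurable.
  move=> x; rewrite !mul1r normrX normrM [`|2|]gtr0_norm// mulrDl mul1r expRD.
  by rewrite expr2 ler_pM// le_expR_norm.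
have e2 : \int[P]_w X w ^+ 2 = s ^+ 2.
  rewrite (@Rintegral_law _ _ _ P X (normal_prob 0 s) mX XN _ i2) -(normal_variance 0 s0).
  by apply: eq_Rintegral => x _; rewrite subr0.
rewrite e2; split; first exact: (@integrable_law _ _ _ P X (normal_prob 0 s) mX XN _ i2).
split => //.
- move=> a th; rewrite (@Rintegral_law _ _ _ P X (normal_prob 0 s) mX XN (fun x => cos (a * x - th))).
    by rewrite normal_cos.
  apply: (@bounded_integrable _ _ _ _ _ 1) => //.
  by apply: measurable_cos_comp; apply: measurable_funB => //; exact: mulrl_measurable.
- move=> a; rewrite (@ge0_integral_law _ _ _ P X (normal_prob 0 s) mX XN (fun x => (expR (a * x))%:E)).
  + by rewrite normal_mgf// mul0r add0r.
  + by move=> x; rewrite lee_fin expR_ge0.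
  + by apply/measurable_EFinP; apply: measurableT_comp => //; exact: mulrl_measurable.
Qed.
End cgauss_of_gaussian.

Section cgauss_theory.
Context d (T : measurableType d) (R : realType) (P : probability T R).

Lemma cgauss_expR_integrable (X : T -> R) v (a : R) : cgauss P X v ->
  P.-integrable setT (fun w => (expR (a * X w))%:E).
Proof.
case=> mX _ h; apply/integrableP; split.
  by apply/measurable_EFinP; apply: measurableT_comp => //; exact: measurable_funM.
under eq_integral do rewrite gee0_abs ?lee_fin ?expR_ge0//.
by rewrite h ltry.
Qed.

Lemma cgauss_expR_norm (X : T -> R) v (a : R) : cgauss P X v ->
  (\int[P]_w (expR `|a * X w|)%:E <= (2 * expR (v * a ^+ 2 / 2))%:E)%E.
Proof.
move=> gX; have [mX _ h] := gX.
apply: (@le_trans _ _ (\int[P]_w ((expR (a * X w))%:E + (expR (- a * X w))%:E))%E).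
  apply: ge0_le_integral => //=.
  - apply/measurable_EFinP; apply: measurableT_comp => //.
    by apply: measurableT_comp => //; exact: measurable_funM.
  - by apply: emeasurable_funD; apply: measurable_int; apply: cgauss_expR_integrable gX.
  - by move=> w _; rewrite -EFinD lee_fin mulNr expR_norm_le.
rewrite integralD//; try exact: cgauss_expR_integrable gX.
by rewrite !h sqrrN -EFinD lee_fin mulr_natl mulr2n.
Qed.

Lemma cgauss_expR_norm_integrable (X : T -> R) v (a : R) : cgauss P X v ->
  P.-integrable setT (fun w => (expR `|a * X w|)%:E).
Proof.
move=> gX; have [mX _ _] := gX; apply/integrableP; split.
  apply/measurable_EFinP; apply: measurableT_comp => //.
  by apply: measurableT_comp => //; exact: measurable_funM.
under eq_integral do rewrite gee0_abs ?lee_fin ?expR_ge0//.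
by rewrite (le_lt_trans (cgauss_expR_norm _ gX))// ltry.
Qed.

Lemma cgauss_integrable (X : T -> R) v : cgauss P X v ->
  P.-integrable setT (EFin \o X).
Proof.
move=> gX; have [mX _ _] := gX.
apply: (le_integrable _ _ _ (cgauss_expR_norm_integrable 1 gX)) => //.
  exact/measurable_EFinP.
by move=> w _; rewrite /= lee_fin (ger0_norm (expR_ge0 _)) mul1r le_expR_norm.
Qed.
End cgauss_theory.

(** * Independence of uncorrelated Gaussian variables *)

Section real_integrable.
Context d (T : measurableType d) (R : realType) (mu : {measure set T -> \bar R}).
Implicit Types f g : T -> R.

Lemma integrable_addR f g : mu.-integrable setT (EFin \o f) ->
  mu.-integrable setT (EFin \o g) -> mu.-integrable setT (EFin \o (fun x => f x + g x)).
Proof. by move=> fi gi; exact: (integrableD measurableT fi gi). Qed.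

Lemma integrable_subR f g : mu.-integrable setT (EFin \o f) ->
  mu.-integrable setT (EFin \o g) -> mu.-integrable setT (EFin \o (fun x => f x - g x)).
Proof. by move=> fi gi; exact: (integrableB measurableT fi gi). Qed.

Lemma integrable_mulR (k : R) f : mu.-integrable setT (EFin \o f) ->
  mu.-integrable setT (EFin \o (fun x => k * f x)).
Proof. by move=> fi; exact: (integrableZl measurableT k fi). Qed.
End real_integrable.

Section Rfubini.
Context d1 d2 (T1 : measurableType d1) (T2 : measurableType d2) (R : realType).
Variables (m1 : {sigma_finite_measure set T1 -> \bar R}).
Variables (m2 : {sigma_finite_measure set T2 -> \bar R}).

Lemma Rintegral12 (f : T1 * T2 -> R) :
  (m1 \x m2)%E.-integrable setT (EFin \o f) ->
  (forall x, m2.-integrable setT (fun y => (f (x, y))%:E)) ->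
  \int[m1]_x \int[m2]_y f (x, y) = \int[(m1 \x m2)%E]_z f z.
Proof.
move=> fi fx; rewrite /Rintegral; congr fine.
rewrite -(integral12_prod_meas1 fi); apply: eq_integral => x _.
by rewrite fineK//; apply: integrable_fin_num.
Qed.

Lemma Rintegral21 (f : T1 * T2 -> R) :
  (m1 \x m2)%E.-integrable setT (EFin \o f) ->
  (forall y, m1.-integrable setT (fun x => (f (x, y))%:E)) ->
  \int[m2]_y \int[m1]_x f (x, y) = \int[(m1 \x m2)%E]_z f z.
Proof.
move=> fi fx; rewrite /Rintegral; congr fine.
rewrite -(integral21_prod_meas1 fi); apply: eq_integral => x _.
by rewrite fineK//; apply: integrable_fin_num.
Qed.
End Rfubini.

Section trig_uniqueness.
Context d (T : measurableType d) (R : realType) (P : probability T R).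
Variables (h Z : T -> R) (M : R).
Hypotheses (mh : measurable_fun setT h) (hM : forall w, `|h w| <= M).
Hypothesis mZ : measurable_fun setT Z.
Hypothesis hcos : forall a th, \int[P]_w (h w * cos (a * Z w - th)) = 0.

Hypothesis M0 : 0 <= M.

Let bounded_h (f : T -> R) (C : R) : measurable_fun setT f ->
  (forall w, `|f w| <= C) -> P.-integrable setT (EFin \o (fun w => h w * f w)).
Proof.
move=> mf fC; apply: (@bounded_integrable _ _ _ _ _ (M * C)).
  exact: measurable_funM.
by move=> w; rewrite normrM ler_pM.
Qed.

(* A Gaussian density is a superposition of cosines. *)
Let bump (x s : R) : 0 < s ->
  \int[P]_w (h w * normal_pdf (Z w) s x) = 0.
Proof.
move=> s0; have si0 : 0 < s^-1 by rewrite invr_gt0.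
have key : \int[P]_w (h w * expR (- ((s^-1) ^+ 2 * (x - Z w) ^+ 2 / 2))) = 0.
  have nc w := normal_cos si0 (x - Z w) 0; rewrite cos0 in nc.
  under eq_Rintegral => w _ do rewrite -[expR _]mul1r -nc.
  pose N := normal_prob 0 (s^-1).
  pose f (z : T * measurableTypeR R) : R := h z.1 * cos ((x - Z z.1) * z.2 - 0).
  have mf : measurable_fun setT f.
    apply: measurable_funM.
      exact: (measurableT_comp mh measurable_fst).
    apply: measurable_cos_comp; apply: measurable_funB => //.
    apply: measurable_funM; last exact: measurable_snd.
    by apply: measurable_funB => //; exact: (measurableT_comp mZ measurable_fst).
  have fM z : `|f z| <= M.
    rewrite normrM -[leRHS]mulr1 ler_pM// norm_cos_le1//.
  have fi : (P \x N)%E.-integrable setT (EFin \o f).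
    exact: (@bounded_integrable _ _ _ (P \x N)%E _ M).
  have fi1 w : N.-integrable setT (fun y => (f (w, y))%:E).
    apply: (@bounded_integrable _ _ _ N (fun y => f (w, y)) M) => //.
    exact: (measurableT_comp mf (measurable_pair1 w)).
  have fi2 y : P.-integrable setT (fun w => (f (w, y))%:E).
    apply: (@bounded_integrable _ _ _ P (fun w => f (w, y)) M) => //.
    exact: (measurableT_comp mf (measurable_pair2 y)).
  transitivity (\int[P]_w \int[N]_y f (w, y)).
    apply: eq_Rintegral => w _; rewrite -RintegralZl//.
    apply: (@bounded_integrable _ _ _ N _ 1) => //; apply: measurable_cos_comp.
    by apply: measurable_funB => //; exact: mulrl_measurable.
  rewrite (Rintegral12 fi fi1) -(Rintegral21 fi fi2).
  rewrite (_ : (fun y => _) = cst 0); first by rewrite Rintegral_cst// mul0r.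
  apply/funext => y /=.
  rewrite -(hcos y (y * x)); apply: eq_Rintegral => w _; rewrite /f/= -[in RHS]cosN.
  by congr (_ * cos _); ring.
transitivity (\int[P]_w (normal_peak s * (h w * expR (- ((s^-1) ^+ 2 * (x - Z w) ^+ 2 / 2))))).
  apply: eq_Rintegral => w _; rewrite normal_pdfE ?gt_eqF// /normal_fun mulrCA.
  congr (_ * (_ * expR _)); field.
  by rewrite gt_eqF.
rewrite RintegralZl ?key ?mulr0//.
apply: (bounded_h (C := 1)).
  apply: measurableT_comp => //; apply: measurableT_comp => //.
  apply: measurable_funM => //; apply: measurable_funM => //.
  by apply: measurable_funX; exact: measurable_funB.
move=> w; rewrite ger0_norm ?expR_ge0// -expR0 ler_expR oppr_le0.
by rewrite divr_ge0// mulr_ge0// sqr_ge0.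
Qed.

Let normal_abs (m s : R) : 0 < s -> \int[normal_prob m s]_x `|x - m| <= s.
Proof.
move=> s0.
have i2 : (normal_prob m s).-integrable setT (EFin \o (fun x : R => (x - m) ^+ 2)).
  apply: (@normal_expR_norm_integrable R m s s0 _ ((1 + `|m|) ^+ 2) 2).
    by apply: measurable_funX; exact: measurable_funB.
  move=> x; rewrite normrX normrM [`|2|]gtr0_norm// mulrDl mul1r expRD -expr2 -exprMn.
  by rewrite !expr2 ler_pM ?normB_le_expR_norm.
(* The inequality [|y| <= s / 2 + y ^+ 2 / (2 * s)], an equality at [|y| = s], reduces the first
   absolute moment to the variance. *)
apply: (@le_trans _ _ (\int[normal_prob m s]_x (s / 2 + (2 * s)^-1 * (x - m) ^+ 2))).
  apply: le_Rintegral => //.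
  - apply: (@normal_expR_norm_integrable R m s s0 _ (1 + `|m|) 1).
      by apply: measurableT_comp => //; exact: measurable_funB.
    by move=> x; rewrite mul1r normr_id normB_le_expR_norm.
  - apply: integrable_addR; last exact: integrable_mulR.
    exact: cst_integrable.
  - move=> x _; rewrite -(ler_pM2l (mulr_gt0 (ltr0Sn _ 1) s0)) mulrDr mulVKf ?gt_eqF ?mulr_gt0//.
    by rewrite -real_normK ?num_real//; have := sqr_ge0 (`|x - m| - s); nra.
rewrite RintegralD//; last 2 first.
- exact: cst_integrable.
- exact: integrable_mulR.
rewrite Rintegral_cst//= probability_setT RintegralZl// normal_variance// mulr1.
rewrite (_ : _ + _ = s)//; field.
by rewrite gt_eqF.
Qed.

(** Convolution with a Gaussian kernel of width [s] turns [phi] into a superposition of bumps,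
    against which [h] integrates to 0, and moves [phi] by at most [L * s]. Then [s] tends to 0. *)
Lemma trig_unique_lipschitz (phi : R -> R) (C L : R) : measurable_fun setT phi ->
  (forall x, `|phi x| <= C) ->
  (forall x y, `|phi x - phi y| <= L * `|x - y|) ->
  \int[P]_w (h w * phi (Z w)) = 0.
Proof.
move=> mphi phiC phiL.
have L0 : 0 <= L.
  by have := phiL 1 0; rewrite subr0 normr1 mulr1; exact: le_trans.
have C0 : 0 <= C by apply: le_trans (phiC 0).
suff H s : 0 < s -> `|\int[P]_w (h w * phi (Z w))| <= M * (L * s).
  apply/eqP; rewrite -normr_eq0 eq_le normr_ge0 andbT.
  apply/ler_addgt0Pr => e e0; rewrite add0r.
  have ML1 : 0 < M * L + 1 by rewrite ltr_wpDl// mulr_ge0// M0.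
  apply: (le_trans (H (e / (M * L + 1)) _)); first by rewrite divr_gt0.
  by rewrite !mulrA ler_pdivrMr// mulrC ler_pM2l// lerDl.
move=> s0.
pose leb := @lebesgue_measure R.
pose Phi w := \int[normal_prob (Z w) s]_x phi x.
have iphi m : (normal_prob m s).-integrable setT (EFin \o phi).
  exact: (@bounded_integrable _ _ _ _ _ C).
have PhiE w : Phi w = \int[leb]_x (phi x * normal_pdf (Z w) s x).
  rewrite /Phi (@Rintegral_density _ _ _ leb _ (normal_pdf (Z w) s))//.
  - exact: normal_pdf_ge0.
  - exact: measurable_normal_pdf.
  - exact: iphi.
have mp : measurable_fun setT (fun z : T * measurableTypeR R => normal_pdf (Z z.1) s z.2).
  rewrite (_ : (fun z => _) = (fun z => normal_peak s * expR (- (z.2 - Z z.1) ^+ 2 / (s ^+ 2 *+ 2)))); last first.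
    by apply/funext => z; rewrite normal_pdfE ?gt_eqF.
  apply: measurable_funM => //; apply: measurableT_comp => //.
  apply: measurable_funM => //; apply: measurableT_comp => //; apply: measurable_funX.
  by apply: measurable_funB; [exact: measurable_snd|exact: (measurableT_comp mZ measurable_fst)].
pose F (g : T -> R) (z : T * measurableTypeR R) : R := g z.1 * (phi z.2 * normal_pdf (Z z.1) s z.2).
have mF g : measurable_fun setT g -> measurable_fun setT (F g).
  move=> mg; apply: measurable_funM; first exact: (measurableT_comp mg measurable_fst).
  by apply: measurable_funM => //; exact: (measurableT_comp mphi measurable_snd).
have Fub (g : T -> R) (K : R) : (forall w, `|g w| <= K) ->
    forall z, `|F g z| <= K * C * normal_pdf (Z z.1) s z.2.
  move=> gK z; rewrite !normrM (ger0_norm (normal_pdf_ge0 _ _ _)) mulrA.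
  by rewrite ler_wpM2r ?normal_pdf_ge0// ler_pM.
have Fi (g : T -> R) (K : R) : measurable_fun setT g -> (forall w, `|g w| <= K) -> 0 <= K ->
    (P \x leb)%E.-integrable setT (EFin \o F g).
  move=> mg gK K0; have KC0 : 0 <= K * C by rewrite mulr_ge0.
  apply/integrable12ltyP; first by apply/measurable_EFinP; exact: mF.
  apply: (@le_lt_trans _ _ (\int[P]_w (K * C)%:E)%E); last first.
    by rewrite integral_cst//= probability_setT mule1 ltry.
  apply: ge0_le_integral => //.
  - by move=> w _; exact: integral_ge0.
  - apply: (@measurable_fun_fubini_tonelli_F _ _ _ _ _ leb (fun z => `|(F g z)%:E|%E)) => //.
    by apply: measurableT_comp => //; apply/measurable_EFinP; exact: mF.
  - move=> w _; apply: (@le_trans _ _ (\int[leb]_y ((K * C)%:E * (normal_pdf (Z w) s y)%:E))%E).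
      apply: ge0_le_integral => //.
      + apply: measurableT_comp => //; apply/measurable_EFinP.
        exact: (measurableT_comp (mF g mg) (measurable_pair1 w)).
      + apply: emeasurable_funM => //; apply/measurable_EFinP; exact: measurable_normal_pdf.
      + by move=> y _; rewrite -EFinM lee_fin (Fub g K).
    rewrite ge0_integralZl//=.
    + by rewrite integral_normal_pdf mule1.
    + by apply/measurable_EFinP; exact: measurable_normal_pdf.
    + by move=> y _; rewrite lee_fin normal_pdf_ge0.
have MC0 : 0 <= M * C by rewrite mulr_ge0.
pose f := F h; have mf := mF h mh; have fi := Fi h M mh hM M0.
have fub := Fub h M hM.
have fi1 w : leb.-integrable setT (fun y => (f (w, y))%:E).
  apply: (@integrable_mulR _ _ _ leb (h w) (fun y => phi y * normal_pdf (Z w) s y)).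
  apply: (@integrable_density _ _ _ leb (normal_prob (Z w) s) (normal_pdf (Z w) s)) => //.
  - exact: normal_pdf_ge0.
  - exact: measurable_normal_pdf.
  - exact: iphi.
have fi2 y : P.-integrable setT (fun w => (f (w, y))%:E).
  apply: (@bounded_integrable _ _ _ P (fun w => f (w, y)) (M * C * normal_peak s)) => //.
    exact: (measurableT_comp mf (measurable_pair2 y)).
  by move=> w; rewrite (le_trans (fub _))// ler_wpM2l//= normal_pdf_ub// gt_eqF.
have mPhi : measurable_fun setT Phi.
  have i1 : (P \x leb)%E.-integrable setT (EFin \o F (cst 1)).
    by apply: (Fi _ 1) => // w; rewrite normr1.
  rewrite (_ : Phi = fine \o (fubini_F leb (EFin \o F (cst 1)))).
    by apply: measurableT_comp => //; exact: measurable_fubini_F i1.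
  apply/funext => w; rewrite PhiE /Rintegral /=; congr fine.
  by apply: eq_integral => x _; rewrite /= /F mul1r.
have Phi0 : \int[P]_w (h w * Phi w) = 0.
  transitivity (\int[P]_w \int[leb]_y f (w, y)).
    apply: eq_Rintegral => w _; rewrite PhiE -RintegralZl//.
    apply: (@integrable_density _ _ _ leb (normal_prob (Z w) s) (normal_pdf (Z w) s)) => //.
    - exact: normal_pdf_ge0.
    - exact: measurable_normal_pdf.
    - exact: iphi.
  rewrite (Rintegral12 fi fi1) -(Rintegral21 fi fi2).
  rewrite (_ : (fun y => _) = cst 0); first by rewrite Rintegral_cst// mul0r.
  apply/funext => y /=.
  transitivity (\int[P]_w (phi y * (h w * normal_pdf (Z w) s y))).
    by apply: eq_Rintegral => w _; rewrite /f/= mulrCA.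
  rewrite RintegralZl ?bump ?mulr0//.
  apply: (bounded_h (C := normal_peak s)).
    exact: (measurableT_comp mp (measurable_pair2 y)).
  by move=> w; rewrite ger0_norm ?normal_pdf_ge0// normal_pdf_ub// gt_eqF.
have PhiL w : `|phi (Z w) - Phi w| <= L * s.
  have -> : phi (Z w) = \int[normal_prob (Z w) s]_x phi (Z w).
    by rewrite Rintegral_cst//= probability_setT mulr1.
  have ic : (normal_prob (Z w) s).-integrable setT (EFin \o cst (phi (Z w))).
    apply: (@bounded_integrable _ _ _ (normal_prob (Z w) s) (cst (phi (Z w))) C) => //.
    by move=> x; exact: phiC.
  rewrite -(RintegralB measurableT ic (iphi (Z w))).
  apply: (le_trans (le_normr_Rintegral _ _)) => //; first exact: (integrableB measurableT ic (iphi _)).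
  have iabs : (normal_prob (Z w) s).-integrable setT (EFin \o (fun x : R => `|x - Z w|)).
    apply: (@normal_expR_norm_integrable R (Z w) s s0 _ (1 + `|Z w|) 1).
      by apply: measurableT_comp => //; exact: measurable_funB.
    by move=> x; rewrite mul1r normr_id normB_le_expR_norm.
  apply: (@le_trans _ _ (\int[normal_prob (Z w) s]_x (L * `|x - Z w|))).
    apply: le_Rintegral => //.
    - exact: (integrable_norm (integrableB measurableT ic (iphi _))).
    - exact: integrable_mulR.
    - by move=> x _; rewrite (le_trans (phiL _ _))// distrC.
  by rewrite RintegralZl// ler_wpM2l// normal_abs.
have i1 : P.-integrable setT (EFin \o (fun w => h w * phi (Z w))).
  by apply: (bounded_h (C := C)) => //; exact: measurableT_comp.
have PhiC w : `|Phi w| <= C + L * s.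
  rewrite -[Phi w](subKr (phi (Z w))) (le_trans (ler_normB _ _))// lerD//.
have i2 : P.-integrable setT (EFin \o (fun w => h w * Phi w)).
  by apply: (bounded_h (C := C + L * s)).
rewrite -[X in `|X|]subr0 -Phi0 -RintegralB//.
apply: (le_trans (le_normr_Rintegral _ _)) => //; first exact: (integrableB measurableT i1 i2).
apply: (@le_trans _ _ (\int[P]_w (M * (L * s)))).
  apply: le_Rintegral => //.
  - exact: (integrable_norm (integrableB measurableT i1 i2)).
  - exact: cst_integrable.
  - by move=> w _; rewrite -mulrBr normrM ler_pM.
by rewrite Rintegral_cst//= probability_setT mulr1.
Qed.

(** At each point the approximations are eventually equal to the limit, which is all that indicators
    of half-lines and exponentials require; the domination [G] does the rest. *)
Let trig_unique_lim (phi : nat -> R -> R) (psi G : R -> R) (C L : nat -> R) :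
  (forall n, measurable_fun setT (phi n)) ->
  (forall n x, `|phi n x| <= C n) ->
  (forall n x y, `|phi n x - phi n y| <= L n * `|x - y|) ->
  (forall n x, `|phi n x| <= G x) ->
  P.-integrable setT (EFin \o (fun w => G (Z w))) ->
  (forall x, \forall n \near \oo, phi n x = psi x) ->
  \int[P]_w (h w * psi (Z w)) = 0.
Proof.
move=> mphi phiC phiL phiG Gi phipsi.
have e n : (\int[P]_w (h w * phi n (Z w))%:E = 0)%E.
  have := trig_unique_lipschitz (mphi n) (phiC n) (phiL n).
  rewrite /Rintegral => e0; rewrite -[LHS]fineK ?e0//.
  apply: integrable_fin_num => //; apply: (bounded_h (C := C n)) => //.
  exact: measurableT_comp.
have := @dominated_cvg _ _ _ P setT measurableT (fun n w => (h w * phi n (Z w))%:E)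
  (fun w => (h w * psi (Z w))%:E) (fun w => (M * G (Z w))%:E) _ _ _ _ _.
move=> /(_ _ _ _ _ _)/wrap[]//.
- move=> n; apply/measurable_EFinP; apply: measurable_funM => //.
  exact: measurableT_comp.
- move=> w _; apply: cvg_EFin; first exact: nearW.
  apply: cvg_near_cst; apply: filterS (phipsi (Z w)) => n /= pe.
  by rewrite pe.
- exact: integrable_mulR.
- by move=> n w _; rewrite /= lee_fin normrM ler_pM.
under eq_fun do rewrite e.
move=> c0; have c1 : (fun _ : nat => 0%E : \bar R) @ \oo --> (0%E : \bar R) by exact: cvg_cst.
by rewrite /Rintegral (cvg_unique _ c0 c1).
Qed.

Let clip (u : R) := Num.max 0 (Num.min 1 u).

Let clip_lip u v : `|clip u - clip v| <= `|u - v|.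
Proof.
have h1 := ler_norm (u - v); have := ler_norm (v - u); rewrite distrC => h2.
rewrite ler_norml /clip /Num.max /Num.min.
case: (ltP 1 u) => ?; case: (ltP 1 v) => ?; case: ltP => ?; case: ltP => ?;
  by apply/andP; split; lra.
Qed.

Let clip_le1 u : `|clip u| <= 1.
Proof.
rewrite ler_norml /clip /Num.max /Num.min.
by case: (ltP 1 u) => ?; case: ltP => ?; apply/andP; split; lra.
Qed.

Let measurable_clip : measurable_fun setT clip.
Proof. by apply: measurable_maxr => //; exact: measurable_minr. Qed.

Let integrable_one : P.-integrable setT (EFin \o (fun _ => 1 : R)).
Proof. by apply: (@bounded_integrable _ _ _ _ _ 1) => // w; rewrite normr1. Qed.

Lemma trig_unique_le (y : R) : \int[P]_w (h w * (Z w <= y)%R%:R) = 0.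
Proof.
apply: (@trig_unique_lim (fun n z => clip (1 - n%:R * (z - y)))
  (fun z => (z <= y)%R%:R) (cst 1) (cst 1) (fun n => n%:R)) => //.
- move=> n; apply: measurableT_comp => //.
  by apply: measurable_funB => //; apply: measurable_funM => //; exact: measurable_funB.
- move=> n x z; apply: (le_trans (clip_lip _ _)).
  rewrite (_ : _ - _ = n%:R * (z - x)); last by ring.
  by rewrite normrM normr_nat distrC.
- move=> x; have [xy|yx] := leP x y.
    apply: nearW => n; rewrite /clip /= min_l ?max_r//.
    by rewrite lerDl oppr_ge0 mulr_ge0_le0// subr_le0.
  near=> n; rewrite /clip /= max_l//.
  rewrite ge_min; apply/orP; right; rewrite subr_le0 -ler_pdivrMr ?subr_gt0// mul1r.
  by near: n; exact: nbhs_infty_ger.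
Unshelve. all: by end_near.
Qed.

Lemma trig_unique_lt (y : R) : \int[P]_w (h w * (Z w < y)%R%:R) = 0.
Proof.
apply: (@trig_unique_lim (fun n z => clip (n%:R * (y - z)))
  (fun z => (z < y)%R%:R) (cst 1) (cst 1) (fun n => n%:R)) => //.
- move=> n; apply: measurableT_comp => //.
  by apply: measurable_funM => //; exact: measurable_funB.
- move=> n x z; apply: (le_trans (clip_lip _ _)).
  rewrite (_ : _ - _ = n%:R * (z - x)); last by ring.
  by rewrite normrM normr_nat distrC.
- move=> x; have [yx|xy] := leP y x.
    apply: nearW => n; rewrite /clip /= max_l//.
    by rewrite ge_min mulr_ge0_le0 ?orbT// subr_le0.
  near=> n; rewrite /clip /= min_l ?max_r//.
  rewrite -ler_pdivrMr ?subr_gt0// mul1r.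
  by near: n; exact: nbhs_infty_ger.
Unshelve. all: by end_near.
Qed.

Lemma trig_unique_expR (b : R) :
  P.-integrable setT (EFin \o (fun w => expR (b * Z w))) ->
  \int[P]_w (h w * expR (b * Z w)) = 0.
Proof.
move=> bi.
have expR_lip (u v : R) : expR u - expR v <= expR u * `|u - v|.
  have -> : expR v = expR u * expR (v - u) by rewrite -expRD subrKC.
  have h1 := expR_ge1Dx (v - u); have h3 := ler_norm (u - v).
  by rewrite -{1}[expR u]mulr1 -mulrBr ler_pM2l ?expR_gt0//; lra.
(* Capping the exponent at [n] makes the exponential bounded and Lipschitz, and the exponential
   itself dominates all the capped versions. *)
apply: (@trig_unique_lim (fun n z => expR (Num.min (b * z) n%:R))
  (fun z => expR (b * z)) (fun z => expR (b * z)) (fun n => expR n%:R)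
  (fun n => expR n%:R * `|b|)) => //.
- move=> n; apply: measurableT_comp => //; exact: measurable_minr.
- by move=> n x; rewrite ger0_norm ?expR_ge0// ler_expR ge_min lexx orbT.
- have hmin (u v k : R) : `|Num.min u k - Num.min v k| <= `|u - v|.
    have k1 := ler_norm (u - v); have := ler_norm (v - u); rewrite distrC => k2.
    by rewrite ler_norml /Num.min; case: ltP => ?; case: ltP => ?; apply/andP; split; lra.
  have h1 (n : nat) (x z : R) : expR (Num.min (b * x) n%:R) - expR (Num.min (b * z) n%:R) <=
      expR n%:R * `|b| * `|x - z|.
    apply: (le_trans (expR_lip _ _)); rewrite -mulrA ler_pM ?expR_ge0//.
      by rewrite ler_expR ge_min lexx orbT.
    by rewrite -normrM mulrBr hmin.
  by move=> n x z; rewrite ler_norml h1 andbT lerNl opprB distrC h1.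
- by move=> n x; rewrite ger0_norm ?expR_ge0// ler_expR ge_min lexx.
- move=> x; near=> n; rewrite min_l//.
  by near: n; exact: nbhs_infty_ger.
Unshelve. all: by end_near.
Qed.
End trig_uniqueness.

Lemma normr_Rintegral_le d (T : measurableType d) (R : realType)
    (P : probability T R) (f : T -> R) (M : R) :
  measurable_fun setT f -> (forall w, `|f w| <= M) -> `|\int[P]_w f w| <= M.
Proof.
move=> mf fM; have fi := bounded_integrable P mf fM.
apply: (le_trans (le_normr_Rintegral _ fi)) => //.
apply: (@le_trans _ _ (\int[P]_w M)); last first.
  by rewrite Rintegral_cst//= probability_setT mulr1.
apply: le_Rintegral => //.
- by apply: (@bounded_integrable _ _ _ _ _ M) => [|w]; [exact: measurableT_comp|rewrite normr_id].
- exact: cst_integrable.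
Qed.

Section box_independence.
Context d (T : measurableType d) (R : realType) (P : probability T R).
Context (K : finType) (D : K -> T -> R) (y : K -> R) (strict : pred K).
Hypothesis mD : forall k, measurable_fun setT (D k).

(** Strict and large inequalities both occur, because [first_argmax] breaks ties by rank. *)
Let box k w : R := (if strict k then (D k w < y k)%R else (D k w <= y k)%R)%:R.

Let box_le1 k w : `|box k w| <= 1.
Proof. by rewrite /box; case: ifP => _; rewrite normr_nat lern1 leq_b1. Qed.

Let measurable_box k : measurable_fun setT (box k).
Proof.
rewrite /box; case: (strict k).
  rewrite (_ : (fun w => _) = \1_[set w | D k w < y k]).
    apply: measurable_indic; rewrite -[X in measurable X]setTI.
    exact: (measurable_fun_ltr (mD k) (measurable_cst (y k))).
  by apply/funext => w; rewrite indicE mem_setE.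
rewrite (_ : (fun w => _) = \1_[set w | D k w <= y k]).
  apply: measurable_indic; rewrite -[X in measurable X]setTI.
  exact: (measurable_fun_ler (mD k) (measurable_cst (y k))).
by apply/funext => w; rewrite indicE mem_setE.
Qed.

Let lin (a : K -> R) w := \sum_k a k * D k w.

Let mlin a : measurable_fun setT (lin a).
Proof. by apply: measurable_sum => k; exact: measurable_funM. Qed.

Let lin0 w : lin (fun=> 0) w = 0.
Proof. by rewrite /lin big1// => k _; rewrite mul0r. Qed.

Let prod_le1 (s : seq K) w : `|\prod_(k <- s) box k w| <= 1.
Proof.
by rewrite normr_prod prodr_ile1// => k _; rewrite normr_ge0 box_le1.
Qed.

Let measurable_prod_box (s : seq K) : measurable_fun setT (fun w => \prod_(k <- s) box k w).
Proof. by apply: measurable_prod => k _; exact: measurable_box. Qed.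

Let mcosL a th : measurable_fun setT (fun w => cos (lin a w - th)).
Proof. by apply: measurable_cos_comp; exact: measurable_funB. Qed.

(** The indicators enter one at a time. The induction carries a free cosine of a linear form: a
    product of two cosines is a half sum of cosines, so the vanishing is inherited with the
    coefficient at [k] changed, and one-dimensional uniqueness in [D k] adds the next indicator. *)
Lemma trig_unique_box (h : T -> R) (M : R) : measurable_fun setT h -> 0 <= M ->
  (forall w, `|h w| <= M) ->
  (forall a th, \int[P]_w (h w * cos (lin a w - th)) = 0) ->
  forall s : seq K, \int[P]_w (h w * \prod_(k <- s) box k w) = 0.
Proof.
move=> mh M0 hM hc s.
suff H : forall a th, \int[P]_w (h w * \prod_(k <- s) box k w * cos (lin a w - th)) = 0.
  apply: etrans (H (fun=> 0) 0); apply: eq_Rintegral => w _.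
  by rewrite lin0 subr0 cos0 mulr1.
elim: s => [|k s IH] a th.
  by rewrite -(hc a th); apply: eq_Rintegral => w _; rewrite big_nil mulr1.
pose g w := h w * \prod_(k <- s) box k w.
have mg : measurable_fun setT g by exact: measurable_funM.
have gM w : `|g w| <= M by rewrite normrM -[leRHS]mulr1 ler_pM.
have linD (b : R) w : lin a w + b * D k w = lin (fun j => a j + b * (j == k)%:R) w.
  rewrite /lin; under [RHS]eq_bigr do rewrite mulrDl.
  rewrite big_split/=; congr (_ + _).
  rewrite (bigD1 k)//= eqxx mulr1 big1 ?addr0// => j /negbTE ->.
  by rewrite mulr0 mul0r.
have ib a' th' : P.-integrable setT (EFin \o (fun w => g w * cos (lin a' w - th'))).
  apply: (@bounded_integrable _ _ _ _ _ M); first exact: measurable_funM.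
  by move=> w; rewrite normrM -[leRHS]mulr1 ler_pM// norm_cos_le1.
pose gc w := g w * cos (lin a w - th).
have mgc : measurable_fun setT gc by exact: measurable_funM.
have gcM w : `|gc w| <= M by rewrite normrM -[leRHS]mulr1 ler_pM// norm_cos_le1.
have gc0 b th' : \int[P]_w (gc w * cos (b * D k w - th')) = 0.
  transitivity (\int[P]_w (
      2^-1 * (g w * cos (lin (fun j => a j + b * (j == k)%:R) w - (th + th'))) +
      2^-1 * (g w * cos (lin (fun j => a j + (- b) * (j == k)%:R) w - (th - th'))))).
    apply: eq_Rintegral => w _; rewrite -!linD mulNr /gc.
    rewrite (_ : lin a w + b * D k w - _ = (lin a w - th) + (b * D k w - th')); last by ring.
    rewrite (_ : lin a w - b * D k w - _ = (lin a w - th) - (b * D k w - th')); last by ring.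
    by rewrite (cosB (lin a w - th)) (cosD (lin a w - th)); field.
  rewrite RintegralD//; [|exact: integrable_mulR|exact: integrable_mulR].
  by rewrite !RintegralZl// !IH !mulr0 addr0.
have -> : \int[P]_w (h w * \prod_(k <- k :: s) box k w * cos (lin a w - th)) =
    \int[P]_w (gc w * box k w).
  by apply: eq_Rintegral => w _; rewrite big_cons /gc /g; ring.
rewrite /box; case: (strict k).
  exact: (trig_unique_lt mgc gcM (mD k) gc0 M0).
exact: (trig_unique_le mgc gcM (mD k) gc0 M0).
Qed.

Context (G : T -> R) (v : R) (q : (K -> R) -> R).
Hypothesis GD : forall a t,
  cgauss P (fun w => lin a w + t * G w) (q a + t ^+ 2 * v).
Hypothesis mG : measurable_fun setT G.

(** By [GD] the variances add, so [G] is uncorrelated with every [D k]. Uniqueness is used twice: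
    with a centered cosine of [G] as weight it passes from the linear forms to their indicators;
    with the centered product of indicators as weight it passes from the cosines of [G] to its
    exponential. *)
Lemma box_expR_indep (s : seq K) (b : R) :
  \int[P]_w (\prod_(k <- s) box k w * expR (b * G w)) =
  (\int[P]_w \prod_(k <- s) box k w) * expR (v * b ^+ 2 / 2).
Proof.
have cG a t th : \int[P]_w cos (lin a w + t * G w - th) =
    cos th * expR (- ((q a + t ^+ 2 * v) / 2)).
  have [_ h _] := GD a t; have := h 1 th.
  by under eq_Rintegral do rewrite mul1r; rewrite expr1n mulr1.
have G0 t w : lin (fun=> 0) w + t * G w = t * G w by rewrite lin0 add0r.
(* As [q] is an arbitrary function here, its value at the zero form is recovered from the cosine
   transform. *)
have q0 : q (fun=> 0) = 0.
  have := cG (fun=> 0) 0 0; under eq_Rintegral do rewrite G0 mul0r subr0 cos0.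
  rewrite Rintegral_cst//= probability_setT mulr1 cos0 mul1r expr0n mul0r addr0.
  rewrite -[LHS]expR0 => /expR_inj/esym/eqP; rewrite oppr_eq0 mulf_eq0 invr_eq0.
  by rewrite pnatr_eq0 orbF => /eqP.
pose e t : R := expR (- (t ^+ 2 * v / 2)).
have EG t th : \int[P]_w cos (t * G w - th) = cos th * e t.
  by have := cG (fun=> 0) t th; under eq_Rintegral do rewrite G0; rewrite q0 add0r.
have EL a th : \int[P]_w cos (lin a w - th) = cos th * expR (- (q a / 2)).
  by have := cG a 0 th; under eq_Rintegral do rewrite mul0r addr0; rewrite expr0n mul0r addr0.
have Eexp : (\int[P]_w (expR (b * G w))%:E = (expR (v * b ^+ 2 / 2))%:E)%E.
  have [_ _ h] := GD (fun=> 0) b; have := h 1.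
  under eq_integral do rewrite G0 mul1r.
  by rewrite q0 add0r expr1n mulr1 (mulrC v).
have iexp : P.-integrable setT (EFin \o (fun w => expR (b * G w))).
  have := cgauss_expR_integrable 1 (GD (fun=> 0) b).
  by under eq_fun do rewrite G0 mul1r.
have ib (f : T -> R) : measurable_fun setT f -> (forall w, `|f w| <= 1) ->
    P.-integrable setT (EFin \o f).
  by move=> mf f1; apply: (@bounded_integrable _ _ _ _ _ 1).
have mcG t th : measurable_fun setT (fun w => cos (t * G w - th)).
  by apply: measurable_cos_comp; apply: measurable_funB => //; exact: measurable_funM.
have mcLG a t th : measurable_fun setT (fun w => cos (lin a w + t * G w - th)).
  by apply: measurable_cos_comp; apply: measurable_funB => //; apply: measurable_funD => //; exact: measurable_funM.
pose B w := \prod_(k <- s) box k w.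
have mB : measurable_fun setT B by exact: measurable_prod_box.
have B1 w : `|B w| <= 1 by exact: prod_le1.
have le2 (x x' : R) : `|x| <= 1 -> `|x'| <= 1 -> `|x - x'| <= 2.
  by move=> x1 x1'; rewrite (le_trans (ler_normB _ _))// -[leRHS]/(1 + 1) lerD.
have uncorrelated t th : \int[P]_w ((cos (t * G w - th) - cos th * e t) * B w) = 0.
  have e1 : `|cos th * e t| <= 1 by rewrite -EG; apply: normr_Rintegral_le.
  apply: (@trig_unique_box _ 2) => //; first exact: measurable_funB.
    by move=> w; exact: le2.
  move=> a th'.
  transitivity (\int[P]_w ((2^-1 * cos (lin a w + t * G w - (th' + th)) +
      2^-1 * cos (lin a w + (- t) * G w - (th' - th))) + (- (cos th * e t)) * cos (lin a w - th'))).
    apply: eq_Rintegral => w _.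
    rewrite (_ : lin a w + t * G w - _ = (lin a w - th') + (t * G w - th)); last by ring.
    rewrite (_ : lin a w + - t * G w - _ = (lin a w - th') - (t * G w - th)); last by ring.
    by rewrite (cosB (lin a w - th')) (cosD (lin a w - th')); field.
  rewrite RintegralD//; last 2 first.
  - by apply: integrable_addR; apply: integrable_mulR; exact: ib.
  - by apply: integrable_mulR; exact: ib.
  rewrite RintegralD//; [|by apply: integrable_mulR; exact: ib|by apply: integrable_mulR; exact: ib].
  rewrite !RintegralZl//; try exact: ib.
  have eD : expR (- ((q a + t ^+ 2 * v) / 2)) = expR (- (q a / 2)) * e t.
    by rewrite /e -expRD; congr expR; field.
  by rewrite !cG EL sqrrN eD cosB cosD; field.
pose p := \int[P]_w B w.
have iB : P.-integrable setT (EFin \o B) by exact: ib.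
have p1 : `|p| <= 1 by exact: normr_Rintegral_le.
have := @trig_unique_expR _ _ _ P (fun w => B w - p) G 2 _ _ mG _ _ b iexp.
move=> /(_ _ _ _ _)/wrap[]//.
- exact: measurable_funB.
- by move=> w; exact: le2.
- move=> t th.
  transitivity (\int[P]_w ((cos (t * G w - th) - cos th * e t) * B w
     + (cos th * e t * B w + (- p) * cos (t * G w - th)))).
    by apply: eq_Rintegral => w _; ring.
  have i1 : P.-integrable setT (EFin \o (fun w => cos th * e t * B w)) by exact: integrable_mulR.
  have i2 : P.-integrable setT (EFin \o (fun w => (- p) * cos (t * G w - th))).
    by apply: integrable_mulR; exact: ib.
  rewrite RintegralD//; [|apply: (@bounded_integrable _ _ _ _ _ 2)|exact: integrable_addR].
  + rewrite uncorrelated RintegralD// !RintegralZl//; last exact: ib.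
    by rewrite EG -/p; ring.
  + by apply: measurable_funM => //; exact: measurable_funB.
  + move=> w; rewrite normrM -[leRHS]mulr1 ler_pM// le2//.
    by rewrite -EG; apply: normr_Rintegral_le.
have iBe : P.-integrable setT (EFin \o (fun w => B w * expR (b * G w))).
  apply: (le_integrable measurableT _ _ iexp) => //.
    apply/measurable_EFinP/measurable_funM => //.
    by apply: measurableT_comp => //; exact: measurable_funM.
  by move=> w _; rewrite /= lee_fin normrM ler_piMl.
under eq_Rintegral do rewrite mulrBl.
rewrite RintegralB//; last exact: integrable_mulR.
rewrite RintegralZl// => /eqP; rewrite subr_eq0 => /eqP ->.
by rewrite /Rintegral Eexp.
Qed.
End box_independence.

(** * Sums over two independent copies *)

Section product_gaussian.
Context d (T : measurableType d) (R : realType) (P : probability T R).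

Lemma Rintegral_prodM (f g : T -> R) : measurable_fun setT f -> measurable_fun setT g ->
  (forall w, `|f w| <= 1) -> (forall w, `|g w| <= 1) ->
  (P \x P)%E.-integrable setT (EFin \o (fun z => f z.1 * g z.2)) /\
  \int[(P \x P)%E]_z (f z.1 * g z.2) = (\int[P]_w f w) * (\int[P]_w g w).
Proof.
move=> mf mg f1 g1.
have mfg : measurable_fun setT (fun z : T * T => f z.1 * g z.2).
  apply: measurable_funM; first exact: (measurableT_comp mf measurable_fst).
  exact: (measurableT_comp mg measurable_snd).
have b1 z : `|f z.1 * g z.2| <= 1 by rewrite normrM mulr_ile1.
have i1 : (P \x P)%E.-integrable setT (EFin \o (fun z => f z.1 * g z.2)).
  exact: (@bounded_integrable _ _ _ (P \x P)%E _ 1).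
split=> //.
have gi : P.-integrable setT (EFin \o g) by exact: (@bounded_integrable _ _ _ _ _ 1).
have fi : P.-integrable setT (EFin \o f) by exact: (@bounded_integrable _ _ _ _ _ 1).
rewrite -(Rintegral12 i1) => [|w]; last exact: (@integrable_mulR _ _ _ P (f w) g gi).
transitivity (\int[P]_x (f x * \int[P]_y g y)); last by rewrite RintegralZr.
by apply: eq_Rintegral => w _; exact: (@RintegralZl _ _ _ P setT g (f w)).
Qed.

Lemma cgauss_prod (X Y : T -> R) (u v : R) : cgauss P X u -> cgauss P Y v ->
  cgauss (P \x P)%E (fun z => X z.1 + Y z.2) (u + v).
Proof.
move=> [mX cX eX] [mY cY eY].
have mc (Z : T -> R) a th : measurable_fun setT Z -> measurable_fun setT (fun w => cos (a * Z w - th)).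
  by move=> mZ; apply: measurable_cos_comp; apply: measurable_funB => //; exact: measurable_funM.
have mXY : measurable_fun setT (fun z : T * T => X z.1 + Y z.2).
  apply: measurable_funD; first exact: (measurableT_comp mX measurable_fst).
  exact: (measurableT_comp mY measurable_snd).
split => // a; [move=> th|].
(* The phase [pi / 2] turns cosines into sines, so the addition formula is a difference of two
   products. The second one vanishes, as the transform of [Y] at this phase carries the factor
   [cos (pi / 2)]. *)
- have [i1 e1] := Rintegral_prodM (mc X a th mX) (mc Y a 0 mY) (fun=> norm_cos_le1 _) (fun=> norm_cos_le1 _).
  have [i2 e2] := Rintegral_prodM (mc X a (th + pi / 2) mX) (mc Y a (pi / 2) mY)
    (fun=> norm_cos_le1 _) (fun=> norm_cos_le1 _).
  transitivity (\int[(P \x P)%E]_z (cos (a * X z.1 - th) * cos (a * Y z.2 - 0) -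
      cos (a * X z.1 - (th + pi / 2)) * cos (a * Y z.2 - pi / 2))).
    apply: eq_Rintegral => z _; rewrite opprD addrA !(cosB _ (pi / 2)) !cos_pihalf !sin_pihalf.
    by rewrite !mulr0 !add0r !mulr1 subr0 -cosD; congr cos; ring.
  rewrite RintegralB// e1 e2 !cX !cY cos_pihalf cos0 mul1r mul0r mulr0 subr0 -[LHS]mulrA -expRD.
  by congr (_ * expR _); rewrite !mulrDl opprD.
- rewrite (@fubini_tonelli1 _ _ _ _ _ P P (fun z => (expR (a * (X z.1 + Y z.2)))%:E)).
  + rewrite /fubini_F /=.
    have mexp (Z : T -> R) : measurable_fun setT Z -> measurable_fun setT (fun w => (expR (a * Z w))%:E).
      by move=> mZ; apply/measurable_EFinP; apply: measurableT_comp => //; exact: measurable_funM.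
    have e0 (Z : T -> R) w : (0 <= (expR (a * Z w))%:E)%E by rewrite lee_fin expR_ge0.
    transitivity (\int[P]_x ((expR (v * a ^+ 2 / 2))%:E * (expR (a * X x))%:E))%E.
      apply: eq_integral => x _; rewrite -eY muleC -ge0_integralZl//; last exact: mexp.
      by apply: eq_integral => y _; rewrite mulrDr expRD EFinM.
    rewrite ge0_integralZl//; last exact: mexp.
    by rewrite eX -EFinM -expRD addrC; congr (expR _)%:E; rewrite !mulrDl.
  + by apply/measurable_EFinP; apply: measurableT_comp => //; exact: measurable_funM.
  + by move=> z; rewrite lee_fin expR_ge0.
Qed.
End product_gaussian.

Lemma sin_le_id (R : realType) (x : R) : 0 <= x -> sin x <= x.
Proof.
rewrite le_eqVlt => /predU1P[<-|x0]; first by rewrite sin0.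
have [c _] := @MVT R sin cos 0 x x0 (fun y _ => is_derive_sin y)
  (continuous_subspaceT (@continuous_sin R)).
by rewrite sin0 !subr0 => ->; rewrite ler_piMl ?cos_le1// ltW.
Qed.

Lemma onem_cos_le (R : realType) (x : R) : 0 <= x -> 1 - cos x <= x ^+ 2.
Proof.
move=> x0; have x2 : 0 <= x / 2 by rewrite divr_ge0.
rewrite [X in cos X](splitr x) -mulr2n cos_mulr2n cos2sin2.
have s1 : sin (x / 2) <= x / 2 by exact: sin_le_id.
have s2 : - (x / 2) <= sin (x / 2).
  have [x4|x4] := leP x 2.
    rewrite (@le_trans _ _ 0)// ?oppr_le0// sin_ge0_pi// x2/=.
    by rewrite (@le_trans _ _ 2) ?pi_ge2//; lra.
  by rewrite (le_trans _ (sin_geN1 _))//; lra.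
by rewrite mulr2n; nra.
Qed.

(** * Concentration of maxima of Gaussian linear forms *)

Section argmax.
Context (R : realType) (K : finType).

(** The fold starts at an actual value of [g], since the reals have no least element to serve as
    default. *)
Definition bigmax (k0 : K) (g : K -> R) : R := \big[Num.max/g k0]_k g k.

Lemma le_bigmax k0 g k : g k <= bigmax k0 g.
Proof. by rewrite /bigmax; apply: le_bigmax_cond. Qed.

Lemma bigmax_attained k0 g : exists k, bigmax k0 g = g k.
Proof.
rewrite /bigmax; elim/big_ind: _ => [|x y [k ->] [l ->]|k _]; first by exists k0.
  by rewrite /Num.max; case: ifP => _; [exists l|exists k].
by exists k.
Qed.

(** Ties can have positive probability, because several indices may carry the same affine form; the
    inadmissible sets of [selection_max] all do. The rank selects one index, so the events for
    different [k] form a partition. *)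
Definition first_argmax (g : K -> R) (k : K) : bool :=
  [forall l, if (enum_rank l < enum_rank k)%N then g l < g k else g l <= g k].

Lemma first_argmax_bigmax k0 g k : first_argmax g k -> bigmax k0 g = g k.
Proof.
move=> /forallP h; apply/eqP; rewrite eq_le le_bigmax andbT.
have [l ->] := bigmax_attained k0 g.
by have := h l; case: ifP => // _ /ltW.
Qed.

Lemma first_argmax_uniq g k l : first_argmax g k -> first_argmax g l -> k = l.
Proof.
move=> /forallP hk /forallP hl; apply: enum_rank_inj; apply: val_inj => /=.
have := hk l; have := hl k.
by case: ltngtP => // _ h1 h2; [have := lt_le_trans h1 h2|have := le_lt_trans h1 h2]; rewrite ltxx.
Qed.

Lemma first_argmax_exists (k0 : K) g : exists k, first_argmax g k.
Proof.
have [k1 e1] := bigmax_attained k0 g.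
pose p k := bigmax k0 g == g k.
have p1 : p k1 by apply/eqP.
pose k := [arg min_(i < k1 | p i) (enum_rank i : nat)].
exists k; rewrite /k; case: arg_minnP => // i /eqP pi mi.
apply/forallP => l; case: ifP => [li|_]; rewrite -pi; last exact: le_bigmax.
rewrite lt_neqAle le_bigmax andbT; apply: contraTN li => /eqP pl.
by rewrite -leqNgt; apply: mi; rewrite /p pl.
Qed.
End argmax.

Section gaussian_family.
Context d (T : measurableType d) (R : realType) (P : probability T R).
Context (I : finType) (Y : I -> T -> R) (C : I -> I -> R).

Definition lincomb (x : I -> R) w := \sum_i x i * Y i w.

Definition cov_form (x : I -> R) := \sum_i \sum_j x i * x j * C i j.

Definition gaussian_family := forall x, cgauss P (lincomb x) (cov_form x).

Lemma lincombD x y w : lincomb (fun i => x i + y i) w = lincomb x w + lincomb y w.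
Proof. by rewrite /lincomb -big_split; apply: eq_bigr => i _; rewrite mulrDl. Qed.

Lemma lincombZ a x w : lincomb (fun i => a * x i) w = a * lincomb x w.
Proof. by rewrite /lincomb mulr_sumr; apply: eq_bigr => i _; rewrite mulrA. Qed.

Lemma lincombB x y w : lincomb (fun i => x i - y i) w = lincomb x w - lincomb y w.
Proof.
by rewrite -mulN1r -lincombZ -lincombD; apply: eq_bigr => i _; rewrite mulN1r.
Qed.

Lemma lincomb_sum (J : finType) (a : J -> R) (x : J -> I -> R) w :
  lincomb (fun i => \sum_j a j * x j i) w = \sum_j a j * lincomb (x j) w.
Proof.
rewrite /lincomb; under eq_bigr do rewrite mulr_suml.
rewrite exchange_big/=; apply: eq_bigr => j _; rewrite mulr_sumr.
by apply: eq_bigr => i _; rewrite mulrA.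
Qed.

Lemma cov_formZ a x : cov_form (fun i => a * x i) = a ^+ 2 * cov_form x.
Proof.
rewrite /cov_form mulr_sumr; apply: eq_bigr => i _; rewrite mulr_sumr.
by apply: eq_bigr => j _; ring.
Qed.

(* A rotation preserves the law of a pair of independent copies. *)
Lemma cov_form_rot x y (s c : R) : s ^+ 2 + c ^+ 2 = 1 ->
  cov_form (fun i => s * x i + c * y i) + cov_form (fun i => c * x i - s * y i) =
  cov_form x + cov_form y.
Proof.
move=> sc; rewrite /cov_form -!big_split; apply: eq_bigr => i _ /=.
rewrite -!big_split; apply: eq_bigr => j _ /=.
transitivity ((s ^+ 2 + c ^+ 2) * (x i * x j * C i j + y i * y j * C i j)); first by ring.
by rewrite sc mul1r.
Qed.
End gaussian_family.

Lemma measurable_bigmax d (T : measurableType d) (R : realType) (K : finType) (k0 : K)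
    (g : K -> T -> R) : (forall k, measurable_fun setT (g k)) ->
  measurable_fun setT (fun w => bigmax k0 (g^~ w)).
Proof.
move=> mg; rewrite /bigmax; elim: (index_enum K) => [|k s IH].
  by under eq_fun do rewrite big_nil; exact: mg.
by under eq_fun do rewrite big_cons; exact: measurable_maxr.
Qed.

Lemma expR_jensen (R : realType) (n : nat) (x : nat -> R) :
  expR (n.+1%:R^-1 * \sum_(j < n.+1) x j) <= n.+1%:R^-1 * \sum_(j < n.+1) expR (x j).
Proof.
set m := _ * \sum_(_ < _) _.
have n0 : (0 : R) < n.+1%:R by rewrite ltr0n.
rewrite -(ler_pM2l n0) mulVKf ?gt_eqF//.
apply: (@le_trans _ _ (\sum_(j < n.+1) (expR m * (1 + (x j - m))))); last first.
  apply: ler_sum => j _; rewrite -[x j in leRHS](subrKC m) expRD.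
  by rewrite ler_pM2l ?expR_gt0// expR_ge1Dx.
rewrite -mulr_sumr big_split/= sumrB !sumr_const card_ord.
rewrite -[X in _ - X]mulr_natl {2}/m mulVKf ?gt_eqF// subrr addr0 mulr_natr.
by rewrite mulr_natl.
Qed.

(** Convexity of the exponential between 0 and [x], from the tangent at [e * x]. It makes a second
    order term linear in [eta] in the rotation argument, and it gives the tangent bound for
    powers. *)
Lemma expR_interp (R : realType) (e x : R) : 0 <= e <= 1 ->
  expR (e * x) <= (1 - e) + e * expR x.
Proof.
move=> /andP[e0 e1].
have h1 : expR (e * x) * (1 + (1 - e) * x) <= expR x.
  rewrite [X in _ <= expR X](_ : x = e * x + (1 - e) * x); last by ring.
  by rewrite expRD ler_pM2l ?expR_gt0// expR_ge1Dx.
have h2 : expR (e * x) * (1 + - (e * x)) <= 1.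
  by rewrite -[leRHS](expR0) -(subrr (e * x)) expRD ler_pM2l ?expR_gt0// expR_ge1Dx.
have e1' : 0 <= 1 - e by rewrite subr_ge0.
have := lerD (ler_wpM2l e1' h2) (ler_wpM2l e0 h1).
by rewrite mulr1; apply: le_trans; apply: le_of_eq; ring.
Qed.

Lemma expRD_le (R : realType) (x y : R) :
  expR (x + y) <= 2^-1 * expR (2 * x) + 2^-1 * expR (2 * y).
Proof.
have := sqr_ge0 (expR x - expR y).
by rewrite expRD !mulrDl !mul1r !expRD; nra.
Qed.

Lemma prod_natr_forall (R : realType) (K : finType) (p : pred K) :
  \prod_(k <- enum K) (p k)%:R = ([forall k, p k])%:R :> R.
Proof.
case: (boolP [forall k, p k]) => [/forallP h|].
  by rewrite big1// => k _; rewrite h.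
rewrite negb_forall => /existsP[k pk].
by rewrite (big_rem k)/= ?mem_enum// (negbTE pk) mul0r.
Qed.

Section concentration.
Context d (T : measurableType d) (R : realType) (P : probability T R).
Context (I : finType) (Y : I -> T -> R) (C : I -> I -> R).
Hypothesis gY : gaussian_family P Y C.
Context (K : finType) (k0 : K) (A : K -> I -> R) (b : K -> R) (s2 : R).
Hypothesis s20 : 0 <= s2.
Hypothesis As2 : forall k, cov_form C (A k) <= s2.

Let L := lincomb Y.
Let q := cov_form C.

Definition max_affine w := bigmax k0 (fun k => L (A k) w - b k).

Let F := max_affine.

Let mL x : measurable_fun setT (L x).
Proof. by have [] := gY x. Qed.

Lemma measurable_max_affine : measurable_fun setT max_affine.
Proof.
apply: (@measurable_bigmax _ _ _ _ k0 (fun k w => L (A k) w - b k)) => k.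
exact: measurable_funB.
Qed.

Let Q := (P \x P)%E.

(** The rotation runs from the second copy at [t = 0] to the first copy at [t = pi / 2], and [X'] is
    its derivative in [t]. *)
Let X (t : R) (x : I -> R) (z : T * T) := sin t * L x z.1 + cos t * L x z.2.
Let X' (t : R) (x : I -> R) (z : T * T) := cos t * L x z.1 - sin t * L x z.2.

Let f (t : R) (z : T * T) k := X t (A k) z - b k.
Let Ft t z := bigmax k0 (f t z).

(** Contains both that [X t x] and [X' t y] are uncorrelated for all [x] and [y], and that each of
    them has the law of one copy. *)
Let gauss_rot (t : R) x y : cgauss Q (fun z => X t x z + X' t y z) (q x + q y).
Proof.
have h := cgauss_prod (gY (fun i => sin t * x i + cos t * y i)) (gY (fun i => cos t * x i - sin t * y i)).
have sc : sin t ^+ 2 + cos t ^+ 2 = 1 by rewrite addrC cos2Dsin2.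
rewrite /q -(cov_form_rot C x y sc).
rewrite (_ : (fun z => _) = (fun z => lincomb Y (fun i => sin t * x i + cos t * y i) z.1 +
   lincomb Y (fun i => cos t * x i - sin t * y i) z.2))//.
by apply/funext => z; rewrite lincombB lincombD !lincombZ /X /X' /L; ring.
Qed.

Let q0 : q (fun=> 0) = 0.
Proof. by rewrite /q /cov_form big1// => i _; rewrite big1// => j _; rewrite !mul0r. Qed.

Let L0 w : L (fun=> 0) w = 0.
Proof. by rewrite /L /lincomb big1// => i _; rewrite mul0r. Qed.

Let gX t x : cgauss Q (X t x) (q x).
Proof.
have := gauss_rot t x (fun=> 0); rewrite q0 addr0.
rewrite (_ : (fun z => X t x z + X' t (fun=> 0) z) = X t x)//.
by apply/funext => z; rewrite /X' !L0 !mulr0 subrr addr0.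
Qed.

Let gX' t x : cgauss Q (X' t x) (q x).
Proof.
have := gauss_rot t (fun=> 0) x; rewrite q0 add0r.
rewrite (_ : (fun z => X t (fun=> 0) z + X' t x z) = X' t x)//.
by apply/funext => z; rewrite {1}/X !L0 !mulr0 addr0 add0r.
Qed.

Let mX t x : measurable_fun setT (X t x). Proof. by have [] := gX t x. Qed.
Let mX' t x : measurable_fun setT (X' t x). Proof. by have [] := gX' t x. Qed.

Let rotate (t e : R) x z : X t x z - X (t - e) x z = (1 - cos e) * X t x z + sin e * X' t x z.
Proof. by rewrite /X /X' sinB cosB; ring. Qed.

(* Rotating by [e] changes the maximum by at most the change at the maximising index. *)
Let step (t e : R) z k : first_argmax (f t z) k ->
  Ft t z - Ft (t - e) z <= (1 - cos e) * X t (A k) z + sin e * X' t (A k) z.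
Proof.
move=> hk; rewrite -rotate /Ft (first_argmax_bigmax k0 hk) {1}/f.
by have := le_bigmax k0 (f (t - e) z) k; rewrite {1}/f => h; lra.
Qed.

Let am t k z : R := (first_argmax (f t z) k)%:R.

Let am_box t k z : am t k z = \prod_(l <- enum K)
  (if (enum_rank l < enum_rank k)%N then (X t (fun i => A l i - A k i) z < b l - b k)%R
   else (X t (fun i => A l i - A k i) z <= b l - b k)%R)%:R.
Proof.
rewrite prod_natr_forall /am; congr (nat_of_bool _)%:R; apply: eq_forallb => l.
have XB : X t (fun i => A l i - A k i) z = X t (A l) z - X t (A k) z.
  by rewrite /X /L !lincombB; ring.
rewrite XB /f; case: ifP => _; [apply/idP/idP|apply/idP/idP]; lra.
Qed.

Let am01 t k z : 0 <= am t k z <= 1.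
Proof. by rewrite /am; case: (first_argmax _ _); rewrite ?lexx ?ler01. Qed.

Let am_sum t z : \sum_k am t k z = 1.
Proof.
have [k hk] := first_argmax_exists k0 (f t z).
rewrite (bigD1 k)//= {1}/am hk big1 ?addr0// => l /eqP lk; rewrite /am.
by case: (boolP (first_argmax _ l)) => // hl; case: lk; exact: first_argmax_uniq hl hk.
Qed.

Let XX t k (a : K -> R) (u : R) z :
  \sum_l a l * X t (fun i => A l i - A k i) z + u * X' t (A k) z =
  X t (fun i => \sum_l a l * (A l i - A k i)) z + X' t (fun i => u * A k i) z.
Proof.
rewrite /X /X' /L (lincomb_sum Y a (fun l i => A l i - A k i)) lincombZ.
rewrite (lincomb_sum Y a (fun l i => A l i - A k i)) lincombZ.
under eq_bigr do rewrite mulrDr (mulrCA _ (sin t)) (mulrCA _ (cos t)).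
rewrite big_split/= -!mulr_sumr; ring.
Qed.

Let measurable_am t k : measurable_fun setT (am t k).
Proof.
rewrite (_ : am t k = \1_[set z | first_argmax (f t z) k]); last first.
  by apply/funext => z; rewrite indicE mem_setE.
apply: measurable_indic.
rewrite (_ : [set z | _] = \big[setI/setT]_(l <- enum K)
   [set z | if (enum_rank l < enum_rank k)%N then f t z l < f t z k else f t z l <= f t z k]).
  apply: bigsetI_measurable => l _; case: (enum_rank l < enum_rank k)%N.
  - rewrite -[X in measurable X]setTI.
    by apply: (measurable_fun_ltr (f := fun z => f t z l) (g := fun z => f t z k)) => //;
      exact: measurable_funB.
  - rewrite -[X in measurable X]setTI.
    by apply: (measurable_fun_ler (f := fun z => f t z l) (g := fun z => f t z k)) => //;
      exact: measurable_funB.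
apply/seteqP; split => z /=.
  by move=> /forallP h; rewrite -bigcap_seq => l _; exact: h.
rewrite -bigcap_seq => h; apply/forallP => l.
by apply: (h l); rewrite /= mem_enum.
Qed.

(* [X' t (A k)] is uncorrelated with the differences [X t (A l - A k)], hence independent of
   the event that [k] is the first argmax. *)
Let am_exp t k (u : R) :
  (\int[Q]_z (am t k z * expR (u * X' t (A k) z))%:E =
   ((\int[Q]_z am t k z) * expR (q (A k) * u ^+ 2 / 2))%:E)%E.
Proof.
have := @box_expR_indep _ _ R Q K (fun l z => X t (fun i => A l i - A k i) z)
  (fun l => b l - b k) (fun l => (enum_rank l < enum_rank k)%N)
  (fun l => mX _ _) (X' t (A k)) (q (A k))
  (fun a => q (fun i => \sum_l a l * (A l i - A k i))) _ (mX' _ _) (enum K) u.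
move=> /(_ _)/wrap[].
  move=> a v; rewrite (_ : (fun w => _) = (fun z => X t (fun i => \sum_l a l * (A l i - A k i)) z
      + X' t (fun i => v * A k i) z)).
    by rewrite -[X in _ + X](cov_formZ C); exact: gauss_rot.
  by apply/funext => z; exact: XX.
under eq_Rintegral do rewrite -am_box.
under [X in _ = X * _ -> _]eq_Rintegral do rewrite -am_box.
move=> <-; rewrite fineK//; apply: integrable_fin_num => //.
apply: (le_integrable measurableT _ _ (cgauss_expR_integrable u (gX' t (A k)))) => //.
  apply/measurable_EFinP/measurable_funM => //.
  by apply: measurableT_comp => //; exact: measurable_funM.
move=> z _; rewrite /= lee_fin normrM ler_piMl//.
by have /andP[a0 a1] := am01 t k z; rewrite ger0_norm.
Qed.

Let kappa := \sum_k expR (q (A k) / 2).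

(* The event that [k] is the first argmax is eliminated by [am_exp], so that no union bound
   enters the main term; [kappa] only multiplies the second order term [1 - cos e]. *)
Let one_step (t e m : R) : 0 <= m -> 0 <= 2 * m * (1 - cos e) <= 1 ->
  (\int[Q]_z (expR (m * (Ft t z - Ft (t - e) z)))%:E <=
   (2^-1 * expR (2 * m ^+ 2 * sin e ^+ 2 * s2) +
    2^-1 * (1 + 2 * m * (1 - cos e) * kappa))%:E)%E.
Proof.
move=> m0; set eta := 2 * m * (1 - cos e) => /andP[eta0 eta1].
pose u := 2 * m * sin e.
have mf k : measurable_fun setT (fun z => f t z k) by exact: measurable_funB.
have mFt t' : measurable_fun setT (Ft t').
  by apply: (@measurable_bigmax _ _ _ _ k0 (fun k z => f t' z k)) => k; exact: measurable_funB.
have iam k : Q.-integrable setT (EFin \o am t k).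
  apply: (@bounded_integrable _ _ _ _ _ 1) => // z.
  by have /andP[a0 a1] := am01 t k z; rewrite ger0_norm.
have meX k : measurable_fun setT (fun z => (expR (X t (A k) z))%:E).
  by apply/measurable_EFinP; apply: measurableT_comp.
have meX' k : measurable_fun setT (fun z => (am t k z * expR (u * X' t (A k) z))%:E).
  apply/measurable_EFinP/measurable_funM => //; apply: measurableT_comp => //.
  exact: measurable_funM.
have p0 k z : (0 <= (am t k z * expR (u * X' t (A k) z))%:E)%E.
  by rewrite lee_fin mulr_ge0 ?expR_ge0//; have /andP[] := am01 t k z.
apply: (@le_trans _ _ (\int[Q]_z ((2^-1)%:E * (\sum_k (am t k z * expR (u * X' t (A k) z))%:E) +
   ((2^-1)%:E + (2^-1 * eta)%:E * (\sum_k (expR (X t (A k) z))%:E))))%E).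
  apply: ge0_le_integral => //=.
  - apply/measurable_EFinP; apply: measurableT_comp => //; apply: measurable_funM => //.
    exact: measurable_funB.
  - apply: emeasurable_funD; first by apply: emeasurable_funM => //; exact: emeasurable_sum.
    by apply: emeasurable_funD => //; apply: emeasurable_funM => //; exact: emeasurable_sum.
  - move=> z _; rewrite !sumEFin -!EFinM -!EFinD lee_fin.
    have [k hk] := first_argmax_exists k0 (f t z).
    (* The first and second order parts of the exponent are separated by [expRD_le], which doubles
       both: hence the factors 2 in [u] and [eta]. *)
    apply: (@le_trans _ _ (2^-1 * expR (u * X' t (A k) z) + 2^-1 * expR (eta * X t (A k) z))).
      apply: le_trans (_ : expR (m * (sin e * X' t (A k) z) + m * ((1 - cos e) * X t (A k) z)) <= _).
        by rewrite ler_expR -mulrDr ler_wpM2l// [leRHS]addrC; exact: step.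
      apply: (le_trans (expRD_le _ _)); rewrite /u /eta.
      by apply: le_of_eq; congr (_ * expR _ + _ * expR _); ring.
    apply: lerD.
      rewrite ler_wpM2l// (bigD1 k)//= {1}/am hk mul1r lerDl sumr_ge0// => l _.
      by have := p0 l z; rewrite lee_fin.
    have h1 : expR (eta * X t (A k) z) <= 1 + eta * expR (X t (A k) z).
      apply: (le_trans (expR_interp _ _)); first by rewrite eta0.
      by rewrite lerD2r gerBl.
    have h2 : expR (X t (A k) z) <= \sum_k expR (X t (A k) z).
      by rewrite (bigD1 k)//= lerDl sumr_ge0// => l _; exact: expR_ge0.
    by have := ler_wpM2l eta0 h2; lra.
rewrite ge0_integralD//=; last 4 first.
- by move=> z _; apply: mule_ge0 => //; apply: sume_ge0 => k _.
- by apply: emeasurable_funM => //; exact: emeasurable_sum.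
- move=> z _; apply: adde_ge0 => //; apply: mule_ge0; first by rewrite lee_fin mulr_ge0.
  by apply: sume_ge0 => k _; rewrite lee_fin expR_ge0.
- by apply: emeasurable_funD => //; apply: emeasurable_funM => //; exact: emeasurable_sum.
rewrite ge0_integralZl//=; last 2 first.
- exact: emeasurable_sum.
- by move=> z _; apply: sume_ge0 => k _.
rewrite ge0_integralD//=; last 2 first.
- move=> z _; apply: mule_ge0; first by rewrite lee_fin mulr_ge0.
  by apply: sume_ge0 => k _; rewrite lee_fin expR_ge0.
- by apply: emeasurable_funM => //; exact: emeasurable_sum.
rewrite ge0_integralZl//=; last 3 first.
- exact: emeasurable_sum.
- by move=> z _; apply: sume_ge0 => k _; rewrite lee_fin expR_ge0.
- by rewrite lee_fin mulr_ge0.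
rewrite !ge0_integral_sum//.
rewrite integral_cst//= probability_setT mule1.
have eX k : (\int[Q]_z (expR (X t (A k) z))%:E = (expR (q (A k) / 2))%:E)%E.
  have [_ _ /(_ 1)] := gX t (A k).
  by under eq_integral do rewrite mul1r; rewrite expr1n mulr1.
rewrite (eq_bigr _ (fun k _ => am_exp t k u)) (eq_bigr _ (fun k _ => eX k)).
rewrite !sumEFin -!EFinM -!EFinD lee_fin -/kappa.
rewrite [X in _ <= _ + X](_ : _ = 2^-1 + 2^-1 * eta * kappa); last by ring.
rewrite lerD2r.
rewrite ler_wpM2l//.
apply: (@le_trans _ _ (\sum_k (\int[Q]_z am t k z) * expR (2 * m ^+ 2 * sin e ^+ 2 * s2))).
  apply: ler_sum => k _; rewrite ler_wpM2l//.
    by apply: Rintegral_ge0 => z _; have /andP[] := am01 t k z.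
  rewrite ler_expR /u (_ : _ / 2 = 2 * m ^+ 2 * sin e ^+ 2 * q (A k)); last by field.
  by rewrite ler_wpM2l ?As2// mulr_ge0 ?sqr_ge0// mulr_ge0 ?sqr_ge0.
rewrite -mulr_suml (_ : \sum_k _ = 1) ?mul1r//.
apply: EFin_inj; rewrite -sumEFin.
transitivity (\sum_k \int[Q]_z (am t k z)%:E)%E.
  by apply: eq_bigr => k _; rewrite /Rintegral fineK//; exact: (integrable_fin_num measurableT (iam k)).
rewrite -ge0_integral_sum//; last 2 first.
- by move=> k; apply/measurable_EFinP.
- by move=> k z _; rewrite lee_fin; have /andP[] := am01 t k z.
under eq_integral do rewrite sumEFin am_sum.
by rewrite integral_cst//= probability_setT mule1.
Qed.

(* The rotation from [z.2] to [z.1] is cut into small steps, and Jensen's inequality turns the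
   sum of the steps into an average of exponentials. *)
Lemma decoupled_mgf_le (l : R) : 0 <= l ->
  (\int[Q]_z (expR (l * (F z.1 - F z.2)))%:E <= (expR (8 * l ^+ 2 * s2))%:E)%E.
Proof.
move=> l0.
have [/andP[p0 p2] _] := pihalf_02_cos_pihalf R.
have kap0 : 0 <= kappa by apply: sumr_ge0 => k _; exact: expR_ge0.
have mFt t' : measurable_fun setT (Ft t').
  by apply: (@measurable_bigmax _ _ _ _ k0 (fun k z => f t' z k)) => k; exact: measurable_funB.
have main n : 8 * l / n.+1%:R <= 1 ->
    (\int[Q]_z (expR (l * (F z.1 - F z.2)))%:E <=
      (2^-1 * expR (8 * l ^+ 2 * s2) + 2^-1 * (1 + 8 * l / n.+1%:R * kappa))%:E)%E.
  move=> ln; pose N : R := n.+1%:R; have N0 : 0 < N by rewrite ltr0n.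
  (* Jensen's inequality multiplies the exponent by [N]. As [e * N = pi / 2 <= 2], the first order
     exponent is at most [2 * (2 * l) ^+ 2 * s2], which is the constant 8, while the second order
     term is at most [8 * l / N] and disappears as [N] grows. *)
  pose e := pi / 2 / N; have e0 : 0 <= e by rewrite divr_ge0// ltW.
  have eN : e * N = pi / 2 by rewrite divfK// gt_eqF.
  have e2 : e <= 2 / N by rewrite ler_pM2r ?invr_gt0.
  have lN0 : 0 <= l * N by rewrite mulr_ge0// ltW.
  have c1 : 0 <= 1 - cos e by rewrite subr_ge0 cos_le1.
  have eta0 : 0 <= 2 * (l * N) * (1 - cos e) by rewrite !mulr_ge0// ltW.
  have etaN : 2 * (l * N) * (1 - cos e) <= 8 * l / N.
    apply: (@le_trans _ _ (2 * (l * N) * (2 / N) ^+ 2)).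
      rewrite ler_wpM2l ?mulr_ge0//.
      by rewrite (le_trans (onem_cos_le e0))// ler_sqr// nnegrE// divr_ge0// ltW.
    by apply: le_of_eq; field; rewrite gt_eqF.
  have sinN : (l * N) ^+ 2 * sin e ^+ 2 <= 4 * l ^+ 2.
    have s0 : 0 <= sin e.
      rewrite sin_ge0_pi// e0/= (le_trans e2)// (le_trans _ (pi_ge2 R))//.
      by rewrite ler_pdivrMr// ler_peMr// ler1n.
    rewrite -exprMn (_ : 4 * l ^+ 2 = (2 * l) ^+ 2); last by ring.
    rewrite ler_sqr ?nnegrE ?mulr_ge0//.
    rewrite mulrAC [leRHS]mulrC -mulrA ler_wpM2l// mulrC.
    rewrite (@le_trans _ _ (e * N))//; last by rewrite eN.
    by rewrite mulrC ler_wpM2r ?sin_le_id// ltW.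
  pose b' := 2^-1 * expR (8 * l ^+ 2 * s2) + 2^-1 * (1 + 8 * l / N * kappa).
  have st j : (\int[Q]_z (expR (l * N * (Ft (j.+1%:R * e) z - Ft (j%:R * e) z)))%:E <= b'%:E)%E.
    have -> : j%:R * e = j.+1%:R * e - e by rewrite -natr1 mulrDl mul1r addrK.
    apply: (le_trans (one_step _ _ _)) => //.
      by rewrite eta0 (le_trans etaN).
    rewrite lee_fin /b' lerD// ler_wpM2l//.
      rewrite ler_expR ler_wpM2r// [leRHS](_ : _ = 2 * (4 * l ^+ 2)); last by ring.
      by rewrite -mulrA ler_wpM2l.
    by rewrite lerD2l ler_wpM2r.
  have F1 z : F z.1 = Ft (pi / 2) z.
    rewrite /F /max_affine /Ft /f; congr (bigmax _ _); apply/funext => k.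
    by rewrite /X sin_pihalf cos_pihalf mul1r mul0r addr0.
  have F2 z : F z.2 = Ft 0 z.
    rewrite /F /max_affine /Ft /f; congr (bigmax _ _); apply/funext => k.
    by rewrite /X sin0 cos0 mul1r mul0r add0r.
  have mterm j : measurable_fun setT (fun z => (expR (l * N * (Ft (j.+1%:R * e) z - Ft (j%:R * e) z)))%:E).
    apply/measurable_EFinP; apply: measurableT_comp => //; apply: measurable_funM => //.
    exact: measurable_funB.
  apply: (@le_trans _ _ (\int[Q]_z ((N^-1)%:E * \sum_(j < n.+1) (expR (l * N * (Ft (j.+1%:R * e) z - Ft (j%:R * e) z)))%:E))%E).
    apply: ge0_le_integral => //=.
    - apply/measurable_EFinP; apply: measurableT_comp => //; apply: measurable_funM => //.
      under eq_fun do rewrite F1 F2; exact: measurable_funB.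
    - by apply: emeasurable_funM => //; exact: emeasurable_sum.
    - move=> z _; rewrite sumEFin -EFinM lee_fin.
      apply: le_trans (expR_jensen n (fun j => l * N * (Ft (j.+1%:R * e) z - Ft (j%:R * e) z))).
      rewrite ler_expR -mulr_sumr mulrA mulrCA mulVf ?mulr1 ?gt_eqF//.
      rewrite -(big_mkord xpredT (fun j => Ft (j.+1%:R * e) z - Ft (j%:R * e) z)).
      by rewrite telescope_sumr// mul0r mulrC -/N (mulrC N) eN F1 F2 mulrC.
  rewrite ge0_integralZl//=; last 3 first.
  - exact: emeasurable_sum.
  - by move=> z _; apply: sume_ge0 => j _; rewrite lee_fin expR_ge0.
  - by rewrite lee_fin invr_ge0 ltW.
  rewrite ge0_integral_sum//.
  apply: (@le_trans _ _ ((N^-1)%:E * \sum_(j < n.+1) b'%:E)%E).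
    by rewrite lee_wpmul2l ?lee_fin ?invr_ge0 ?(ltW N0)//; apply: lee_sum => j _; exact: st.
  by rewrite sumEFin sumr_const card_ord -EFinM -[X in _ * X]mulr_natl -/N mulrA mulVf ?mul1r// gt_eqF.
suff H (eps : R) : 0 < eps -> (\int[Q]_z (expR (l * (F z.1 - F z.2)))%:E <=
    (expR (8 * l ^+ 2 * s2))%:E + eps%:E)%E by apply/lee_addgt0Pr.
(* Beyond [c], the number of steps meets the condition of [main] and makes the term with [kappa] at
   most [eps]. *)
move=> eps0; pose c := 8 * l + 8 * l * kappa / eps.
have l8 : 0 <= 8 * l by rewrite mulr_ge0.
have lk0 : 0 <= 8 * l * kappa / eps by apply: divr_ge0; [exact: mulr_ge0|exact: ltW].
have c0 : 0 <= c by exact: addr_ge0.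
have [n /ltW nc] : exists n : nat, c < n%:R by exists (Num.truncn c).+1; rewrite truncnS_gt.
have n0 : (0 : R) < n.+1%:R by rewrite ltr0n.
have cn : c <= n.+1%:R by rewrite (le_trans nc)// ler_nat.
apply: (le_trans (main n _)).
  by rewrite ler_pdivrMr// mul1r (le_trans _ cn)// /c lerDl.
rewrite -EFinD lee_fin.
have h1 : 8 * l / n.+1%:R * kappa <= eps.
  by rewrite mulrAC ler_pdivrMr// [leRHS]mulrC -ler_pdivrMr// (le_trans _ cn)// /c lerDr.
have h2 : 1 <= expR (8 * l ^+ 2 * s2).
  by rewrite -expR0 ler_expR mulr_ge0// mulr_ge0// sqr_ge0.
move: h1 h2; move: (expR _) (_ * kappa) => E kk h1 h2; by lra.
Qed.

Lemma max_affine_integrable : P.-integrable setT (EFin \o F).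
Proof.
have [k1 _] := first_argmax_exists k0 b.
apply: (le_integrable measurableT _ (g := fun w => (\sum_k `|L (A k) w - b k|)%:E)).
- exact/measurable_EFinP/measurable_max_affine.
- move=> w _; rewrite /= lee_fin /F /max_affine.
  have [k ->] := bigmax_attained k0 (fun k => L (A k) w - b k).
  rewrite [leRHS]ger0_norm ?sumr_ge0// (bigD1 k)//= lerDl.
  by rewrite sumr_ge0.
- under eq_fun do rewrite -sumEFin.
  apply: integrable_sum => //= k _.
  have h : P.-integrable setT (EFin \o (fun w => L (A k) w - b k)).
    apply: integrable_subR; first exact: cgauss_integrable (gY _).
    exact: cst_integrable.
  exact: integrable_norm h.
Qed.

Lemma jensen_expR (G : T -> R) (c l : R) : P.-integrable setT (EFin \o G) ->
  ((expR (l * (c - \int[P]_w G w)))%:E <= \int[P]_w (expR (l * (c - G w)))%:E)%E.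
Proof.
move=> Gi; have mG : measurable_fun setT G by apply/measurable_EFinP; exact: measurable_int Gi.
set m := \int[P]_w G w.
pose h w := expR (l * (c - m)) * (1 + l * (m - G w)).
have hi : P.-integrable setT (EFin \o h).
  apply: integrable_mulR; apply: integrable_addR; first exact: cst_integrable.
  apply: integrable_mulR; apply: integrable_subR => //.
  exact: cst_integrable.
have -> : (expR (l * (c - m)))%:E = (\int[P]_w (h w)%:E)%E.
  rewrite -[RHS]fineK; last exact: integrable_fin_num.
  congr EFin; rewrite -/(Rintegral _ _ _) /h RintegralZl//; last first.
    apply: integrable_addR; first exact: cst_integrable.
    apply: integrable_mulR; apply: integrable_subR => //.
    exact: cst_integrable.
  rewrite RintegralD//; last 2 first.
  - exact: cst_integrable.
  - apply: integrable_mulR; apply: integrable_subR => //.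
    exact: cst_integrable.
  rewrite RintegralZl//; last first.
    apply: integrable_subR => //; exact: cst_integrable.
  rewrite RintegralB//; last exact: cst_integrable.
  by rewrite !Rintegral_cst//= probability_setT !mulr1 subrr mulr0 addr0 mulr1.
(* If the exponential is not integrable, the right-hand side is [+oo]. *)
have [fin|] := boolP (P.-integrable setT (fun w => (expR (l * (c - G w)))%:E)).
  apply: le_integral => // w _; rewrite /= lee_fin /h.
  rewrite [X in _ <= expR X](_ : _ = l * (c - m) + l * (m - G w)); last by ring.
  by rewrite expRD ler_pM2l ?expR_gt0// expR_ge1Dx.
move=> /negP nfin; suff -> : (\int[P]_w (expR (l * (c - G w)))%:E = +oo)%E by rewrite leey.
apply/eqP; rewrite -leye_eq leNgt; apply/negP => lt; apply: nfin.
apply/integrableP; split.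
  apply/measurable_EFinP; apply: measurableT_comp => //; apply: measurable_funM => //.
  exact: measurable_funB.
by under eq_integral do rewrite gee0_abs ?lee_fin ?expR_ge0//.
Qed.

(** One copy is averaged out by Jensen's inequality: the second for [l >= 0], the first for [l < 0],
    since [decoupled_mgf_le] is about nonnegative exponents. *)
Lemma max_affine_mgf (l : R) :
  (\int[P]_w (expR (l * (F w - \int[P]_w' F w')))%:E <= (expR (8 * l ^+ 2 * s2))%:E)%E.
Proof.
have Fi := max_affine_integrable; have mF := measurable_max_affine.
pose g (c : R) (z : T * T) := (expR (c * (F z.1 - F z.2)))%:E.
have mg c : measurable_fun setT (g c).
  apply/measurable_EFinP; apply: measurableT_comp => //; apply: measurable_funM => //.
  by apply: measurable_funB; [exact: (measurableT_comp mF measurable_fst)|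
    exact: (measurableT_comp mF measurable_snd)].
have g0 c z : (0 <= g c z)%E by rewrite lee_fin expR_ge0.
have ml : measurable_fun setT (fun w => (expR (l * (F w - \int[P]_w' F w')))%:E).
  apply/measurable_EFinP; apply: measurableT_comp => //; apply: measurable_funM => //.
  exact: measurable_funB.
have [l0|l0] := leP 0 l.
  apply: le_trans (decoupled_mgf_le l0).
  rewrite (@fubini_tonelli1 _ _ _ _ _ P P (g l))//.
  apply: ge0_le_integral => //=.
  - exact: (@measurable_fun_fubini_tonelli_F _ _ _ _ _ P (g l)).
  - by move=> w _; exact: jensen_expR.
have l0' : 0 <= - l by rewrite oppr_ge0 ltW.
rewrite -[l ^+ 2]sqrrN; apply: le_trans (decoupled_mgf_le l0').
rewrite (@fubini_tonelli2 _ _ _ _ _ P P (g (- l)))//.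
apply: ge0_le_integral => //=.
- exact: (@measurable_fun_fubini_tonelli_G _ _ _ _ _ P (g (- l))).
- move=> w _; rewrite /fubini_G /g /=.
  under [leRHS]eq_integral => x _.
    rewrite (_ : - l * (F x - F w) = l * (F w - F x)); last by ring.
    over.
  exact: jensen_expR.
Qed.
End concentration.

(** * Chaining over dyadic grids *)

Section chains.
Context (R : realType).
Local Notation pos x := (Num.max x 0).

(** Empty and adjacent intervals are allowed, because rounding to a coarser grid creates them. *)
Definition weak_chain (N n : nat) (a b : nat -> nat) : Prop :=
  [/\ forall i, (i <= n)%N -> (a i <= b i)%N,
      forall i, (i < n)%N -> (b i <= a i.+1)%N & (b n <= N)%N].

Lemma weak_chain_sum (N n : nat) (a b : nat -> nat) (g : nat -> R) :
  weak_chain N n a b -> (forall j, 0 <= g j) ->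
  \sum_(i < n.+1) \sum_(a i <= j < b i) g j <= \sum_(0 <= j < N) g j.
Proof.
move=> [ab ba bN] g0.
have g0' p r : 0 <= \sum_(p <= j < r) g j by apply: sumr_ge0.
apply: (@le_trans _ _ (\sum_(0 <= j < b n) g j)); last first.
  by rewrite (big_cat_nat (n := b n) _ bN)//= lerDl.
elim: n ab ba {bN} => [|n IH] ab ba.
  rewrite big_ord_recl big_ord0 addr0 /=.
  by rewrite [leRHS](big_cat_nat (n := a 0%N))//= ?ab// lerDr.
rewrite big_ord_recr/=.
rewrite [leRHS](big_cat_nat (n := a n.+1))//= ?ab// lerD2r.
apply: (le_trans (IH _ _)).
- by move=> i /leqW; exact: ab.
- by move=> i ?; apply: ba; rewrite ltnS ltnW.
- by rewrite [leRHS](big_cat_nat (n := b n) (p := a n.+1))//= ?ba// lerDl.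
Qed.

Lemma pos_ge0 (x : R) : 0 <= pos x. Proof. by rewrite le_max lexx orbT. Qed.
Lemma pos_ge (x : R) : x <= pos x. Proof. by rewrite le_max lexx. Qed.
Lemma pos_le (x y : R) : x <= y -> 0 <= y -> pos x <= y.
Proof. by move=> xy y0; rewrite ge_max xy. Qed.

Section halving.
Variables (f f' : nat -> R) (x y : R).
Hypothesis ff' : forall j, f j.*2 = f' j.
Hypotheses (x0 : 0 <= x) (y0 : 0 <= y).
Let g j : R := pos (`|f j.+1 - f j| - y).

Let g0 j : 0 <= g j. Proof. exact: pos_ge0. Qed.

(** The increment lost at an odd endpoint is at most [y] plus its excess over [y]. The two copies of
    [y] are paid out of the cost of the interval, the excesses are charged to [g]. *)
Let halve_term (a b : nat) : (a <= b)%N ->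
  pos (f b - f a - (x + 2 * y)) <=
  pos (f' b./2 - f' (minn (uphalf a) b./2) - x) + \sum_(a <= j < b) g j.
Proof.
rewrite leq_eqVlt => /predU1P[->|ab].
  rewrite big_geq// addr0 max_r ?pos_ge0// subrr sub0r oppr_le0.
  by rewrite addr_ge0// mulr_ge0.
have ->: minn (uphalf a) b./2 = uphalf a.
  by apply/minn_idPl; rewrite uphalfE half_leq.
have fb : f b = f' b./2 + (odd b)%:R * (f b - f b.-1).
  have := odd_double_half b; case: (odd b) => /=; rewrite ?add0n ?add1n => e.
    have -> : b.-1 = b./2.*2 by rewrite -[in LHS]e.
    by rewrite ff'; ring.
  by rewrite mul0r addr0 -ff' e.
have fa : f a = f' (uphalf a) - (odd a)%:R * (f a.+1 - f a).
  have := odd_double_half a; rewrite uphalf_half; case: (odd a) => /=; rewrite ?add0n ?add1n => e.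
    have -> : a.+1 = (a./2.+1).*2 by rewrite doubleS e.
    by rewrite ff'; ring.
  by rewrite mul0r subr0 -ff' e.
have hd (z : R) (o : bool) : o%:R * z <= y + o%:R * pos (`|z| - y).
  case: o; rewrite ?mul1r ?mul0r ?addr0//.
  by have := pos_ge (`|z| - y); have := ler_norm z; lra.
(* The two lost increments are different terms of the sum: if the interval has a single step, only
   one of its endpoints is odd. *)
have hsum c : (a <= c)%N ->
    (odd c.+1)%:R * g c + (odd a)%:R * g a <= \sum_(a <= j < c.+1) g j.
  move=> ac.
  have ga : g a <= \sum_(a <= j < c.+1) g j by rewrite big_ltn// lerDl sumr_ge0.
  have gc : g c <= \sum_(a <= j < c.+1) g j by rewrite big_nat_recr//= lerDr sumr_ge0.
  have s0 : 0 <= \sum_(a <= j < c.+1) g j by apply: sumr_ge0.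
  case oa : (odd a); case oc : (odd c.+1); rewrite ?mul1r ?mul0r ?addr0 ?add0r//.
  have ac1 : (a < c)%N.
    rewrite ltn_neqAle ac andbT; apply/eqP => e.
    by move: oc; rewrite /= -e oa.
  have -> : \sum_(a <= j < c.+1) g j = g a + \sum_(a.+1 <= j < c.+1) g j by rewrite big_ltn.
  by rewrite big_nat_recr//= [leLHS]addrC lerD2l lerDr sumr_ge0.
have b1 : b.-1.+1 = b by rewrite prednK// (leq_ltn_trans _ ab).
have {}hsum := hsum b.-1; rewrite -ltnS b1 in hsum.
have {}hsum := hsum ab.
apply: pos_le; last by rewrite addr_ge0 ?pos_ge0// sumr_ge0.
have h1 := hd (f b - f b.-1) (odd b).
have h2 := hd (f a.+1 - f a) (odd a).
have h3 : pos (`|f b - f b.-1| - y) = g b.-1.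
  by rewrite /g b1.
rewrite h3 -/(g a) in h1 h2.
have h4 := pos_ge (f' b./2 - f' (uphalf a) - x).
by rewrite fb fa; lra.
Qed.

(* Odd endpoints of a fine chain are moved to their even neighbours inside the interval, at the
   cost of one fine increment each. *)
Lemma halve_chain_sum (N n : nat) (a b : nat -> nat) : weak_chain N.*2 n a b ->
  exists a' b', weak_chain N n a' b' /\
  \sum_(i < n.+1) pos (f (b i) - f (a i) - (x + 2 * y)) <=
  \sum_(i < n.+1) pos (f' (b' i) - f' (a' i) - x) + \sum_(0 <= j < N.*2) g j.
Proof.
move=> ch; have [ab ba bN] := ch.
(* The minimum matters only for an empty interval at an odd point, where rounding inward would
   reverse the endpoints. *)
exists (fun i => minn (uphalf (a i)) (b i)./2), (fun i => (b i)./2); split.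
  split.
  - by move=> i _; rewrite geq_minr.
  - move=> i ni; have h1 := ba i ni; have h2 := ab i.+1 ni.
    rewrite leq_min !half_leq ?(leq_trans h1)// andbT.
    by rewrite uphalf_half (leq_trans (half_leq h1))// leq_addl.
  - by rewrite -[N]doubleK half_leq.
apply: le_trans (_ : \sum_(i < n.+1) (pos (f' (b i)./2 - f' (minn (uphalf (a i)) (b i)./2) - x)
  + \sum_(a i <= j < b i) g j) <= _).
  by apply: ler_sum => i _; apply: halve_term; rewrite ab// -ltnS.
by rewrite big_split/= lerD2l; exact: weak_chain_sum.
Qed.
End halving.

Section dyadic.
Variables (fs : nat -> nat -> R) (y : nat -> R) (M : nat).
Hypothesis fsE : forall k j, fs k.+1 j.*2 = fs k j.
Hypothesis y0 : forall k, 0 <= y k.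

(** Only excesses over [y k] are summed on the fine levels. For a process with increments of
    standard deviation [2 ^ (- k * h / 2)] on level [k], the full increments would add up to
    [M * 2 ^ (k * (1 - h / 2))], which diverges; the excesses are summable. *)
Definition dyadic_bound (m : nat) : R :=
  \sum_(0 <= j < M) `|fs 0 j.+1 - fs 0 j| +
  \sum_(k < m) \sum_(0 <= j < M * 2 ^ k.+1) pos (`|fs k.+1 j.+1 - fs k.+1 j| - y k).

Lemma dyadic_chain_bound m n a b (x : R) : 0 <= x -> weak_chain (M * 2 ^ m) n a b ->
  \sum_(i < n.+1) pos (fs m (b i) - fs m (a i) - (x + 2 * \sum_(k < m) y k)) <= dyadic_bound m.
Proof.
elim: m n a b x => [|m IH] n a b x x0.
  rewrite expn0 muln1 => ch; rewrite /dyadic_bound !big_ord0 addr0 mulr0 addr0.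
  apply: le_trans (weak_chain_sum (g := fun j => `|fs 0 j.+1 - fs 0 j|) ch _) => //.
  apply: ler_sum => i _; apply: pos_le; last by apply: sumr_ge0.
  have [ab _ _] := ch; have /ab abi : (i <= n)%N by rewrite -ltnS.
  apply: le_trans (ler_norm_sum _ _ _); rewrite telescope_sumr//.
  by rewrite (le_trans _ (ler_norm _))// gerBl.
rewrite expnS mulnCA mul2n => ch.
have x0' : 0 <= x + 2 * \sum_(k < m) y k by rewrite addr_ge0// mulr_ge0// sumr_ge0.
have [a' [b' [ch' h]]] := halve_chain_sum (fsE m) x0' (y0 m) ch.
have -> : \sum_(k < m.+1) y k = \sum_(k < m) y k + y m by rewrite big_ord_recr.
rewrite mulrDr addrA; apply: (le_trans h).
have -> : dyadic_bound m.+1 = dyadic_bound m +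
    \sum_(0 <= j < M * 2 ^ m.+1) pos (`|fs m.+1 j.+1 - fs m.+1 j| - y m).
  by rewrite /dyadic_bound [in LHS]big_ord_recr/= addrA.
rewrite expnS mulnCA mul2n lerD2r.
exact: IH.
Qed.
End dyadic.

End chains.

(** * Increments of fractional Brownian motion *)

Section power_concavity.
Context (R : realType) (h : R).
Hypothesis h01 : 0 < h < 1.

Let h0 : 0 < h. Proof. by case/andP: h01. Qed.
Let h1 : h < 1. Proof. by case/andP: h01. Qed.

Lemma powR_tangent (m x : R) : 0 < m -> 0 <= x ->
  x `^ h <= m `^ h * ((1 - h) + h * (x / m)).
Proof.
move=> m0; rewrite le_eqVlt => /predU1P[<-|x0].
  rewrite powR0 ?gt_eqF// mul0r mulr0 addr0.
  by rewrite mulr_ge0 ?powR_ge0// subr_ge0 ltW.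
have xm0 : 0 < x / m by rewrite divr_gt0.
have -> : x `^ h = m `^ h * (x / m) `^ h.
  by rewrite -powRM ?(ltW m0) ?(ltW xm0)// mulrC divfK// gt_eqF.
rewrite ler_pM2l ?powR_gt0//.
have -> : (x / m) `^ h = expR (h * ln (x / m)) by rewrite /powR gt_eqF.
apply: (le_trans (expR_interp _ _)); first by rewrite !ltW.
by rewrite lnK.
Qed.

Lemma powR_concave (l u v : R) : 0 <= l <= 1 -> 0 <= u -> 0 <= v ->
  l * u `^ h + (1 - l) * v `^ h <= (l * u + (1 - l) * v) `^ h.
Proof.
move=> /andP[l0 l1] u0 v0.
have l1' : 0 <= 1 - l by rewrite subr_ge0.
have [m0|m0] := ltP 0 (l * u + (1 - l) * v); last first.
  have e1 : l * u = 0.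
    by apply/eqP; rewrite eq_le mulr_ge0// andbT; apply: le_trans m0; rewrite lerDl mulr_ge0.
  have e2 : (1 - l) * v = 0.
    by apply/eqP; rewrite eq_le mulr_ge0// andbT; apply: le_trans m0; rewrite lerDr mulr_ge0.
  have z (c w : R) : c * w = 0 -> c * w `^ h = 0.
    by move/eqP; rewrite mulf_eq0 => /orP[/eqP ->|/eqP ->]; rewrite ?mul0r// powR0 ?mulr0// gt_eqF.
  by rewrite !z// addr0 powR_ge0.
set m := l * u + (1 - l) * v.
apply: le_trans (lerD (ler_wpM2l l0 (powR_tangent m0 u0)) (ler_wpM2l l1' (powR_tangent m0 v0))) _.
rewrite -/m; apply: le_of_eq.
transitivity (m `^ h * ((1 - h) + h * ((l * u + (1 - l) * v) / m))); first by ring.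
by rewrite -/m divff ?gt_eqF//; ring.
Qed.

(** The points [x + p] and [x + q] are convex combinations of [x] and [x + p + q] with exchanged
    weights, so two concavity inequalities add up to the claim. *)
Lemma powR_four_point (x p q : R) : 0 <= x -> 0 <= p -> 0 <= q ->
  (x + p + q) `^ h + x `^ h <= (x + p) `^ h + (x + q) `^ h.
Proof.
move=> x0 p0 q0.
have [pq0|pq0] := ltP 0 (p + q); last first.
  have e1 : p = 0 by lra.
  have e2 : q = 0 by lra.
  by rewrite e1 e2 !addr0.
have l01 : 0 <= q / (p + q) <= 1.
  by rewrite divr_ge0 ?(ltW pq0)//= ler_pdivrMr// mul1r lerDr.
have l01' : 0 <= p / (p + q) <= 1.
  by rewrite divr_ge0 ?(ltW pq0)//= ler_pdivrMr// mul1r lerDl.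
have y0 : 0 <= x + p + q by rewrite !addr_ge0.
have k1 := powR_concave l01 x0 y0; have k2 := powR_concave l01' x0 y0.
have e1 : q / (p + q) * x + (1 - q / (p + q)) * (x + p + q) = x + p by field; rewrite gt_eqF.
have e2 : p / (p + q) * x + (1 - p / (p + q)) * (x + p + q) = x + q by field; rewrite gt_eqF.
rewrite e1 in k1; rewrite e2 in k2.
apply: le_trans (lerD k1 k2); apply: le_of_eq.
by field; rewrite gt_eqF.
Qed.

(* Jensen's inequality, through the tangent of [x `^ h] at the mean. *)
Lemma sum_powR_le (J : finType) (B : {set J}) (x : J -> R) (S : R) :
  (forall j, j \in B -> 0 <= x j) -> \sum_(j in B) x j <= S ->
  \sum_(j in B) x j `^ h <= #|B|%:R `^ (1 - h) * S `^ h.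
Proof.
move=> x0 xS; have s0 : 0 <= \sum_(j in B) x j by apply: sumr_ge0.
apply: (@le_trans _ _ (#|B|%:R `^ (1 - h) * (\sum_(j in B) x j) `^ h)); last first.
  have S0 : 0 <= S by exact: le_trans xS.
  by rewrite ler_wpM2l ?powR_ge0//; apply: ge0_ler_powR; rewrite ?nnegrE// ltW.
move: s0; rewrite le_eqVlt => /predU1P[s0|s0].
  rewrite big1 ?mulr_ge0 ?powR_ge0// => j jB.
  have := psumr_eq0P x0 (esym s0) => ->//.
  by rewrite powR0// gt_eqF.
have B0 : (0 : R) < #|B|%:R.
  rewrite ltr0n lt0n; apply/eqP => /eqP; rewrite cards_eq0 => /eqP B0.
  by move: s0; rewrite B0 big_set0 ltxx.
set s := \sum_(j in B) x j; pose m := s / #|B|%:R.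
have m0 : 0 < m by rewrite divr_gt0.
apply: (@le_trans _ _ (\sum_(j in B) (m `^ h * ((1 - h) + h * (x j / m))))).
  by apply: ler_sum => j jB; apply: powR_tangent => //; exact: x0.
rewrite -mulr_sumr big_split/= sumr_const -mulr_sumr -mulr_suml -/s.
apply: le_of_eq.
have -> : s / m = #|B|%:R by rewrite /m invf_div mulrCA divff ?mulr1// gt_eqF.
have -> : (1 - h) *+ #|B| + h * #|B|%:R = #|B|%:R by rewrite -mulr_natl; ring.
have -> : #|B|%:R `^ (1 - h) = (#|B|%:R^-1) `^ h * #|B|%:R.
  rewrite -powR_inv1 ?(ltW B0)// -powRrM mulN1r -{3}[#|B|%:R]powRr1 ?(ltW B0)//.
  by rewrite -powRD ?(gt_eqF B0) ?implybT// addrC.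
by rewrite /m powRM ?invr_ge0 ?(ltW s0) ?(ltW B0)//; ring.
Qed.
End power_concavity.

Section fbm_covariance.
Context (R : realType) (h : R).
Hypothesis h01 : 0 < h < 1.

Definition fbm_cov_fun (s t : R) : R :=
  2^-1 * (`|s| `^ h + `|t| `^ h - `|t - s| `^ h).

(* Covariance of the increments over [a, b] and [a', b'] of a process with covariance
   [fbm_cov_fun]. *)
Definition incr_cov (a b a' b' : R) : R :=
  (fbm_cov_fun b b' - fbm_cov_fun b a') - (fbm_cov_fun a b' - fbm_cov_fun a a').

Lemma incr_cov_self a b : a <= b -> incr_cov a b a b = (b - a) `^ h.
Proof.
move=> ab; rewrite /incr_cov /fbm_cov_fun !subrr normr0 powR0; last first.
  by case/andP: h01 => h0 _; rewrite gt_eqF.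
have e1 : `|b - a| = b - a by rewrite ger0_norm// subr_ge0.
by rewrite (distrC a b) e1; field.
Qed.

Lemma incr_covC a b a' b' : incr_cov a b a' b' = incr_cov a' b' a b.
Proof.
have C s t : fbm_cov_fun s t = fbm_cov_fun t s by rewrite /fbm_cov_fun distrC; ring.
by rewrite /incr_cov (C b b') (C b a') (C a b') (C a a'); ring.
Qed.

(* With [h = 2 * H], this is where [H < 1 / 2] enters. *)
Lemma incr_cov_le0 a b a' b' : a <= b -> b <= a' -> a' <= b' -> incr_cov a b a' b' <= 0.
Proof.
move=> ab ba' a'b'.
have := @powR_four_point R h h01 (a' - b) (b - a) (b' - a') _ _ _.
rewrite !subr_ge0 => /(_ ba' ab a'b').
rewrite (_ : a' - b + (b - a) + (b' - a') = b' - a); last by ring.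
rewrite (_ : a' - b + (b - a) = a' - a); last by ring.
rewrite (_ : a' - b + (b' - a') = b' - b); last by ring.
rewrite /incr_cov /fbm_cov_fun.
have n (u v : R) : u <= v -> `|v - u| = v - u by move=> uv; rewrite ger0_norm// subr_ge0.
have bb' := le_trans ba' a'b'; have ab' := le_trans ab bb'; have aa' := le_trans ab ba'.
by rewrite !n//; lra.
Qed.

Section increments_form.
Context (I J : finType) (t : I -> R) (kk : R) (B : {set J}) (a b : J -> I).
Hypothesis kk0 : 0 <= kk.

(** Coefficients, on the values of the process, of the sum of the increments over [B]: the
    concentration inequality is about linear forms in these values. *)
Definition incr_vec (v : I) : R := \sum_(j in B) ((b j == v)%:R - (a j == v)%:R).

Lemma incr_vecE (G : I -> R) : \sum_v incr_vec v * G v = \sum_(j in B) (G (b j) - G (a j)).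
Proof.
rewrite /incr_vec; under eq_bigr do rewrite mulr_suml.
rewrite exchange_big/=; apply: eq_bigr => j _.
have dl c : \sum_v (c == v)%:R * G v = G c.
  rewrite (bigD1 c)//= eqxx mul1r big1 ?addr0// => v /negbTE vc.
  by rewrite eq_sym vc mul0r.
by under eq_bigr do rewrite mulrBl; rewrite sumrB !dl.
Qed.

Lemma incr_vec_cov_form (S : R) :
  (forall j, j \in B -> t (a j) <= t (b j)) ->
  (forall i j, i \in B -> j \in B -> i != j -> t (b i) <= t (a j) \/ t (b j) <= t (a i)) ->
  \sum_(j in B) (t (b j) - t (a j)) <= S ->
  cov_form (fun i j => kk * fbm_cov_fun (t i) (t j)) incr_vec <=
  kk * (#|B|%:R `^ (1 - h) * S `^ h).
Proof.
move=> tab sep tS.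
have -> : cov_form (fun i j => kk * fbm_cov_fun (t i) (t j)) incr_vec =
    \sum_(i in B) \sum_(j in B) kk * incr_cov (t (a i)) (t (b i)) (t (a j)) (t (b j)).
  rewrite /cov_form.
  under eq_bigr => v _.
    under eq_bigr do rewrite -mulrA.
    rewrite -mulr_sumr incr_vecE.
    over.
  rewrite incr_vecE; apply: eq_bigr => i _; rewrite -sumrB; apply: eq_bigr => j _.
  by rewrite /incr_cov; ring.
apply: (@le_trans _ _ (\sum_(i in B) kk * (t (b i) - t (a i)) `^ h)).
  apply: ler_sum => i iB; rewrite (bigD1 i)//= incr_cov_self ?tab// gerDl.
  apply: sumr_le0 => j /andP[jB ji]; rewrite mulr_ge0_le0//.
  have [bi|bj] := sep _ _ iB jB (negbT (negbTE (introN eqP (fun e => elimN eqP ji (esym e))))).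
    by apply: incr_cov_le0 => //; exact: tab.
  by rewrite incr_covC; apply: incr_cov_le0 => //; exact: tab.
rewrite -mulr_sumr ler_wpM2l//; apply: (sum_powR_le h01) => // j jB.
by rewrite subr_ge0 tab.
Qed.
End increments_form.

End fbm_covariance.

(** * Sets of disjoint intervals of a grid *)

Section interval_sets.
Context (N : nat).
Local Notation I := 'I_N.+1.

(** Gaps are strict, as in [interval_chain]. Unordered sets of pairs form a finite type, over which
    the maximum can be taken. *)
Definition separated (Q : {set I * I}) : bool :=
  [forall z in Q, (z.1 < z.2)%N] &&
  [forall z in Q, forall z' in Q, (z != z') ==> ((z.2 < z'.1)%N || (z'.2 < z.1)%N)].

Lemma separatedP (Q : {set I * I}) : reflect
  ((forall z, z \in Q -> (z.1 < z.2)%N) /\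
   (forall z z', z \in Q -> z' \in Q -> z != z' -> (z.2 < z'.1)%N \/ (z'.2 < z.1)%N))
  (separated Q).
Proof.
apply: (iffP andP) => -[h1 h2]; split.
- by move=> z zQ; exact: (forall_inP h1).
- move=> z z' zQ zQ' zz'; apply/orP.
  by have /forall_inP/(_ _ zQ')/implyP/(_ zz') := forall_inP h2 _ zQ.
- exact/forall_inP.
- apply/forall_inP => z zQ; apply/forall_inP => z' zQ'; apply/implyP => zz'.
  by apply/orP; exact: h2.
Qed.

(** Sorting by left endpoints. The sum identity holds for all [g], so that one enumeration serves
    lengths, increments and gains. *)
Lemma separated_chain (R : realType) (Q : {set I * I}) : separated Q -> (0 < #|Q|)%N ->
  exists a b : nat -> nat,
  [/\ forall i, (i <= #|Q|.-1)%N -> (a i < b i)%N,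
      forall i, (i < #|Q|.-1)%N -> (b i < a i.+1)%N,
      forall i, (b i <= N)%N &
      forall g : nat -> nat -> R,
        \sum_(z in Q) g z.1 z.2 = \sum_(i < #|Q|.-1.+1) g (a i) (b i)].
Proof.
move=> /separatedP[h1 h2] Qp; pose le1 := fun z z' : I * I => (z.1 <= z'.1)%N.
pose s := sort le1 (enum Q).
have le1_total : total le1 by move=> z z'; exact: leq_total.
have le1_trans : transitive le1 by move=> z z' z''; exact: leq_trans.
have ss : sorted le1 s by exact: sort_sorted.
have sz : size s = #|Q| by rewrite size_sort cardE.
have us : uniq s by rewrite sort_uniq enum_uniq.
have ms z : (z \in s) = (z \in Q) by rewrite mem_sort mem_enum.
pose z0 : I * I := (ord0, ord0).
have nQ i : (i <= #|Q|.-1)%N -> nth z0 s i \in Q.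
  by move=> iQ; rewrite -ms mem_nth// sz -(prednK Qp) ltnS.
exists (fun i => (nth z0 s i).1 : nat), (fun i => (nth z0 s i).2 : nat); split.
- by move=> i /nQ; exact: h1.
- move=> i iQ; have m1 := nQ _ (ltnW iQ); have m2 := nQ _ iQ.
  have i1 : (i < size s)%N by rewrite sz -(prednK Qp) ltnS ltnW.
  have i2 : (i.+1 < size s)%N by rewrite sz -(prednK Qp) ltnS.
  have ne : nth z0 s i != nth z0 s i.+1 by rewrite nth_uniq// ltn_eqF.
  have [//|l] := h2 _ _ m1 m2 ne.
  have : le1 (nth z0 s i) (nth z0 s i.+1) by apply: (sorted_leq_nth le1_trans _ z0 ss) => // z; exact: leqnn.
  by rewrite /le1 => l'; have := leq_ltn_trans l' (ltn_trans (h1 _ m2) l); rewrite ltnn.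
- by move=> i; rewrite -ltnS ltn_ord.
- move=> g; rewrite (prednK Qp) -sz -(big_mkord xpredT (fun i => g (nth z0 s i).1 (nth z0 s i).2)).
  rewrite -(big_nth z0 xpredT (fun z => g z.1 z.2)) -big_enum.
  by apply: perm_big; rewrite perm_sym perm_sort.
Qed.

(* Only the intervals with a positive contribution are selected. *)
Lemma chain_separated (R : realType) (n : nat) (a b : nat -> nat) (g : nat -> nat -> R) :
  (forall i, (i <= n)%N -> (a i < b i)%N) -> (forall i, (i < n)%N -> (b i < a i.+1)%N) ->
  (b n <= N)%N ->
  exists2 Q : {set I * I}, separated Q &
    \sum_(i < n.+1) Num.max (g (a i) (b i)) 0 = \sum_(z in Q) g z.1 z.2.
Proof.
move=> ab ba bN.
have ba' i j : (i < j <= n)%N -> (b i < a j)%N.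
  elim: j => // j IH /andP[]; rewrite ltnS leq_eqVlt => /predU1P[->|ij] jn; first exact: ba.
  by apply: ltn_trans (ba _ jn); apply: ltn_trans (ab _ (ltnW jn)); apply: IH; rewrite ij ltnW.
have bN' i : (i <= n)%N -> (b i < N.+1)%N.
  rewrite leq_eqVlt => /predU1P[->//|i_n]; rewrite ltnS (leq_trans _ bN)// ltnW//.
  by rewrite (ltn_trans (ba' i n _))// ?i_n ?leqnn ?ab.
have aN' i : (i <= n)%N -> (a i < N.+1)%N.
  by move=> i_n; rewrite (ltn_trans (ab i i_n))// bN'.
pose f (i : 'I_n.+1) : I * I := (inord (a i), inord (b i)).
have fE i : (f i).1 = a i :> nat /\ (f i).2 = b i :> nat.
  by have i_n := ltn_ord i; rewrite ltnS in i_n; rewrite /f/=; split; rewrite inordK ?aN' ?bN'.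
have finj : injective f.
  move=> i j fij; apply: val_inj => /=; have [e1 e2] := fE i; have [e3 e4] := fE j.
  rewrite fij in e1 e2; rewrite e1 in e3; rewrite e2 in e4.
  have := ltn_ord i; have := ltn_ord j; rewrite !ltnS => jn i_n.
  case: (ltngtP i j) => // ij.
    by have := ba' i j; rewrite ij jn => /(_ isT); have := ab j jn; lia.
  by have := ba' j i; rewrite ij i_n => /(_ isT); have := ab j jn; have := ab i i_n; lia.
pose B : {set 'I_n.+1} := [set i : 'I_n.+1 | 0 < g (a i) (b i)]%SET.
exists (f @: B).
  apply/separatedP; split => [z /imsetP[i _ ->]|z z' /imsetP[i _ ->] /imsetP[j _ ->] ne].
    by have [-> ->] := fE i; rewrite ab// -ltnS.
  have [-> ->] := fE i; have [-> ->] := fE j.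
  have := ltn_ord i; have := ltn_ord j; rewrite !ltnS => jn i_n.
  case: (ltngtP i j) => ij; [left|right|].
  - by apply: ba'; rewrite ij.
  - by apply: ba'; rewrite ij.
  - by move: ne; rewrite (val_inj ij) eqxx.
rewrite big_imset; last by move=> i j _ _; exact: finj.
rewrite [RHS]big_mkcond; apply: eq_bigr => i _; rewrite inE.
by have [-> ->] := fE i; case: ltP.
Qed.
End interval_sets.

(** * Expected truncated variation on a grid *)

Section truncated_increment.
Context d (T : measurableType d) (R : realType) (P : probability T R).

(** By [x <= expR x], the excess is at most [sigma * expR ((|Z| - y) / sigma)], and the exponential
    moment at [sigma^-1] is bounded. An exponential tail is enough, because [y / sigma] will grow
    geometrically with the level. *)
Lemma cgauss_truncated (Z : T -> R) (v sigma y : R) : cgauss P Z v -> 0 < sigma ->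
  v <= sigma ^+ 2 ->
  (\int[P]_w (Num.max (`|Z w| - y) 0)%:E <=
   (2 * expR 2^-1 * (sigma * expR (- (y / sigma))))%:E)%E.
Proof.
move=> gZ s0 vs; have mZ : measurable_fun setT Z by case: gZ.
have me : measurable_fun setT (fun w => (expR `|sigma^-1 * Z w|)%:E).
  by apply/measurable_EFinP; apply: measurableT_comp => //; apply: measurableT_comp => //; exact: measurable_funM.
apply: (@le_trans _ _ (\int[P]_w ((sigma * expR (- (y / sigma)))%:E * (expR `|sigma^-1 * Z w|)%:E))%E).
  apply: ge0_le_integral => //=.
  - by move=> w _; rewrite lee_fin pos_ge0.
  - apply/measurable_EFinP; apply: measurable_maxr => //; apply: measurable_funB => //.
    exact: measurableT_comp.
  - by apply: emeasurable_funM => //; exact: measurable_cst.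
  - move=> w _; rewrite -EFinM lee_fin -mulrA -expRD.
    have h : `|Z w| - y = sigma * (- (y / sigma) + `|sigma^-1 * Z w|).
      rewrite normrM gtr0_norm ?invr_gt0//; field; exact: lt0r_neq0.
    rewrite h ge_max mulr_ge0 ?expR_ge0 ?(ltW s0)// andbT ler_pM2l//.
    by rewrite (le_trans _ (expR_ge1Dx _))// lerDr.
rewrite ge0_integralZl//; last by rewrite lee_fin mulr_ge0 ?expR_ge0// ltW.
rewrite [(2 * _ * _)]mulrC [leRHS]EFinM.
apply: lee_wpmul2l; first by rewrite lee_fin mulr_ge0 ?expR_ge0// ltW.
apply: (le_trans (cgauss_expR_norm sigma^-1 gZ)).
rewrite lee_fin ler_wpM2l// ler_expR ler_pdivrMr// mulVf// exprVn ler_pdivrMr ?exprn_gt0//.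
by rewrite mul1r.
Qed.
End truncated_increment.

Section chaining_constants.
Context (R : realType) (h : R).
Hypothesis h0 : 0 < h.

(* An increment over the l-th dyadic level has standard deviation at most
   [chain_ratio ^+ (2 * l)]; the l-th truncation level is proportional to [chain_ratio ^+ l]. *)
Definition chain_ratio : R := 2 `^ (- (h / 4)).
(** Scales the truncation levels to a total of at most 1/4, so that the two endpoints of an interval
    use up at most half of its cost. *)
Definition chain_step : R := (1 - chain_ratio) / 4.
(** Large enough for [chain_ratio ^+ chain_power <= 4^-1]. In [chain_tail], [expR (- z)] is at most
    [(p / z) ^+ p] with [z] proportional to [chain_ratio ^- l]; the resulting [4 ^- l] outweighs the
    [M * 2 ^ l] intervals of level [l]. *)
Definition chain_power : nat := (Num.truncn (8 / h)).+1.
Definition chain_const : R :=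
  2 * expR 2^-1 * (1 + (chain_power%:R / chain_step) ^+ chain_power).

Let rho := chain_ratio.
Let eta := chain_step.
Let p := chain_power.

Lemma chain_ratio_gt0 : 0 < rho. Proof. exact: powR_gt0. Qed.

Lemma chain_ratio_lt1 : rho < 1.
Proof.
rewrite /rho /chain_ratio /powR gt_eqF// expR_lt1 mulNr oppr_lt0 mulr_gt0 ?divr_gt0//.
by rewrite ln_gt0// ltr1n.
Qed.

Lemma chain_step_gt0 : 0 < eta.
Proof. by rewrite divr_gt0// subr_gt0 chain_ratio_lt1. Qed.

Lemma chain_const_gt0 : 0 < chain_const.
Proof.
rewrite mulr_gt0 ?mulr_gt0 ?expR_gt0// ltr_pwDl// exprn_ge0// divr_ge0//.
exact: ltW chain_step_gt0.
Qed.

Lemma chain_step_sum (m : nat) : 2 * \sum_(k < m) (eta * rho ^+ k.+1) <= 2^-1.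
Proof.
have r0 := chain_ratio_gt0; have r1 := chain_ratio_lt1.
suff : \sum_(k < m) (eta * rho ^+ k.+1) <= 4^-1 * (1 - rho ^+ m).
  by have := exprn_ge0 m (ltW r0); lra.
elim: m => [|m IH]; first by rewrite big_ord0 expr0 subrr mulr0.
rewrite big_ord_recr/=; apply: (le_trans (lerD IH (lexx _))).
have rm := exprn_ge0 m (ltW r0).
by rewrite /eta /chain_step -/rho exprS; have := mulr_ge0 (sqr_ge0 (1 - rho)) rm; lra.
Qed.

Lemma chain_ratio_pow4 (l : nat) : (2 ^+ l)^-1 `^ h = (rho ^+ (2 * l)) ^+ 2.
Proof.
rewrite -exprM -powR_mulrn ?(ltW chain_ratio_gt0)// /rho /chain_ratio -powRrM.
rewrite -(powR_mulrn l (ler0n _ 2)) -powRN -powRrM; congr (_ `^ _).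
by rewrite !natrM; field.
Qed.

Lemma chain_tail (l : nat) :
  rho ^+ (2 * l) * expR (- (eta * rho ^+ l / rho ^+ (2 * l))) <=
  (p%:R / eta) ^+ p * (4 ^+ l)^-1.
Proof.
have r0 := chain_ratio_gt0; have r1 := chain_ratio_lt1; have e0 := chain_step_gt0.
have p0 : (0 : R) < p%:R by rewrite ltr0n.
have rl : 0 < rho ^+ l by rewrite exprn_gt0.
have -> : eta * rho ^+ l / rho ^+ (2 * l) = eta / rho ^+ l.
  by rewrite mul2n -addnn exprD; field; rewrite gt_eqF.
set z := eta / rho ^+ l; have z0 : 0 < z by rewrite divr_gt0.
have zp : expR (- z) <= (p%:R / z) ^+ p.
  have : (z / p%:R) ^+ p <= expR z.
    rewrite (_ : expR z = expR (z / p%:R) ^+ p); last by rewrite -expRM_natl mulrC divfK// gt_eqF.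
    rewrite lerXn2r ?nnegrE ?expR_ge0 ?(divr_ge0 (ltW z0) (ltW p0))//.
    by rewrite (le_trans _ (expR_ge1Dx _))// lerDr.
  by rewrite expRN -[p%:R / z]invf_div exprVn lef_pV2 ?posrE ?expR_gt0 ?(exprn_gt0 _ (divr_gt0 z0 p0)).
have -> : (p%:R / eta) ^+ p * (4 ^+ l)^-1 = 1 * ((p%:R / eta) ^+ p * (4 ^+ l)^-1) by rewrite mul1r.
apply: ler_pM; rewrite ?expR_ge0 ?exprn_ge0 ?(ltW r0)//.
  by rewrite exprn_ile1// ltW.
have q0 : 0 <= (p%:R / eta) ^+ p by rewrite exprn_ge0// (divr_ge0 (ltW p0) (ltW e0)).
apply: (le_trans zp); rewrite /z invf_div mulrA [p%:R * _]mulrC -mulrA [X in X <= _]exprMn mulrC.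
rewrite ler_wpM2l//.
rewrite -exprM mulnC exprM -exprVn lerXn2r ?nnegrE ?exprn_ge0 ?(ltW r0) ?invr_ge0//.
rewrite -powR_mulrn ?(ltW r0)// /rho /chain_ratio -powRrM.
have e4 : (4^-1 : R) = 2 `^ (- 2%:R) by rewrite powRN powR_mulrn// expr2 -natrM.
rewrite [leRHS]e4 ler_powR ?ler1n//.
have : 8 / h < p%:R by rewrite /p /chain_power truncnS_gt.
by rewrite ltr_pdivrMr//; lra.
Qed.

Lemma chain_level (l : nat) (M : nat) :
  (M * 2 ^ l)%:R * (rho ^+ (2 * l) * expR (- (eta * rho ^+ l / rho ^+ (2 * l)))) <=
  M%:R * ((p%:R / eta) ^+ p * (2 ^+ l)^-1).
Proof.
have q0 : 0 <= (p%:R / eta) ^+ p by rewrite exprn_ge0// divr_ge0// ltW// chain_step_gt0.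
rewrite natrM natrX -mulrA ler_wpM2l//.
apply: le_trans (ler_wpM2l _ (chain_tail l)) _; first by rewrite exprn_ge0.
rewrite mulrCA ler_wpM2l//.
rewrite (_ : 4 = 2 * 2); last by rewrite -natrM.
by rewrite exprMn invfM mulrA mulfV ?mul1r// expf_neq0.
Qed.
End chaining_constants.

(** The factor [kk] accommodates the process divided by [c], with either sign. *)
Definition fbm_family d (T : measurableType d) (R : realType) (P : probability T R)
    (X : R -> T -> R) (kk h : R) : Prop :=
  forall n (t : 'I_n -> R), (forall i, 0 <= t i) ->
    gaussian_family P (fun i => X (t i)) (fun i j => kk * fbm_cov_fun h (t i) (t j)).

Section chaining.
Context d (T : measurableType d) (R : realType) (P : probability T R).
Context (X : R -> T -> R) (kk h S : R) (M : nat).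
Hypotheses (fX : fbm_family P X kk h) (h01 : 0 < h < 1) (kk0 : 0 <= kk) (S0 : 0 < S)
  (M0 : (0 < M)%N) (kkS : kk * S `^ h <= M%:R `^ h).

Let h0 : 0 < h. Proof. by case/andP: h01. Qed.

Lemma fbm_increment (a b : R) : 0 <= a <= b ->
  cgauss P (fun w => X b w - X a w) (kk * (b - a) `^ h).
Proof.
move=> /andP[a0 ab]; pose t (i : 'I_2) := if i == ord0 then a else b.
have t0 i : 0 <= t i by rewrite /t; case: ifP => // _; exact: le_trans ab.
have := fX t0 (fun i => if i == ord0 then -1 else 1).
rewrite -(incr_cov_self h01 ab) /cov_form /incr_cov !big_ord_recl !big_ord0 /t/=.
rewrite (_ : lincomb _ _ = (fun w => X b w - X a w)); last first.
  by apply/funext => w; rewrite /lincomb !big_ord_recl big_ord0/=; ring.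
by congr cgauss; ring.
Qed.

Definition dyadic (m j : nat) : R := S * j%:R / (M * 2 ^ m)%:R.

Lemma dyadic_ge0 m j : 0 <= dyadic m j.
Proof. by rewrite /dyadic divr_ge0// mulr_ge0// ltW. Qed.

Let dyp m : (0 : R) < (M * 2 ^ m)%:R.
Proof. by rewrite ltr0n muln_gt0 M0 expn_gt0. Qed.

Lemma dyadic_double m j : dyadic m.+1 j.*2 = dyadic m j.
Proof.
rewrite /dyadic expnS mulnCA -mul2n !natrM.
by field; rewrite !pnatr_eq0 -!lt0n M0 expn_gt0.
Qed.

Lemma dyadic_step m j : dyadic m j.+1 - dyadic m j = S / (M * 2 ^ m)%:R.
Proof. by rewrite /dyadic -natr1; ring. Qed.

Lemma dyadic_le m i j : (i <= j)%N -> dyadic m i <= dyadic m j.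
Proof.
by move=> ij; rewrite /dyadic ler_pM2r ?invr_gt0// ler_pM2l// ler_nat.
Qed.

Lemma dyadic_lt m i j : (i < j)%N -> dyadic m i < dyadic m j.
Proof.
by move=> ij; rewrite /dyadic ltr_pM2r ?invr_gt0// ltr_pM2l// ltr_nat.
Qed.

Lemma dyadic_increment m j :
  cgauss P (fun w => X (dyadic m j.+1) w - X (dyadic m j) w) (kk * (S / (M * 2 ^ m)%:R) `^ h).
Proof. by rewrite -(dyadic_step m j); apply: fbm_increment; rewrite dyadic_ge0 dyadic_le. Qed.

(** By [kkS], an increment over a coarsest step [S / M] has variance at most 1. This is what fixes
    the size of [M]; each halving of the step multiplies the variance by [2 ^ (- h)]. *)
Lemma dyadic_variance m : kk * (S / (M * 2 ^ m)%:R) `^ h <= (chain_ratio h ^+ (2 * m)) ^+ 2.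
Proof.
rewrite -chain_ratio_pow4// natrM invfM natrX mulrA powRM ?invr_ge0 ?exprn_ge0 ?divr_ge0 ?(ltW S0)//.
rewrite mulrA ler_piMl ?powR_ge0//.
rewrite powRM ?invr_ge0 ?(ltW S0)// mulrA -powR_inv1// -powRrM mulN1r powRN ler_pdivrMr ?mul1r//.
by rewrite powR_gt0// ltr0n.
Qed.

Definition chain_bound m w : R :=
  dyadic_bound (fun k j => X (dyadic k j) w) (fun k => chain_step h * chain_ratio h ^+ k.+1) M m.

Let mX m j : measurable_fun setT (fun w => X (dyadic m j.+1) w - X (dyadic m j) w).
Proof. by case: (dyadic_increment m j). Qed.

Let mpos m j (y : R) : measurable_fun setT
  (fun w => (Num.max (`|X (dyadic m j.+1) w - X (dyadic m j) w| - y) 0)%:E).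
Proof.
apply/measurable_EFinP; apply: measurable_maxr => //; apply: measurable_funB => //.
exact: measurableT_comp.
Qed.

Lemma chain_bound_ge0 m w : 0 <= chain_bound m w.
Proof.
rewrite addr_ge0//; first by apply: sumr_ge0.
by apply: sumr_ge0 => k _; apply: sumr_ge0 => j _; rewrite pos_ge0.
Qed.

Let chain_boundE m w : (chain_bound m w)%:E =
  (\sum_(0 <= j < M) (Num.max (`|X (dyadic 0 j.+1) w - X (dyadic 0 j) w| - 0) 0)%:E +
   \sum_(k < m) \sum_(0 <= j < M * 2 ^ k.+1)
     (Num.max (`|X (dyadic k.+1 j.+1) w - X (dyadic k.+1 j) w| -
        chain_step h * chain_ratio h ^+ k.+1) 0)%:E)%E.
Proof.
rewrite /chain_bound /dyadic_bound EFinD -!sumEFin; congr (_ + _)%E.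
  by apply: eq_bigr => j _; rewrite subr0 max_l.
by apply: eq_bigr => k _; rewrite sumEFin.
Qed.

Lemma measurable_chain_bound m : measurable_fun setT (chain_bound m).
Proof.
apply/measurable_EFinP; rewrite /comp; under eq_fun do rewrite chain_boundE.
apply: emeasurable_funD; first by apply: emeasurable_sum => j; exact: mpos.
by apply: emeasurable_sum => k; apply: emeasurable_sum => j; exact: mpos.
Qed.

Lemma chain_bound_integral m : (\int[P]_w (chain_bound m w)%:E <= (chain_const h * M%:R)%:E)%E.
Proof.
under eq_integral do rewrite chain_boundE.
have pos0 k j (y : R) w : (0 <= (Num.max (`|X (dyadic k j.+1) w - X (dyadic k j) w| - y) 0)%:E)%E.
  by rewrite lee_fin pos_ge0.
have r0 := chain_ratio_gt0 h; have e0 := chain_step_gt0 h0.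
rewrite ge0_integralD//=; first last.
- by apply: emeasurable_sum => k; apply: emeasurable_sum => j; exact: mpos.
- by move=> w _; apply: sume_ge0 => k _; apply: sume_ge0.
- by apply: emeasurable_sum => j; exact: mpos.
- by move=> w _; apply: sume_ge0.
set e2 : R := 2 * expR 2^-1.
have e20 : 0 <= e2 by rewrite mulr_ge0 ?expR_ge0.
set q := (chain_power h)%:R / chain_step h.
have level k (y : R) : (\int[P]_w (\sum_(0 <= j < M * 2 ^ k)
     (Num.max (`|X (dyadic k j.+1) w - X (dyadic k j) w| - y) 0)%:E) <=
   ((M * 2 ^ k)%:R * (e2 * (chain_ratio h ^+ (2 * k) * expR (- (y / chain_ratio h ^+ (2 * k))))))%:E)%E.
  rewrite ge0_integral_sum//.
  apply: (@le_trans _ _ (\sum_(0 <= j < M * 2 ^ k)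
     (e2 * (chain_ratio h ^+ (2 * k) * expR (- (y / chain_ratio h ^+ (2 * k)))))%:E)%E).
    apply: lee_sum => j _; apply: (cgauss_truncated _ (dyadic_increment k j)); first by rewrite exprn_gt0.
    exact: dyadic_variance.
  by rewrite sumEFin sumr_const_nat subn0 mulr_natl.
rewrite /chain_const -/e2 -/q mulrDr mulr1 mulrDl EFinD; apply: leeD.
  have := level 0%N 0; rewrite expn0 muln1 muln0 expr0 mul0r oppr0 expR0 !mulr1.
  by rewrite mulrC.
rewrite ge0_integral_sum//; first last.
- by move=> k w _; apply: sume_ge0.
- by move=> k; apply: emeasurable_sum => j; exact: mpos.
apply: (@le_trans _ _ (\sum_(k < m) (e2 * (M%:R * (q ^+ chain_power h * (2 ^+ k.+1)^-1)))%:E)%E).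
  apply: lee_sum => k _; apply: (le_trans (level _ _)); rewrite lee_fin mulrCA ler_wpM2l//.
  exact: chain_level.
rewrite sumEFin lee_fin -!mulr_sumr -mulrA ler_wpM2l// mulrC ler_wpM2r//.
have q0 : 0 <= q by exact: divr_ge0 (ltW e0).
rewrite ler_piMr ?exprn_ge0//.
suff -> : \sum_(k < m) (2 ^+ k.+1)^-1 = 1 - (2 ^+ m)^-1 :> R by rewrite gerBl invr_ge0 exprn_ge0.
elim: m => [|m IH]; first by rewrite big_ord0 expr0 invr1 subrr.
by rewrite big_ord_recr/= IH exprS; field; rewrite expf_neq0.
Qed.
End chaining.

(** * Tail bounds from exponential moments *)

Lemma measurable_gtr d (T : measurableType d) (R : realType) (f : T -> R) (u : R) :
  measurable_fun setT f -> measurable [set w | u < f w].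
Proof.
move=> mf; have /measurable_EFinP me := mf.
by have := emeasurable_fun_o_infty measurableT me u%:E; rewrite setTI.
Qed.

Section chernoff.
Context d (T : measurableType d) (R : realType) (P : probability T R).
Context (F : T -> R) (mu s2 : R).
Hypotheses (mF : measurable_fun setT F) (s20 : 0 < s2).
Hypothesis mgf : forall l : R,
  (\int[P]_w (expR (l * (F w - mu)))%:E <= (expR (8 * l ^+ 2 * s2))%:E)%E.

Let me l (c : R) : measurable_fun setT (fun w => (expR (l * (F w - c)))%:E).
Proof.
apply/measurable_EFinP; apply: measurableT_comp => //; apply: measurable_funM => //.
exact: measurable_funB.
Qed.

(** A parameter [l] of either sign serves both tails. The choice [|l| = u / (16 * s2)] made below
    minimises the exponent and gives [- u ^+ 2 / (32 * s2)]. *)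
Lemma subgaussian_tail (l u : R) (A : set T) : measurable A ->
  (forall w, A w -> l * u <= l * (F w - mu)) ->
  (P A <= (expR (8 * l ^+ 2 * s2 - l * u))%:E)%E.
Proof.
move=> mA Au; rewrite expRD EFinM muleC.
apply: (@le_trans _ _ ((expR (- (l * u)))%:E * \int[P]_w (expR (l * (F w - mu)))%:E)%E); last first.
  by apply: lee_wpmul2l => //; rewrite lee_fin expR_ge0.
rewrite -ge0_integralZl//=.
rewrite -(setIT A) -integral_indic//; apply: ge0_le_integral => //=.
- exact/measurable_EFinP.
- by apply: emeasurable_funM; [exact: measurable_cst|exact: me].
- move=> w _; rewrite -EFinM lee_fin indicE -expRD; case: (boolP (w \in A)) => [|_]; last exact: expR_ge0.
  by rewrite inE => /Au h; rewrite -expR0 ler_expR addrC subr_ge0.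
Qed.

Lemma subgaussian_upper (u : R) : 0 < u ->
  (P [set w | u <= F w - mu]%R <= (expR (- (u ^+ 2 / (32 * s2))))%:E)%E.
Proof.
move=> u0; have l0 : 0 <= u / (16 * s2) by rewrite divr_ge0 ?mulr_ge0// ltW.
apply: (@le_trans _ _ _ _ _ (@subgaussian_tail (u / (16 * s2)) u _ _ _)).
- rewrite -[X in measurable X]setTI; apply: measurable_fun_le => //; exact: measurable_funB.
- by move=> w /= h; rewrite ler_wpM2l.
- by rewrite lee_fin ler_expR; apply: le_of_eq; field; rewrite gt_eqF.
Qed.

Lemma subgaussian_lower (u : R) : 0 < u ->
  (P [set w | F w - mu <= - u]%R <= (expR (- (u ^+ 2 / (32 * s2))))%:E)%E.
Proof.
move=> u0; have l0 : - (u / (16 * s2)) <= 0 by rewrite oppr_le0 divr_ge0 ?mulr_ge0// ltW.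
apply: (@le_trans _ _ _ _ _ (@subgaussian_tail (- (u / (16 * s2))) (- u) _ _ _)).
- rewrite -[X in measurable X]setTI; apply: measurable_fun_le => //; exact: measurable_funB.
- by move=> w /= h; rewrite ler_wnM2l.
- by rewrite lee_fin ler_expR; apply: le_of_eq; field; rewrite gt_eqF.
Qed.

Lemma subgaussian_deviation (u : R) : 0 < u ->
  (P [set w | u < `|F w - mu|]%R <= (2 * expR (- (u ^+ 2 / (32 * s2))))%:E)%E.
Proof.
move=> u0; rewrite mulrDl !mul1r EFinD.
have m1 : measurable [set w | u <= F w - mu]%R.
  rewrite -[X in measurable X]setTI; apply: measurable_fun_le => //; exact: measurable_funB.
have m2 : measurable [set w | F w - mu <= - u]%R.
  rewrite -[X in measurable X]setTI; apply: measurable_fun_le => //; exact: measurable_funB.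
apply: le_trans (leeD (subgaussian_upper u0) (subgaussian_lower u0)).
apply: le_trans (measureU2 P m1 m2); apply: le_measure; rewrite ?inE//.
- by apply: measurable_gtr; apply: measurableT_comp => //; exact: measurable_funB.
- exact: measurableU.
- move=> w /=; rewrite ltr_normr => /orP[h|h]; [left|right] => /=; first exact: ltW.
  by rewrite lerNr ltW.
Qed.

(** Since [mu <= - u], the inequality [x <= expR x] gives [l * F <= expR (l * (F - mu - u))], so the
    positive part has a mean of Chernoff size. *)
Lemma subgaussian_pos_part (u : R) : 0 < u -> mu <= - u ->
  (\int[P]_w (Num.max (F w) 0)%:E <= (16 * s2 / u * expR (- (u ^+ 2 / (32 * s2))))%:E)%E.
Proof.
move=> u0 muu; pose l := u / (16 * s2).
have l0 : 0 < l by rewrite divr_gt0// mulr_gt0.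
apply: (@le_trans _ _ (\int[P]_w ((l^-1 * expR (- (l * u)))%:E * (expR (l * (F w - mu)))%:E))%E).
  apply: ge0_le_integral => //=.
  - by move=> w _; rewrite lee_fin pos_ge0.
  - by apply/measurable_EFinP; exact: measurable_maxr.
  - by apply: emeasurable_funM; [exact: measurable_cst|exact: me].
  - move=> w _; rewrite -EFinM lee_fin -mulrA -expRD ge_max mulr_ge0 ?expR_ge0 ?invr_ge0 ?(ltW l0)//.
    rewrite andbT ler_pdivlMl// (le_trans _ (expR_ge1Dx _))//.
    by rewrite (@le_trans _ _ (l * (F w - mu - u)))// ?ler_pM2l//; lra.
rewrite ge0_integralZl//=; last by rewrite lee_fin mulr_ge0 ?expR_ge0// invr_ge0 ltW.
apply: (@le_trans _ _ ((l^-1 * expR (- (l * u)))%:E * (expR (8 * l ^+ 2 * s2))%:E)%E).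
  by apply: lee_wpmul2l => //; rewrite lee_fin mulr_ge0 ?expR_ge0// invr_ge0 ltW.
rewrite -EFinM lee_fin -[leLHS]mulrA -expRD; apply: le_of_eq.
congr (_ * expR _); first by rewrite /l invf_div.
by rewrite /l; field; rewrite gt_eqF.
Qed.
End chernoff.

(** A term is at most [a] times the difference of two consecutive exponentials, because
    [a * (expR x - 1) >= a * x >= 1]; the sum telescopes. *)
Lemma geometric_tail (R : realType) (a x : R) (k n : nat) : 0 < a -> a^-1 <= x -> (k <= n)%N ->
  \sum_(k <= i < n) expR (- (i.+1%:R * x)) <= a * expR (- (k%:R * x)).
Proof.
move=> a0 x1 kn.
suff : \sum_(k <= i < n) expR (- (i.+1%:R * x)) <= a * (expR (- (k%:R * x)) - expR (- (n%:R * x))).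
  by move/le_trans; apply; rewrite ler_pM2l// gerBl expR_ge0.
elim: n kn => [|n IH]; first by rewrite leqn0 => /eqP ->; rewrite big_geq// subrr mulr0.
rewrite leq_eqVlt => /predU1P[<-|]; first by rewrite big_geq// subrr mulr0.
rewrite ltnS => kn; rewrite big_nat_recr//=; apply: (le_trans (lerD (IH kn) (lexx _))).
have e1 : expR (- (n%:R * x)) = expR x * expR (- (n.+1%:R * x)).
  by rewrite -expRD -natr1; congr expR; ring.
have h2 := expR_ge0 (- (n.+1%:R * x)).
have h1 : 1 <= a * (expR x - 1).
  by rewrite -ler_pdivrMl// mulr1 (le_trans x1)// lerBrDl expR_ge1Dx.
rewrite e1; move: h1 h2; set y := expR x; set b := expR _ => h1 h2.
have h3 : 0 <= (a * (y - 1) - 1) * b by rewrite mulr_ge0// subr_ge0.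
by lra.
Qed.

(** * Gains of selections of grid intervals *)

Section interval_selections.
Context d (T : measurableType d) (R : realType) (P : probability T R).
Context (X : R -> T -> R) (kk h S : R) (M m : nat).
Hypotheses (fX : fbm_family P X kk h) (h01 : 0 < h < 1) (kk0 : 0 <= kk) (S0 : 0 < S)
  (M0 : (0 < M)%N) (kkS : kk * S `^ h <= M%:R `^ h).

Let h0 : 0 < h. Proof. by case/andP: h01. Qed.
Let h1 : 0 <= 1 - h. Proof. by case/andP: h01 => _ h1; rewrite subr_ge0 ltW. Qed.

Local Notation I := 'I_(M * 2 ^ m).+1.

Let t (i : I) : R := dyadic S M m i.
Let Y (i : I) := X (t i).

Definition selection_sum (Q : {set I * I}) w : R :=
  \sum_(z in Q) (X (dyadic S M m z.2) w - X (dyadic S M m z.1) w).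

(* The largest total gain, at cost 1 per interval, over the admissible selections of
   intervals; the value [- e] is always allowed. *)
Definition selection_max (D : pred {set I * I}) (e : R) : T -> R :=
  max_affine Y finset.set0 (fun Q => if D Q then incr_vec R Q fst snd else fun=> 0)
    (fun Q => if D Q then #|Q|%:R else e).

Lemma selection_maxE (D : pred {set I * I}) e w : selection_max D e w =
  bigmax finset.set0 (fun Q => if D Q then selection_sum Q w - #|Q|%:R else - e).
Proof.
rewrite /selection_max /max_affine; congr bigmax; apply/funext => Q.
case: ifP => _; first by rewrite /lincomb incr_vecE.
by rewrite /lincomb big1 ?sub0r// => i _; rewrite mul0r.
Qed.

Lemma selection_max_ge (D : pred {set I * I}) e Q w : D Q -> selection_sum Q w - #|Q|%:R <= selection_max D e w.
Proof.
move=> DQ; rewrite selection_maxE.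
have := le_bigmax finset.set0 (fun Q => if D Q then selection_sum Q w - #|Q|%:R else - e) Q.
by rewrite DQ.
Qed.

Lemma selection_max_attained (D : pred {set I * I}) e w :
  selection_max D e w = - e \/
  exists2 Q, D Q & selection_max D e w = selection_sum Q w - #|Q|%:R.
Proof.
rewrite selection_maxE.
have [Q ->] := bigmax_attained finset.set0 (fun Q => if D Q then selection_sum Q w - #|Q|%:R else - e).
by case: ifP => DQ; [right; exists Q|left].
Qed.

Let gY : gaussian_family P Y (fun i j => kk * fbm_cov_fun h (t i) (t j)).
Proof. by apply: fX => i; exact: dyadic_ge0. Qed.

Lemma measurable_selection_max (D : pred {set I * I}) e : measurable_fun setT (selection_max D e).
Proof. exact: (measurable_max_affine gY). Qed.

Lemma selection_max_integrable (D : pred {set I * I}) e : P.-integrable setT (EFin \o selection_max D e).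
Proof. exact: (max_affine_integrable gY). Qed.

Lemma separated_weak_chain (Q : {set I * I}) : separated Q -> (0 < #|Q|)%N ->
  exists n a b, weak_chain (M * 2 ^ m) n a b /\
    forall g : nat -> nat -> R, \sum_(z in Q) g z.1 z.2 = \sum_(i < n.+1) g (a i) (b i).
Proof.
move=> sQ Q0; have [a [b [ab ba bN e]]] := separated_chain R sQ Q0.
by exists #|Q|.-1, a, b; split=> //; split => // i ?; rewrite ltnW ?ab ?ba.
Qed.

Lemma separated_length (Q : {set I * I}) : separated Q -> \sum_(z in Q) (t z.2 - t z.1) <= S.
Proof.
move=> sQ; have [/eqP|] := posnP #|Q|.
  by rewrite cards_eq0 => /eqP ->; rewrite big_set0 ltW.
move=> /(separated_weak_chain sQ)[n [a [b [ch e]]]].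
rewrite (e (fun i j => dyadic S M m j - dyadic S M m i)).
have tot : \sum_(0 <= j < M * 2 ^ m) (dyadic S M m j.+1 - dyadic S M m j) = S.
  rewrite telescope_sumr// /dyadic mulr0 mul0r subr0 mulfK//.
  by rewrite pnatr_eq0 -lt0n muln_gt0 M0 expn_gt0.
have := weak_chain_sum (g := fun j => dyadic S M m j.+1 - dyadic S M m j) ch.
rewrite tot => hS; apply: le_trans (hS _); last by move=> j; rewrite subr_ge0; exact: dyadic_le.
apply: ler_sum => i _; rewrite telescope_sumr//.
by have [ab _ _] := ch; rewrite ab// -ltnS.
Qed.

Lemma selection_max_mgf (D : pred {set I * I}) e (n : nat) (l : R) : (forall Q, D Q -> separated Q && (#|Q| <= n)%N) ->
  (\int[P]_w (expR (l * (selection_max D e w - \int[P]_w' selection_max D e w')))%:E <=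
   (expR (8 * l ^+ 2 * (n%:R `^ (1 - h) * M%:R `^ h)))%:E)%E.
Proof.
move=> Dn; apply: (max_affine_mgf gY); first by rewrite mulr_ge0 ?powR_ge0.
move=> Q; case: ifP => [/Dn/andP[sQ Qn]|_]; last first.
  rewrite /cov_form big1 ?mulr_ge0 ?powR_ge0// => i _.
  by rewrite big1// => j _; rewrite !mul0r.
have [s1 s2] := separatedP _ sQ.
have hb := @incr_vec_cov_form R h h01 _ _ t kk Q fst snd kk0 S.
apply: (le_trans (hb _ _ (separated_length sQ))).
- by move=> z zQ; apply: dyadic_le => //; rewrite ltnW// s1.
- move=> z z' zQ z'Q zz'; have [l1|l1] := s2 _ _ zQ z'Q zz'; [left|right].
    by apply: dyadic_le => //; exact: ltnW.
  by apply: dyadic_le => //; exact: ltnW.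
rewrite mulrCA; apply: ler_pM => //; rewrite ?powR_ge0 ?mulr_ge0 ?powR_ge0//.
by apply: ge0_ler_powR; rewrite ?nnegrE ?ler_nat.
Qed.

Lemma selection_le_chain_bound (Q : {set I * I}) w : separated Q ->
  selection_sum Q w - #|Q|%:R / 2 <= chain_bound X h S M m w.
Proof.
move=> sQ; have [/eqP|] := posnP #|Q|.
  rewrite cards_eq0 => /eqP ->; rewrite /selection_sum big_set0 cards0 mul0r subr0.
  exact: chain_bound_ge0.
move=> /(separated_weak_chain sQ)[n [a [b [ch e]]]].
rewrite /selection_sum.
have -> : #|Q|%:R / 2 = \sum_(z in Q) (2^-1 : R) by rewrite sumr_const mulr_natl.
rewrite -sumrB (e (fun i j => X (dyadic S M m j) w - X (dyadic S M m i) w - 2^-1)).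
have s0 := chain_step_sum h0 m.
have y0 k : 0 <= chain_step h * chain_ratio h ^+ k.+1.
  by rewrite mulr_ge0 ?(ltW (chain_step_gt0 h0))// exprn_ge0// ltW// chain_ratio_gt0.
(* The chaining runs with a total cost of 1/2 per interval; this is the part of it left over by the
   truncation levels up to [m]. *)
have x0 : 0 <= 2^-1 - 2 * \sum_(k < m) chain_step h * chain_ratio h ^+ k.+1 by rewrite subr_ge0.
have := dyadic_chain_bound (fs := fun k j => X (dyadic S M k j) w) _ y0 x0 ch.
rewrite subrK => hb; apply: le_trans (hb _); last by move=> k j; rewrite dyadic_double.
by apply: ler_sum => i _; exact: pos_ge.
Qed.
End interval_selections.

Lemma measure_union_bound d (T : measurableType d) (R : realType) (P : probability T R)
    (A C : set T) (B : nat -> set T) (k n : nat) :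
  measurable A -> measurable C -> (forall i, measurable (B i)) ->
  (forall w, C w -> A w \/ exists2 i, (k <= i < n)%N & B i w) ->
  (P C <= P A + \sum_(k <= i < n) P (B i))%E.
Proof.
move=> mA mC mB; elim: n C mC => [|n IH] C mC CAB.
  rewrite big_geq// adde0; apply: le_measure; rewrite ?inE// => w /CAB[//|[i]].
  by rewrite ltn0 andbF.
have [nk|kn] := ltnP n k.
  rewrite big_geq// adde0; apply: le_measure; rewrite ?inE// => w /CAB[//|[i /andP[ki iN]]].
  by have := leq_trans iN (leq_trans nk ki); rewrite ltnn.
rewrite big_nat_recr//= addeA; apply: (@le_trans _ _ (P (C `\` B n) + P (B n))%E).
  apply: le_trans (measureU2 P (measurableD mC (mB n)) (mB n)).
  apply: le_measure; rewrite ?inE//; first by apply: measurableU => //; exact: measurableD.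
  by move=> w Cw; have [|nB] := pselect (B n w); [right|left].
apply: leeD => //; apply: IH; first exact: measurableD.
move=> w [/CAB[|[i /andP[ki]]]]; first by left.
by rewrite ltnS leq_eqVlt => /predU1P[->//|iN] Bi _; right; exists i; rewrite ?ki.
Qed.

(* The union bound over the number of intervals is a geometric series of ratio at most
   [expR (- tail_const^-1)]. *)
Definition tail_const (R : realType) : R := 512.

(** * Concentration on a grid *)

Section selection_concentration.
Context d (T : measurableType d) (R : realType) (P : probability T R).
Context (X : R -> T -> R) (kk h S : R) (M m : nat).
Hypotheses (fX : fbm_family P X kk h) (h01 : 0 < h < 1) (kk0 : 0 <= kk) (S0 : 0 < S)
  (M0 : (0 < M)%N) (kkS : kk * S `^ h <= M%:R `^ h).

Let h0 : 0 < h. Proof. by case/andP: h01. Qed.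
Let h1 : 0 <= 1 - h. Proof. by case/andP: h01 => _ h1; rewrite subr_ge0 ltW. Qed.

Local Notation I := 'I_(M * 2 ^ m).+1.
Local Notation smax D e := (@selection_max _ T R X S M m D e).
Local Notation E F := (\int[P]_w F w).

Definition grid_UTV : T -> R := smax (@separated _) 0.

Let Fle (k : nat) : T -> R := smax (fun Q => separated Q && (#|Q| <= k)%N) 0.

(* Offsetting the minimal value makes the mean of [Fat n] at most [- n / 4]. *)
Let Fat (n : nat) : T -> R := smax (fun Q => separated Q && (#|Q| == n)) (n%:R / 2).

Let mS D e : measurable_fun setT (smax D e).
Proof. exact: (measurable_selection_max fX S0). Qed.

Let iS D e : P.-integrable setT (EFin \o smax D e).
Proof. exact: (selection_max_integrable fX S0). Qed.

Let V := chain_bound X h S M m.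
Let C1 : R := chain_const h.

Let mV : measurable_fun setT V. Proof. exact: measurable_chain_bound fX _ _ _ _. Qed.
Let V0 w : 0 <= V w. Proof. exact: chain_bound_ge0. Qed.

Let iV : P.-integrable setT (EFin \o V).
Proof.
apply/integrableP; split; first exact/measurable_EFinP.
under eq_integral do rewrite /= ger0_norm//.
by apply: le_lt_trans (chain_bound_integral fX h01 S0 M0 kkS m) _; rewrite ltry.
Qed.

Let EV : E V <= C1 * M%:R.
Proof.
have := chain_bound_integral fX h01 S0 M0 kkS m.
by rewrite -(fineK (integrable_fin_num measurableT iV)) lee_fin.
Qed.

Let card_half (Q : {set I * I}) w : separated Q ->
  selection_sum X S Q w - #|Q|%:R <= V w - #|Q|%:R / 2.
Proof.
move=> sQ; have := selection_le_chain_bound X S h01 M0 w sQ.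
by rewrite -/V; move: (selection_sum X S Q w) (V w) (#|Q|%:R : R) => a b c; lra.
Qed.

Let expectation_Fat n : E (Fat n) <= C1 * M%:R - n%:R / 2.
Proof.
have iVn : P.-integrable setT (EFin \o (fun w => V w - n%:R / 2)).
  by apply: integrable_subR => //; exact: cst_integrable.
apply: (@le_trans _ _ (E (fun w => V w - n%:R / 2))).
  apply: le_Rintegral => //; first exact: iS.
  move=> w _; rewrite /Fat.
  have [->|[Q /andP[sQ /eqP Qn] ->]] := selection_max_attained X S
      (fun Q : {set I * I} => separated Q && (#|Q| == n)) (n%:R / 2) w.
    by rewrite lerDr.
  by rewrite -Qn; exact: card_half.
rewrite RintegralB//; last exact: cst_integrable.
by rewrite Rintegral_cst//= probability_setT mulr1 lerD2r.
Qed.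

Lemma measurable_grid_UTV : measurable_fun setT grid_UTV. Proof. exact: mS. Qed.

Lemma grid_UTV_integrable : P.-integrable setT (EFin \o grid_UTV). Proof. exact: iS. Qed.

Lemma separated0 N : separated (finset.set0 : {set 'I_N.+1 * 'I_N.+1}).
Proof. by apply/separatedP; split=> [z|z z']; rewrite inE. Qed.

Lemma grid_UTV_ge0 w : 0 <= grid_UTV w.
Proof.
have := selection_max_ge X S (D := @separated _) 0 w (separated0 (M * 2 ^ m)).
by rewrite /selection_sum big_set0 cards0 subr0.
Qed.

Lemma grid_UTV_expectation : E grid_UTV <= C1 * M%:R.
Proof.
apply: le_trans EV; apply: le_Rintegral => //; first exact: iS.
move=> w _; rewrite /grid_UTV.
have [->|[Q sQ ->]] := selection_max_attained X S (@separated (M * 2 ^ m)) 0 w.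
  by rewrite oppr0.
by apply: (le_trans (card_half w sQ)); rewrite gerBl divr_ge0.
Qed.

Let Fle_le k w : Fle k w <= grid_UTV w.
Proof.
rewrite /Fle; have [->|[Q /andP[sQ _] ->]] := selection_max_attained X S
  (fun Q : {set I * I} => separated Q && (#|Q| <= k)%N) 0 w.
  by rewrite oppr0 grid_UTV_ge0.
exact: selection_max_ge.
Qed.

Let Fle_ge0 k w : 0 <= Fle k w.
Proof.
have := @selection_max_ge _ T R X S M m (fun Q : {set I * I} => separated Q && (#|Q| <= k)%N)
  0 finset.set0 w.
by rewrite separated0 cards0 /selection_sum big_set0 subr0 => /(_ isT).
Qed.

Let K := #|{: I * I}|.

(** The size of a maximising selection decides. The number [K] only makes the union finite: it grows
    with the grid, but no estimate depends on it. *)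
Let grid_cases k w : grid_UTV w = Fle k w \/
  exists2 n, (k <= n < K)%N & grid_UTV w <= Fat n.+1 w.
Proof.
rewrite /grid_UTV.
have [e|[Q sQ e]] := selection_max_attained X S (@separated (M * 2 ^ m)) 0 w.
  left; apply/eqP; rewrite eq_le Fle_le andbT.
  by rewrite e oppr0 Fle_ge0.
have [Qk|kQ] := leqP #|Q| k.
  left; apply/eqP; rewrite eq_le Fle_le andbT e.
  by apply: selection_max_ge; rewrite sQ.
right; have Q1 : #|Q|.-1.+1 = #|Q| by rewrite prednK// (leq_ltn_trans _ kQ).
exists #|Q|.-1; first by apply/andP; split; [rewrite -ltnS Q1|rewrite Q1 /K max_card].
by rewrite e; apply: selection_max_ge; rewrite sQ Q1 eqxx.
Qed.

Section cutoff.
Local Notation q := (tail_const R).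

Let q0 : 0 < q. Proof. by rewrite /tail_const ltr0n. Qed.

Variable k : nat.
Hypotheses (k4 : 4 * C1 * M%:R <= k%:R) (kM : (M <= k)%N).

Let MR : (0 : R) < M%:R. Proof. by rewrite ltr0n. Qed.
Let k0 : (0 < k)%N. Proof. exact: leq_trans kM. Qed.

Let x : R := (k%:R / M%:R) `^ h / q.

Let x512 : q^-1 <= x.
Proof.
rewrite /x ler_peMl ?invr_ge0 ?(ltW q0)// -[leLHS](powRr0 (k%:R / M%:R)) ler_powR ?(ltW h0)//.
by rewrite ler_pdivlMr// mul1r ler_nat.
Qed.

Let s2 (n : nat) : R := n%:R `^ (1 - h) * M%:R `^ h.

Let s2_gt0 n : (0 < n)%N -> 0 < s2 n.
Proof. by move=> n0; rewrite mulr_gt0// powR_gt0// ltr0n. Qed.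

Let s2E n : (0 < n)%N -> n%:R / s2 n = (n%:R / M%:R) `^ h.
Proof.
move=> n0; have nR : (0 : R) < n%:R by rewrite ltr0n.
have e : n%:R = n%:R `^ (1 - h) * n%:R `^ h :> R.
  by rewrite -powRD ?subrK ?powRr1 ?ler0n// (gt_eqF nR) implybT.
have eM : (M%:R^-1 : R) `^ h = (M%:R `^ h)^-1.
  by rewrite -powR_inv1 ?ler0n// -powRrM mulN1r powRN.
rewrite powRM ?invr_ge0 ?ler0n// eM {1}e /s2 invfM mulrACA divff ?mul1r//.
by rewrite gt_eqF// powR_gt0.
Qed.

Let tail_exponent n : (k <= n)%N ->
  expR (- ((n.+1%:R / 4) ^+ 2 / (32 * s2 n.+1))) <= expR (- (n.+1%:R * x)).
Proof.
move=> kn; rewrite ler_expR lerN2.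
(* The constant [tail_const] is 512 = 16 * 32, with 16 from the square of [n / 4] and 32 from the
   Chernoff bound. *)
have -> : (n.+1%:R / 4) ^+ 2 / (32 * s2 n.+1) = n.+1%:R * (n.+1%:R / s2 n.+1 / q).
  by rewrite /tail_const; field; rewrite gt_eqF// s2_gt0.
rewrite ler_wpM2l// /x s2E// ler_pM2r ?invr_gt0 ?q0//.
apply: ge0_ler_powR; rewrite ?nnegrE ?divr_ge0 ?(ltW h0)//.
by rewrite ler_pM2r ?invr_gt0// ler_nat (leq_trans kn).
Qed.

Let mgfFat n := @selection_max_mgf _ T R P X kk h S M m fX h01 kk0 S0 M0 kkS
  (fun Q => separated Q && (#|Q| == n)) (n%:R / 2) n.

Let meanFat n : (k <= n)%N -> E (Fat n.+1) <= - (n.+1%:R / 4).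
Proof.
move=> kn; apply: (le_trans (expectation_Fat _)).
have : (k%:R : R) <= n.+1%:R by rewrite ler_nat (leq_trans kn).
by move: k4; rewrite -mulrA; move: (C1 * _) (k%:R : R) (n.+1%:R : R) => a b c; lra.
Qed.

Let Dn n (Q : {set I * I}) : separated Q && (#|Q| == n) -> separated Q && (#|Q| <= n)%N.
Proof. by move=> /andP[-> /eqP ->]; rewrite /=. Qed.

Let prob_Fat n : (k <= n)%N -> (P [set w | 0 < Fat n.+1 w]%R <= (expR (- (n.+1%:R * x)))%:E)%E.
Proof.
move=> kn.
have n4 : (0 : R) < n.+1%:R / 4 by rewrite divr_gt0.
have := subgaussian_upper (mS _ _) (s2_gt0 (ltn0Sn n)) (fun l => mgfFat l (@Dn n.+1)) n4.
move=> hb; apply: (@le_trans _ _ (expR (- ((n.+1%:R / 4) ^+ 2 / (32 * s2 n.+1))))%:E); last first.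
  by rewrite lee_fin tail_exponent.
apply: le_trans hb; apply: le_measure; rewrite ?inE.
- by apply: measurable_gtr; exact: mS.
- rewrite -[X in measurable X]setTI; apply: measurable_fun_le => //; exact: measurable_funB.
- by move=> w /= w0; have := meanFat kn; rewrite -/(Fat n.+1); lra.
Qed.

Let pos_Fat n : (k <= n)%N ->
  (\int[P]_w (Num.max (Fat n.+1 w) 0)%:E <= (64 * expR (- (n.+1%:R * x)))%:E)%E.
Proof.
move=> kn; have n4 : (0 : R) < n.+1%:R / 4 by rewrite divr_gt0.
have s0 := s2_gt0 (ltn0Sn n).
have := subgaussian_pos_part (mS _ _) s0 (fun l => mgfFat l (@Dn n.+1)) n4 (meanFat kn).
move/le_trans; apply; rewrite lee_fin; apply: ler_pM; rewrite ?expR_ge0 ?tail_exponent//.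
  by rewrite divr_ge0 ?(ltW n4)// mulr_ge0// ltW.
have -> : 16 * s2 n.+1 / (n.+1%:R / 4) = 64 * (n.+1%:R / s2 n.+1)^-1.
  by field; rewrite gt_eqF//= gt_eqF.
rewrite ler_piMr// invf_le1; last by rewrite divr_gt0.
rewrite s2E// -[leLHS](powRr0 (n.+1%:R / M%:R)) ler_powR ?(ltW h0)//.
by rewrite ler_pdivlMr// mul1r ler_nat (leq_trans kM)// (leq_trans kn).
Qed.

Let kK_sum (a : R) : 0 <= a -> \sum_(k <= n < K) (a * expR (- (n.+1%:R * x))) <= a * (q * expR (- (k%:R * x))).
Proof.
move=> a0; rewrite -mulr_sumr ler_wpM2l//.
have [kK|Kk] := leqP k K; first exact: geometric_tail.
by rewrite big_geq ?(ltnW Kk)// mulr_ge0 ?expR_ge0.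
Qed.

(** Discarding the large selections shifts the mean by a constant, independent of [M] and of the
    grid. The 64 is [16 * s2 / (n / 4)] with [s2 <= n]. *)
Lemma cutoff_expectation : 0 <= E grid_UTV - E (Fle k) <= 64 * q.
Proof.
apply/andP; split; first by rewrite subr_ge0; apply: le_Rintegral => //; exact: iS.
rewrite -RintegralB//; try exact: iS.
have iFF : P.-integrable setT (EFin \o (fun w => grid_UTV w - Fle k w)).
  by apply: integrable_subR; exact: iS.
rewrite -lee_fin fineK; last exact: (integrable_fin_num measurableT iFF).
apply: (@le_trans _ _ (\int[P]_w \sum_(k <= n < K) (Num.max (Fat n.+1 w) 0)%:E)%E).
  have mFat n : measurable_fun setT (fun w => (Num.max (Fat n.+1 w) 0)%:E).
    by apply/measurable_EFinP; apply: measurable_maxr => //; exact: mS.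
  apply: ge0_le_integral => //=.
  - by move=> w _; rewrite lee_fin subr_ge0.
  - by apply/measurable_EFinP; apply: measurable_funB; exact: mS.
  - exact: emeasurable_sum.
  - move=> w _; rewrite sumEFin lee_fin.
    have [->|[n /andP[kn nK] hn]] := grid_cases k w.
      by rewrite subrr sumr_ge0// => i _; rewrite pos_ge0.
    apply: (@le_trans _ _ (Num.max (Fat n.+1 w) 0)).
      by rewrite le_max (le_trans _ hn)// gerBl.
    rewrite (big_cat_nat (n := n.+1))//=; last exact: leqW.
    rewrite big_nat_recr//= -addrA [leRHS]addrC -addrA lerDl addr_ge0//.
      by rewrite sumr_ge0// => i _; rewrite pos_ge0.
    by rewrite sumr_ge0// => i _; rewrite pos_ge0.
rewrite ge0_integral_sum//=; first last.
- by move=> n w _; rewrite lee_fin pos_ge0.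
- by move=> n; apply/measurable_EFinP; apply: measurable_maxr => //; exact: mS.
rewrite big_nat; apply: (@le_trans _ _ (\sum_(k <= n < K | (k <= n < K)%N) (64 * expR (- (n.+1%:R * x)))%:E)%E).
  by apply: lee_sum => n /andP[kn _]; exact: pos_Fat.
rewrite -big_nat sumEFin lee_fin; apply: (le_trans (kK_sum _)) => //.
rewrite ler_wpM2l// ler_piMr// -expR0 ler_expR oppr_le0 mulr_ge0//.
by rewrite (le_trans _ x512)// invr_ge0 ltW.
Qed.

(** Half of [u] absorbs the shift of the mean, the other half is a deviation of [Fle k]. *)
Lemma cutoff_deviation (u : R) : 2 * (64 * q) <= u ->
  (P [set w | u < `|grid_UTV w - E grid_UTV|]%R <=
   (2 * expR (- ((u / 2) ^+ 2 / (32 * s2 k))) + q * expR (- (k%:R * x)))%:E)%E.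
Proof.
move=> u2; have u0 : 0 < u / 2 by rewrite divr_gt0// (lt_le_trans _ u2)// !mulr_gt0.
have /andP[e0 e1] := cutoff_expectation.
pose A := [set w | u / 2 < `|Fle k w - E (Fle k)|]%R.
have mA : measurable A.
  by apply: measurable_gtr; apply: measurableT_comp => //; apply: measurable_funB => //; exact: mS.
have mB n : measurable [set w | 0 < Fat n.+1 w]%R by apply: measurable_gtr; exact: mS.
have mC : measurable [set w | u < `|grid_UTV w - E grid_UTV|]%R.
  by apply: measurable_gtr; apply: measurableT_comp => //; apply: measurable_funB => //; exact: mS.
have hC w : (u < `|grid_UTV w - E grid_UTV|)%R -> A w \/ exists2 n, (k <= n < K)%N & (0 < Fat n.+1 w)%R.
  move=> wu; have [Aw|nAw] := pselect (A w); [by left|right].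
  have [eF|[n nk hn]] := grid_cases k w.
    exfalso; apply: nAw; rewrite /A /=; move: wu; rewrite eF.
    have := ler_distD (E (Fle k)) (Fle k w) (E grid_UTV).
    rewrite [`|E (Fle k) - _|]distrC (ger0_norm e0).
    by move: e1 u2; move: `|_ - E grid_UTV| `|_ - E (Fle k)| (64 * q) => a b c; lra.
  (* If [Fat n.+1] were nonpositive, both maxima would vanish at [w] and the deviations would be the
     means themselves, which differ by at most [u / 2]. *)
  exists n => //; rewrite ltNge; apply/negP => F0; apply: nAw; rewrite /A /=.
  have G0 : grid_UTV w = 0 by apply/eqP; rewrite eq_le grid_UTV_ge0 (le_trans hn F0).
  have L0 : Fle k w = 0 by apply/eqP; rewrite eq_le Fle_ge0 -{1}G0 Fle_le.
  move: wu; rewrite G0 L0 !sub0r !normrN.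
  have eg : 0 <= E grid_UTV by apply: Rintegral_ge0 => w' _; exact: grid_UTV_ge0.
  have ef : 0 <= E (Fle k) by apply: Rintegral_ge0 => w' _; exact: Fle_ge0.
  rewrite !ger0_norm//.
  by move: e1 u2; move: (64 * q) (E grid_UTV) (E (Fle k)) => a b c; lra.
have := @measure_union_bound _ _ _ P A _ (fun n => [set w | 0 < Fat n.+1 w]%R) k K mA mC mB hC.
move/le_trans; apply; rewrite EFinD; apply: leeD.
  exact: (subgaussian_deviation (mS _ _) (s2_gt0 k0)
    (fun l => @selection_max_mgf _ T R P X kk h S M m fX h01 kk0 S0 M0 kkS
      (fun Q => separated Q && (#|Q| <= k)%N) 0 k l (fun Q => id)) u0).
rewrite big_nat; apply: (@le_trans _ _ (\sum_(k <= n < K | (k <= n < K)%N) (1 * expR (- (n.+1%:R * x)))%:E)%E).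
  by apply: lee_sum => n /andP[kn _]; rewrite mul1r; exact: prob_Fat.
by rewrite -big_nat sumEFin lee_fin -[leRHS]mul1r; apply: kK_sum.
Qed.
End cutoff.

End selection_concentration.

(** * Choice of the cutoff *)

Section grid_deviation.
Context (R : realType) (h : R).
Hypothesis h01 : 0 < h < 1.

Let h0 : 0 < h. Proof. by case/andP: h01. Qed.
Let h1 : 0 <= 1 - h. Proof. by case/andP: h01 => _ h1; rewrite subr_ge0 ltW. Qed.

Local Notation q := (tail_const R).

Let q0 : 0 < q. Proof. by rewrite /tail_const ltr0n. Qed.
Let qE : q = 512. Proof. by []. Qed.

(** The term [4 * chain_const h] secures the condition [k4] on the cutoff, and the 1 keeps the
    cutoff above [M * (1 + v)]. *)
Let C3 : R := 4 * chain_const h + 1.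

Let C31 : 1 <= C3.
Proof. by rewrite /C3 lerDr mulr_ge0// ltW// chain_const_gt0. Qed.

Let C30 : 0 < C3. Proof. exact: lt_le_trans C31. Qed.

Definition deviation_rate : R := (q * C3)^-1.
(** The 2 counts the two tails of [Fle k] and [q] bounds the geometric series; the exponential makes
    the estimate trivial while [M * v < 2 * (64 * q)]. *)
Definition deviation_prefactor : R := (2 + q) * expR ((2 * (64 * q)) ^+ 2).
Definition deviation_profile (v : R) : R := Num.min (v `^ (1 + h)) (v ^+ 2).

Lemma deviation_rate_gt0 : 0 < deviation_rate.
Proof. by rewrite /deviation_rate invr_gt0 mulr_gt0. Qed.

Let rate1 : deviation_rate <= 1.
Proof.
rewrite /deviation_rate invf_le1 ?mulr_gt0// -[leLHS]mulr1; apply: ler_pM => //.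
by rewrite qE ler1n.
Qed.

Lemma deviation_prefactor_gt0 : 0 < deviation_prefactor.
Proof. by rewrite mulr_gt0 ?expR_gt0// addr_gt0. Qed.

Lemma deviation_profile_ge0 v : 0 <= deviation_profile v.
Proof. by rewrite le_min powR_ge0 sqr_ge0. Qed.

(** At a cutoff of order [M * (1 + v)] the variance carries the factor [(1 + v) ^ (1 - h)]. Up to a
    constant, dividing [v ^+ 2] by it leaves [v ^+ 2] for [v <= 1] and [v ^ (1 + h)] for [v > 1]. *)
Lemma deviation_profile_le v : 0 < v -> deviation_profile v * (1 + v) `^ (1 - h) <= 2 * v ^+ 2.
Proof.
move=> v0; have v10 : 0 <= 1 + v by rewrite addr_ge0// ltW.
have p2 : 2 `^ (1 - h) <= (2 : R).
  by rewrite -[leRHS]powRr1// ler_powR ?ler1n// gerBl ltW.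
have [v1|v1] := leP v 1.
  rewrite mulrC; apply: ler_pM; rewrite ?powR_ge0 ?deviation_profile_ge0//; last by rewrite ge_min lexx orbT.
  by apply: le_trans p2; apply: ge0_ler_powR; rewrite ?nnegrE//; lra.
have -> : v ^+ 2 = v `^ (1 + h) * v `^ (1 - h).
  rewrite -powRD; last by rewrite (gt_eqF v0) implybT.
  by rewrite addrACA subrr addr0 -powR_mulrn ?(ltW v0)// mulr2n.
rewrite mulrCA; apply: ler_pM; rewrite ?powR_ge0 ?deviation_profile_ge0//; first by rewrite ge_min lexx.
apply: (@le_trans _ _ ((2 * v) `^ (1 - h))).
  by apply: ge0_ler_powR; rewrite ?nnegrE ?mulr_ge0 ?(ltW v0)//; lra.
by rewrite powRM ?(ltW v0)// ler_wpM2r ?powR_ge0.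
Qed.

Context d (T : measurableType d) (P : probability T R).
Context (X : R -> T -> R) (kk S : R) (M m : nat).
Hypotheses (fX : fbm_family P X kk h) (kk0 : 0 <= kk) (S0 : 0 < S)
  (M0 : (0 < M)%N) (kkS : kk * S `^ h <= M%:R `^ h).

Let F := @grid_UTV _ T R X S M m.

Let mdev u : measurable [set w | u < `|F w - \int[P]_w' F w'|]%R.
Proof.
apply: measurable_gtr; apply: measurableT_comp => //; apply: measurable_funB => //.
exact: (measurable_grid_UTV _ _ fX S0).
Qed.

Lemma grid_UTV_deviation (v : R) : 0 < v ->
  (P [set w | M%:R * v < `|F w - \int[P]_w' F w'|]%R <=
   (deviation_prefactor * expR (- (deviation_rate * M%:R * deviation_profile v)))%:E)%E.
Proof.
move=> v0; have MR : (0 : R) < M%:R by rewrite ltr0n.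
set b := deviation_rate; set mu := deviation_profile v.
have b0 : 0 < b by exact: deviation_rate_gt0.
have mu0 : 0 <= mu by exact: deviation_profile_ge0.
have q2 : (0 : R) < 2 + q by rewrite addr_gt0.
set c2 := 2 * (64 * q).
have c20 : 0 < c2 by rewrite !mulr_gt0.
have [small|large] := ltP (M%:R * v) c2.
  apply: (le_trans (probability_le1 P (mdev _))); rewrite lee_fin.
  rewrite /deviation_prefactor -mulrA -expRD.
  have q21 : 1 <= 2 + q.
    by apply: (@le_trans _ _ 2); rewrite ?ler1n// lerDl ltW.
  apply: (le_trans q21); rewrite ler_peMr ?(ltW q2)// -[leLHS]expR0 ler_expR subr_ge0 -/c2 -/b -/mu.
  apply: (@le_trans _ _ (1 * (M%:R * (v * v)))).
    rewrite -mulrA; apply: ler_pM => //; rewrite ?(ltW b0) ?mulr_ge0 ?(ltW MR)//.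
    by rewrite ler_wpM2l// -expr2 ge_min lexx orbT.
  rewrite mul1r mulrA expr2; apply: ler_pM; rewrite ?mulr_ge0 ?(ltW v0) ?(ltW small)//.
  apply: le_trans (ltW small); rewrite ler_peMl ?(ltW v0)// ler1n//.
have v1 : 0 < 1 + v by rewrite addr_gt0.
(* This size balances the two terms: for large [v], both the deviation of the small selections and
   the tail of the large ones have exponents of order [M * v ^ (1 + h)]. *)
pose k := (Num.truncn (C3 * M%:R * (1 + v))).+1.
have kl : C3 * M%:R * (1 + v) <= k%:R by rewrite ltW// truncnS_gt.
have y1 : 1 <= C3 * M%:R * (1 + v).
  rewrite -[leLHS]mulr1; apply: ler_pM => //; last by rewrite lerDl ltW.
  by rewrite -[leLHS]mulr1; apply: ler_pM => //; rewrite ler1n.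
have ku : k%:R <= 2 * C3 * M%:R * (1 + v).
  have ty : (Num.truncn (C3 * M%:R * (1 + v)))%:R <= C3 * M%:R * (1 + v).
    by rewrite truncn_le// (le_trans _ y1).
  rewrite /k -natr1 (_ : 2 * C3 * M%:R * (1 + v) = 2 * (C3 * M%:R * (1 + v))); last by rewrite !mulrA.
  by apply: le_trans (lerD ty y1) _; rewrite -mulr2n mulr_natl.
have kMv : M%:R * (1 + v) <= k%:R.
  apply: le_trans kl; rewrite ler_wpM2r ?(ltW v1)// ler_peMl ?(ltW MR)//.
have k4 : 4 * chain_const h * M%:R <= k%:R.
  apply: le_trans kl; rewrite -[leLHS]mulr1; apply: ler_pM => //.
  - by rewrite mulr_ge0// mulr_ge0// ltW// chain_const_gt0.
  - by rewrite ler_wpM2r ?(ltW MR)// /C3 lerDl.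
  - by rewrite lerDl ltW.
have kM : (M <= k)%N.
  rewrite -(ler_nat R) (le_trans _ kMv)// ler_peMr ?(ltW MR)// lerDl ltW//.
apply: (le_trans (cutoff_deviation m fX h01 kk0 S0 M0 kkS k4 kM large)).
rewrite lee_fin.
have e1 : b * M%:R * mu <= (M%:R * v / 2) ^+ 2 / (32 * (k%:R `^ (1 - h) * M%:R `^ h)).
  have kR : (0 : R) < k%:R by rewrite ltr0n.
  rewrite ler_pdivlMr ?mulr_gt0 ?powR_gt0//.
  have s2 : k%:R `^ (1 - h) * M%:R `^ h <= 2 * C3 * (M%:R * (1 + v) `^ (1 - h)).
    have -> : 2 * C3 * (M%:R * (1 + v) `^ (1 - h)) =
        (2 * C3 * (M%:R `^ (1 - h) * (1 + v) `^ (1 - h))) * M%:R `^ h.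
      have eM : M%:R = M%:R `^ (1 - h) * M%:R `^ h :> R.
        by rewrite -powRD ?subrK ?powRr1 ?ler0n// (gt_eqF MR) implybT.
      by rewrite [in LHS]eM; ring.
    rewrite ler_wpM2r ?powR_ge0// -powRM ?(ltW MR) ?(ltW v1)//.
    apply: (@le_trans _ _ ((2 * C3 * (M%:R * (1 + v))) `^ (1 - h))).
      by apply: ge0_ler_powR; rewrite ?nnegrE ?mulr_ge0 ?(ltW C30) ?(ltW v1)// mulrA.
    rewrite powRM ?mulr_ge0 ?(ltW C30) ?(ltW v1)// ler_wpM2r ?powR_ge0//.
    have C32 : 1 <= 2 * C3 by rewrite -[leLHS]mulr1; apply: ler_pM => //; rewrite ler1n.
    by rewrite -[leRHS]powRr1 ?mulr_ge0 ?(ltW C30)// ler_powR// gerBl ltW.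
  have mu2 := deviation_profile_le v0; rewrite -/mu in mu2.
  have bM : 0 <= b * M%:R * mu * 32 by rewrite !mulr_ge0 ?(ltW b0).
  rewrite [leLHS]mulrA; apply: (le_trans (ler_wpM2l bM s2)).
  (* The factor 512 in the rate is chosen here: it leaves 1/8, and the 2 of [deviation_profile_le]
     completes this to the square of [M * v / 2]. *)
  have -> : b * M%:R * mu * 32 * (2 * C3 * (M%:R * (1 + v) `^ (1 - h))) =
      (M%:R ^+ 2 / 8) * (mu * (1 + v) `^ (1 - h)).
    rewrite /b /deviation_rate qE; field; rewrite gt_eqF//.
  apply: (le_trans (ler_wpM2l _ mu2)); first by rewrite divr_ge0// sqr_ge0.
  by apply: le_of_eq; field.
have e2 : b * M%:R * mu <= k%:R * ((k%:R / M%:R) `^ h / q).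
  rewrite /b /deviation_rate invfM.
  apply: (@le_trans _ _ (q^-1 * M%:R * (v * v `^ h))).
    apply: ler_pM; rewrite ?mulr_ge0 ?invr_ge0 ?(ltW q0) ?(ltW C30)//.
      by rewrite ler_wpM2r// ler_piMr ?invr_ge0 ?(ltW q0)// invf_le1.
    rewrite -{1}[v](powRr1 (ltW v0)) -powRD ?(gt_eqF v0) ?implybT// ge_min lexx//.
  rewrite [leRHS]mulrA [leRHS]mulrC -mulrA ler_wpM2l ?invr_ge0 ?(ltW q0)//.
  have Mvk : M%:R * v <= k%:R by apply: le_trans kMv; rewrite ler_wpM2l// lerDr.
  rewrite [leLHS]mulrA; apply: ler_pM; rewrite ?mulr_ge0 ?powR_ge0 ?(ltW v0)//.
  apply: ge0_ler_powR; rewrite ?nnegrE ?divr_ge0 ?(ltW v0) ?(ltW h0)//.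
  by rewrite ler_pdivlMr// mulrC.
have f1 : expR (- ((M%:R * v / 2) ^+ 2 / (32 * (k%:R `^ (1 - h) * M%:R `^ h)))) <= expR (- (b * M%:R * mu)).
  by rewrite ler_expR lerN2.
have f2 : expR (- (k%:R * ((k%:R / M%:R) `^ h / q))) <= expR (- (b * M%:R * mu)).
  by rewrite ler_expR lerN2.
apply: (le_trans (lerD (ler_wpM2l _ f1) (ler_wpM2l (ltW q0) f2))) => //.
rewrite -mulrDl ler_wpM2r ?expR_ge0// /deviation_prefactor ler_peMr ?(ltW q2)//.
by rewrite -[leLHS]expR0 ler_expR sqr_ge0.
Qed.
End grid_deviation.

(** * Refinement of the grid *)

Section deviation_of_supremum.
Context d (T : measurableType d) (R : realType) (P : probability T R).

(* The integral of a nonnegative function is a supremum over simple minorants, so [U] need not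
   be measurable. *)
Lemma nonmeasurable_integral_eq (U L : T -> \bar R) :
  (forall w, 0 <= L w)%E -> measurable_fun setT L -> (forall w, L w <= U w)%E ->
  {ae P, forall w, (U w <= L w)%E} ->
  (\int[P]_w U w = \int[P]_w L w)%E.
Proof.
move=> L0 mL LU UL; have U0 w : (0 <= U w)%E by exact: le_trans (L0 w) (LU w).
rewrite ge0_integralTE//; apply/eqP; rewrite eq_le; apply/andP; split.
  apply: ge_ereal_sup => _ [g /= gU <-]; rewrite -integralT_nnsfun.
  apply: ae_ge0_le_integral => //.
  - by move=> w _; rewrite lee_fin; exact: fun_ge0.
  - exact/measurable_EFinP.
  - apply: filterS UL => w UL _; apply: le_trans UL.
    exact: gU.
rewrite ge0_integralTE//; apply: ereal_sup_le => _ [g /= gL <-].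
by exists g => // w; exact: le_trans (gL w) (LU w).
Qed.

(** Almost surely [U] is the monotone limit of the [G m], and the bound [C] makes the means converge
    to a finite limit. A strict deviation of the limit is a deviation of all late [G m], so up to a
    null set the event lies in an increasing union of intersections, each of probability at most
    [p]. *)
Lemma deviation_of_supremum (U : T -> \bar R) (G : nat -> T -> R) (C p u : R) :
  (forall m, measurable_fun setT (G m)) -> (forall m w, 0 <= G m w) ->
  (forall w, {homo G^~ w : m n / (m <= n)%N >-> m <= n}) ->
  (forall m, P.-integrable setT (EFin \o G m)) ->
  (forall m, \int[P]_w G m w <= C) ->
  (forall m w, ((G m w)%:E <= U w)%E) ->
  {ae P, forall w, (U w <= ereal_sup (range (fun m => (G m w)%:E)))%E} ->
  (forall m, (P [set w | u < `|G m w - \int[P]_w' G m w'|]%R <= p%:E)%E) ->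
  (deviation_prob P U u <= p%:E)%E.
Proof.
move=> mG G0 ndG iG GC GU UG Gp.
pose L w := limn (fun m => (G m w)%:E).
have ndE w : nondecreasing_seq (fun m => (G m w)%:E) by move=> m n mn; rewrite lee_fin ndG.
have cL w : (fun m => (G m w)%:E) @ \oo --> L w by exact: ereal_nondecreasing_is_cvgn.
have LE w : L w = ereal_sup (range (fun m => (G m w)%:E)).
  by apply/cvg_lim => //; exact: ereal_nondecreasing_cvgn.
have GL m w : ((G m w)%:E <= L w)%E by rewrite LE; apply: ereal_sup_ubound; exists m.
have L0 w : (0 <= L w)%E by apply: le_trans (GL 0%N w); rewrite lee_fin.
have mGE m : measurable_fun setT (fun w => (G m w)%:E) by exact/measurable_EFinP.
have mL : measurable_fun setT L by apply: (emeasurable_fun_cvg (fun m w => (G m w)%:E)) => // w _; exact: cL.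
have LU w : (L w <= U w)%E.
  by rewrite LE; apply: ge_ereal_sup => _ [m _ <-]; exact: GU.
have UL : {ae P, forall w, (U w <= L w)%E} by apply: filterS UG => w; rewrite LE.
have EU := nonmeasurable_integral_eq L0 mL LU UL.
have cE : (fun m => \int[P]_w (G m w)%:E)%E @ \oo --> (\int[P]_w L w)%E.
  apply: (@cvg_monotone_convergence _ _ _ P setT measurableT (fun m w => (G m w)%:E)) => //.
  by move=> m w _; rewrite lee_fin.
have EG m : (\int[P]_w (G m w)%:E)%E = (\int[P]_w G m w)%:E.
  by rewrite -[LHS](fineK (integrable_fin_num measurableT (iG m))).
have LC : (\int[P]_w L w <= C%:E)%E.
  apply: cvge_le cE; apply: nearW => m; rewrite EG lee_fin; exact: GC.
have iL : P.-integrable setT L.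
  apply/integrableP; split => //.
  under eq_integral do rewrite gee0_abs//.
  by apply: le_lt_trans LC _; rewrite ltry.
have Lfin := integrable_ae measurableT iL.
have [N [mN PN hN]] : P.-negligible (~` [set w | (U w <= L w)%E /\ L w \is a fin_num]).
  have h : {ae P, forall w, (U w <= L w)%E /\ L w \is a fin_num}.
    by apply: filterS2 UL Lfin => w h1 h2; split => //; exact: h2.
  exact: h.
set e := (\int[P]_w L w)%E; have efin : e \is a fin_num by exact: integrable_fin_num.
pose A m := [set w | u < `|G m w - \int[P]_w' G m w'|]%R.
have mA m : measurable (A m).
  by apply: measurable_gtr; apply: measurableT_comp => //; exact: measurable_funB.
pose B k := \bigcap_(m in [set m | (k <= m)%N]) A m.
have mB k : measurable (B k) by apply: bigcap_measurableType => m _; exact: mA.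
have ndB : {homo B : n m / (n <= m)%N >-> (n <= m)%O}.
  move=> n m nm; apply/subsetPset => w Bw i /= mi; apply: Bw => /=; exact: leq_trans mi.
have mUB : measurable (\bigcup_k B k) by exact: bigcup_measurable.
have PB : (P (\bigcup_k B k) <= p%:E)%E.
  apply: cvge_le (nondecreasing_cvg_mu mB mUB ndB); apply: nearW => k /=.
  apply: le_trans (Gp k); apply: le_measure; rewrite ?inE//; first exact: mA.
  by move=> w /(_ k) /=; apply; exact: leqnn.
rewrite /deviation_prob EU -/e.
apply: (@le_trans _ _ (mu_ext P (\bigcup_k B k `|` N))).
  apply: le_mu_ext => w /= wu; have [Nw|nN] := pselect (N w); [by right|left].
  have [Uw Lw] : (U w <= L w)%E /\ L w \is a fin_num.
    by apply: contrapT => h; apply: nN; exact: hN.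
  have ULw : U w = L w by apply/eqP; rewrite eq_le Uw LU.
  have c1 : (fun m => `|G m w - \int[P]_w' G m w'|) @ \oo --> `|fine (L w) - fine e|.
    apply: cvg_norm; apply: cvgB.
      by have := cL w; rewrite -(fineK Lw) => /fine_cvgP[].
    by move: cE; rewrite -/e -(fineK efin) => /fine_cvgP[].
  have : u < `|fine (L w) - fine e|.
    by move: wu; rewrite ULw -(fineK Lw) -(fineK efin) lte_fin.
  move=> uL; have [k _ hk] := cvgr_gt _ c1 _ uL.
  by exists k => // m /= km; exact: hk.
rewrite measurable_mu_extE; last exact: measurableU.
apply: le_trans (measureU2 P mUB mN) _; rewrite -[leRHS]adde0; apply: leeD => //.
by apply: le_of_eq; exact: PN.
Qed.
End deviation_of_supremum.

Lemma cvg_sumr (R : realType) (n : nat) (f : nat -> nat -> R) (l : nat -> R) :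
  (forall i, (i < n)%N -> f i @ \oo --> l i) ->
  (fun m => \sum_(i < n) f i m) @ \oo --> \sum_(i < n) l i.
Proof.
elim: n => [|n IH] fl.
  by under eq_fun do rewrite big_ord0; rewrite big_ord0; exact: cvg_cst.
under eq_fun do rewrite big_ord_recr; rewrite big_ord_recr /=; apply: cvgD.
  by apply: IH => i i_n; apply: fl; rewrite ltnW.
exact: fl.
Qed.

Lemma cvg_maxr0 (R : realType) (f : nat -> R) (l : R) :
  f @ \oo --> l -> (fun m => Num.max (f m) 0) @ \oo --> Num.max l 0.
Proof.
move=> fl; have e (x : R) : Num.max x 0 = (x + `|x|) / 2 by rewrite maxr_absE addr0 subr0.
under eq_fun do rewrite e; rewrite e; apply: cvgMr_tmp.
by apply: cvgD => //; exact: cvg_norm.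
Qed.

Section grid_limit.
Context d (T : measurableType d) (R : realType).
Context (X : R -> T -> R) (S : R) (M : nat).
Hypotheses (S0 : 0 < S) (M0 : (0 < M)%N).

Local Notation F m w := (@grid_UTV _ T R X S M m w).
Local Notation t m j := (dyadic S M m j).

Definition strict_chain (N n : nat) (a b : nat -> nat) : Prop :=
  [/\ forall i, (i <= n)%N -> (a i < b i)%N,
      forall i, (i < n)%N -> (b i < a i.+1)%N & (b n <= N)%N].

Definition chain_gain (m n : nat) (a b : nat -> nat) w : R :=
  \sum_(i < n.+1) Num.max (X (t m (b i)) w - X (t m (a i)) w - 1) 0.

Lemma chain_gain_le m n a b w : strict_chain (M * 2 ^ m) n a b -> chain_gain m n a b w <= F m w.
Proof.
move=> [ab ba bN]; rewrite /chain_gain.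
have [Q sQ ->] := chain_separated (fun i j => X (t m j) w - X (t m i) w - 1) ab ba bN.
have := selection_max_ge X S (D := @separated (M * 2 ^ m)) 0 w sQ.
have -> : \sum_(z in Q) (X (t m z.2) w - X (t m z.1) w - 1) = selection_sum X S Q w - #|Q|%:R.
  by rewrite sumrB sumr_const.
by [].
Qed.

Lemma grid_UTV_chain m w :
  F m w = 0 \/ exists n a b, strict_chain (M * 2 ^ m) n a b /\ F m w <= chain_gain m n a b w.
Proof.
rewrite /grid_UTV.
have [->|[Q sQ ->]] := selection_max_attained X S (@separated (M * 2 ^ m)) 0 w.
  by left; rewrite oppr0.
have [/eqP|Q0] := posnP #|Q|.
  by rewrite cards_eq0 => /eqP ->; left; rewrite /selection_sum big_set0 cards0 subr0.
right; have [a [b [ab ba bN e]]] := separated_chain R sQ Q0.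
exists #|Q|.-1, a, b; split; first by split.
have -> : selection_sum X S Q w - #|Q|%:R = \sum_(z in Q) (X (t m z.2) w - X (t m z.1) w - 1).
  by rewrite sumrB sumr_const.
rewrite (e (fun i j => X (t m j) w - X (t m i) w - 1)).
by apply: ler_sum => i _; exact: pos_ge.
Qed.

Lemma grid_UTV_succ m w : F m w <= F m.+1 w.
Proof.
have [->|[n [a [b [[ab ba bN] h]]]]] := grid_UTV_chain m w; first exact: grid_UTV_ge0.
apply: (le_trans h); rewrite /chain_gain.
under eq_bigr do rewrite -(dyadic_double S M0 m (b _)) -(dyadic_double S M0 m (a _)).
apply: (@chain_gain_le m.+1 n (fun i => (a i).*2) (fun i => (b i).*2) w); split.
- by move=> i /ab; rewrite ltn_double.
- by move=> i /ba; rewrite ltn_double.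
- by rewrite expnS mulnCA mul2n leq_double.
Qed.

Lemma grid_UTV_le w : {homo (fun m => F m w) : m n / (m <= n)%N >-> m <= n}.
Proof. by apply: homo_leq => //; [exact: le_trans|move=> m; exact: grid_UTV_succ]. Qed.

Section paths.
Variables (c : R) (w : T) (f : R -> R).
Hypotheses (c0 : 0 < c) (fX : forall s, f s = c * X s w).

Let gain (s e : R) : Num.max (f e - f s - c) 0 = c * Num.max (X e w - X s w - 1) 0.
Proof. by rewrite !fX maxr_pMr ?(ltW c0)// mulr0; congr Num.max; ring. Qed.

Lemma grid_UTV_le_UTV m : ((c * F m w)%:E <= UTV c f 0 S)%E.
Proof.
have [->|[n [a [b [[ab ba bN] h]]]]] := grid_UTV_chain m w.
  (* A chain has at least one interval, so the empty selection is compared with the single interval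
     from 0 to [S]. *)
  apply: (@le_trans _ _ (\sum_(i < 1) Num.max (f S - f 0 - c) 0)%:E).
    by rewrite mulr0 lee_fin sumr_ge0// => i _; rewrite pos_ge0.
  by apply: ereal_sup_ubound; exists 0%N, (fun=> 0), (fun=> S); split.
apply: (@le_trans _ _ (\sum_(i < n.+1) Num.max (f (t m (b i)) - f (t m (a i)) - c) 0)%:E); last first.
  apply: ereal_sup_ubound; exists n, (fun i => t m (a i)), (fun i => t m (b i)); split => //; split.
  - exact: dyadic_ge0.
  - by move=> i /ab; exact: dyadic_lt.
  - by move=> i /ba; exact: dyadic_lt.
  - rewrite (le_trans (dyadic_le S0 M0 m bN))// /dyadic mulfK//.
    by rewrite pnatr_eq0 -lt0n muln_gt0 M0 expn_gt0.
rewrite lee_fin; under eq_bigr do rewrite gain.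
by rewrite -mulr_sumr ler_pM2l.
Qed.

Definition grid_floor (m : nat) (s : R) : nat := Num.truncn (s * (M * 2 ^ m)%:R / S).

Lemma grid_floor_le m s : 0 <= s -> t m (grid_floor m s) <= s < t m (grid_floor m s) + S / (M * 2 ^ m)%:R.
Proof.
move=> s0; have N0 : (0 : R) < (M * 2 ^ m)%:R by rewrite ltr0n muln_gt0 M0 expn_gt0.
have y0 : 0 <= s * (M * 2 ^ m)%:R / S by rewrite divr_ge0 ?mulr_ge0 ?(ltW S0).
have /andP[l1 l2] := truncn_itv y0.
rewrite /dyadic -/(grid_floor m s) in l1 l2 *.
apply/andP; split.
  by rewrite ler_pdivrMr// mulrC -ler_pdivlMr.
by rewrite -mulrDl ltr_pdivlMr// -[X in _ + X]mulr1 -mulrDr natr1 [ltRHS]mulrC -ltr_pdivrMr.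
Qed.

Lemma grid_floor_max m s : s <= S -> (grid_floor m s <= M * 2 ^ m)%N.
Proof.
move=> sS; rewrite -[leqRHS](natrK (R := R)) /grid_floor.
apply: le_truncn; rewrite ler_pdivrMr// [leRHS]mulrC ler_wpM2r//.
Qed.

Lemma grid_floor_cvg s : 0 <= s -> (fun m => t m (grid_floor m s)) @ \oo --> s.
Proof.
move=> s0; have c1 : (fun m => S / (M * 2 ^ m)%:R) @ \oo --> (0 : R).
  have := @cvg_geometric R (S / M%:R) 2^-1.
  rewrite ger0_norm// invf_lt1// ltr1n => /(_ isT).
  apply: cvg_trans; apply: near_eq_cvg; apply: nearW => m /=.
  by rewrite /geometric/= natrM natrX exprVn invfM mulrA.
have c2 : (fun m => s - S / (M * 2 ^ m)%:R) @ \oo --> s.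
  by rewrite -[X in _ --> X]subr0; apply: cvgB => //; exact: cvg_cst.
apply: (squeeze_cvgr _ c2 (cvg_cst s)); apply: nearW => m.
by have /andP[l1 l2] := grid_floor_le m s0; rewrite l1 andbT lerBlDr ltW.
Qed.

Hypothesis fC : {within `[(0 : R), +oo[, continuous f}.

Lemma path_grid_cvg s : 0 <= s -> (fun m => f (t m (grid_floor m s))) @ \oo --> f s.
Proof.
move=> s0; have := (subspace_continuousP _ _).1 fC s.
rewrite /= in_itv/= s0 => /(_ isT) h.
apply: cvg_trans h => B /= hB.
have : \forall m \near \oo, `[(0 : R), +oo[%classic (t m (grid_floor m s)) -> B (f (t m (grid_floor m s))).
  exact: (grid_floor_cvg s0 hB).
by apply: filterS => m; apply; rewrite /= in_itv/= dyadic_ge0.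
Qed.

(** The endpoints of a given chain are rounded down to the grids. By continuity the gains converge,
    and strict inequalities between endpoints survive on all fine grids, where the rounded chain is
    admissible. *)
Lemma UTV_le_grid : (UTV c f 0 S <= ereal_sup (range (fun m => (c * F m w)%:E)))%E.
Proof.
apply: ge_ereal_sup => _ [n [a [b [[a0 ab ba bS] ->]]]].
have a0' i : (i <= n)%N -> 0 <= a i.
  elim: i => // i IH i_n; rewrite (le_trans (IH (ltnW i_n)))// ltW//.
  by rewrite (lt_trans (ab _ (ltnW i_n)))// ba.
have bS' i : (i <= n)%N -> b i <= S.
  move=> i_n; apply: le_trans bS; move: i_n; elim: n {a0'} ab ba => [|k IH] ab ba.
    by rewrite leqn0 => /eqP ->.
  rewrite leq_eqVlt => /predU1P[->//|]; rewrite ltnS => ik.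
  apply: (le_trans (IH _ _ ik)).
  - by move=> j jk; apply: ab; exact: leqW.
  - by move=> j jk; apply: ba; exact: leqW.
  - by rewrite ltW// (lt_trans (ba k _))// ab.
have b0' i : (i <= n)%N -> 0 <= b i by move=> i_n; rewrite (le_trans (a0' i i_n))// ltW// ab.
pose A m i := grid_floor m (a i); pose B m i := grid_floor m (b i).
pose g m := \sum_(i < n.+1) Num.max (f (t m (B m i)) - f (t m (A m i)) - c) 0.
have cg : g @ \oo --> \sum_(i < n.+1) Num.max (f (b i) - f (a i) - c) 0.
  apply: (@cvg_sumr R n.+1 (fun i m => Num.max (f (t m (B m i)) - f (t m (A m i)) - c) 0)
    (fun i => Num.max (f (b i) - f (a i) - c) 0)) => i; rewrite ltnS => i_n.
  apply: cvg_maxr0; apply: cvgB; last exact: cvg_cst.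
  by apply: cvgB; apply: path_grid_cvg; [exact: b0'|exact: a0'].
have sep : \forall m \near \oo, strict_chain (M * 2 ^ m) n (A m) (B m).
  have lt s e : 0 <= s -> s < e -> \forall m \near \oo, (grid_floor m s < grid_floor m e)%N.
    move=> s0 se; have e0 : 0 <= e by exact: le_trans (ltW se).
    have hk : \forall m \near \oo, s < t m (grid_floor m e) by apply: (cvgr_gt _ (grid_floor_cvg e0)).
    apply: filterS hk => m h.
    rewrite ltnNge; apply/negP => /(dyadic_le S0 M0 m) h'.
    have /andP[h2 _] := grid_floor_le m s0.
    by have := lt_le_trans h (le_trans h' h2); rewrite ltxx.
  have h1 : \forall m \near \oo, forall i : 'I_n.+1, (A m i < B m i)%N.
    apply: filter_forall => i; have i_n : (i <= n)%N by rewrite -ltnS.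
    by apply: lt; [exact: a0'|exact: ab].
  have h2 : \forall m \near \oo, forall i : 'I_n, (B m i < A m i.+1)%N.
    apply: filter_forall => i; have i_n : (i <= n)%N by rewrite ltnW.
    by apply: lt; [exact: b0'|exact: ba].
  apply: filterS2 h1 h2 => m h1 h2; split.
  - by move=> i i_n; have := h1 (inord i); rewrite inordK.
  - by move=> i i_n; exact: (h2 (Ordinal i_n)).
  - exact: grid_floor_max.
have gL : \forall m \near \oo, ((g m)%:E <= ereal_sup (range (fun m => (c * F m w)%:E)))%E.
  apply: filterS sep => m ch; apply: (@le_trans _ _ (c * F m w)%:E); last by apply: ereal_sup_ubound; exists m.
  rewrite lee_fin /g; under eq_bigr do rewrite gain.
  by rewrite -mulr_sumr ler_pM2l//; exact: chain_gain_le.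
have cE : (fun m => (g m)%:E) @ \oo --> (\sum_(i < n.+1) Num.max (f (b i) - f (a i) - c) 0)%:E.
  by apply: cvg_EFin => //; exact: nearW.
by apply: cvge_le cE; exact: gL.
Qed.
End paths.

End grid_limit.

(** * Fractional Brownian motion as a Gaussian family *)

Section fractional_brownian_family.
Context d (T : measurableType d) (R : realType) (P : probability T R).
Context (W : R -> {RV P >-> R}) (H : R).
Hypothesis fbm : fractional_brownian_motion H W.

Let mW t : measurable_fun setT (W t). Proof. exact: measurable_funP. Qed.

Let W_cgauss t : 0 <= t ->
  P.-integrable setT (EFin \o (fun w => W t w ^+ 2)) /\ exists v, cgauss P (W t) v.
Proof.
move=> t0; have g : gaussian_rv P (W t).
  have := fbm_gaussian fbm (n := 1) (t := fun=> t) (fun=> 1) (fun=> t0).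
  by under eq_fun do rewrite big_ord_recl big_ord0 addr0 mul1r.
have e : (\int[P]_w (W t w)%:E = 0)%E by rewrite -expectation_def (fbm_centered fbm).
have [h1 h2] := gaussian_rv_cgauss (mW t) g e.
by split => //; eexists; exact: h2.
Qed.

Let W_integrable t : 0 <= t -> P.-integrable setT (EFin \o W t).
Proof. by move=> /W_cgauss[_ [v]]; exact: cgauss_integrable. Qed.

Let W_mean t : 0 <= t -> \int[P]_w W t w = 0.
Proof. by move=> t0; rewrite /Rintegral -expectation_def (fbm_centered fbm). Qed.

Let WW_integrable s t : 0 <= s -> 0 <= t -> P.-integrable setT (EFin \o (fun w => W s w * W t w)).
Proof.
move=> s0 t0; have [is2 _] := W_cgauss s0; have [it2 _] := W_cgauss t0.
apply: (le_integrable measurableT _ _ (integrable_addR is2 it2)).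
  by apply/measurable_EFinP; exact: measurable_funM.
move=> w _ /=; rewrite lee_fin normrM [leRHS]ger0_norm ?addr_ge0 ?sqr_ge0//.
rewrite -(real_normK (num_real (W s w))) -(real_normK (num_real (W t w))).
have := sqr_ge0 (`|W s w| - `|W t w|); have := mulr_ge0 (normr_ge0 (W s w)) (normr_ge0 (W t w)).
by move: `|W s w| `|W t w| => a b; rewrite sqrrB; lra.
Qed.

Let WW_mean s t : 0 <= s -> 0 <= t -> \int[P]_w (W s w * W t w) = fbm_cov_fun (2 * H) s t.
Proof.
move=> s0 t0; have := fbm_cov fbm s0 t0; rewrite unlock => h.
by rewrite /Rintegral h.
Qed.

(** Linear combinations are Gaussian by hypothesis, so only their second moment has to be expanded.
    Below, [a] is [c^-1] or [- c^-1]. *)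
Lemma fbm_familyP (a : R) : fbm_family P (fun t w => a * W t w) (a ^+ 2) (2 * H).
Proof.
move=> n t t0 x.
set L := lincomb _ x.
have LE : L = fun w => \sum_(i < n) (x i * a) * W (t i) w.
  by apply/funext => w; rewrite /L /lincomb; apply: eq_bigr => i _; rewrite mulrA.
have mL : measurable_fun setT L.
  by rewrite LE; apply: measurable_sum => i; exact: measurable_funM.
have gL : gaussian_rv P L by rewrite LE; exact: (fbm_gaussian fbm (fun i => x i * a) t0).
have iW i (b : R) : P.-integrable setT (EFin \o (fun w => b * W (t i) w)).
  by apply: integrable_mulR; exact: W_integrable.
have mean : (\int[P]_w (L w)%:E = 0)%E.
  rewrite LE; under eq_integral do rewrite -sumEFin.
  rewrite integral_sum//; last by move=> i; exact: iW.
  rewrite big1// => i _.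
  rewrite -[LHS](fineK (integrable_fin_num measurableT (iW i _))) -/(Rintegral _ _ _).
  by rewrite RintegralZl ?W_mean ?mulr0//; exact: W_integrable.
have [_ h] := gaussian_rv_cgauss mL gL mean.
rewrite (_ : cov_form _ _ = \int[P]_w L w ^+ 2)//.
pose b i j := x i * x j * a ^+ 2.
have iWW i j : P.-integrable setT (EFin \o (fun w => b i j * (W (t i) w * W (t j) w))).
  by apply: integrable_mulR; exact: WW_integrable.
have sq w : (L w ^+ 2)%:E = (\sum_i \sum_j (b i j * (W (t i) w * W (t j) w))%:E)%E.
  rewrite LE expr2 mulr_suml -sumEFin; apply: eq_bigr => i _.
  by rewrite mulr_sumr -sumEFin; apply: eq_bigr => j _; rewrite /b; congr EFin; ring.
rewrite /Rintegral; under eq_integral do rewrite sq.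
rewrite integral_sum//; last by move=> i; apply: integrable_sum => //= j _; exact: iWW.
rewrite /cov_form -[LHS]/(fine (_%:E)) -sumEFin; congr fine; apply: eq_bigr => i _.
rewrite integral_sum//; last by move=> j; exact: iWW.
rewrite -sumEFin; apply: eq_bigr => j _.
rewrite -[RHS](fineK (integrable_fin_num measurableT (iWW i j))); congr EFin.
rewrite -/(Rintegral _ _ _) RintegralZl//; last exact: WW_integrable.
by rewrite WW_mean// mulrA.
Qed.

End fractional_brownian_family.

(* A bound by [min 1 z] is a bound by [z `^ th] for every [th] in [0, 1]. *)
Lemma absorb_prefactor (R : realType) (D b : R) : 0 < D -> 0 < b ->
  exists2 B : R, 0 < B & forall x y : R, 0 <= x -> y <= 1 -> y <= D * expR (- (b * x)) ->
    y <= 18 * expR (- (B * x)).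
Proof.
move=> D0 b0; pose l := ln (D + 1); pose L : R := ln 18.
have D1 : 0 < D + 1 by rewrite addr_gt0.
have l0 : 0 <= l by rewrite ln_ge0// lerDr ltW.
have L0 : 0 < L by rewrite ln_gt0// ltr1n.
have E18 : (18 : R) = expR L by rewrite lnK// posrE ltr0n.
have lL : 0 < L + l by rewrite ltr_wpDr.
(* The exponent must satisfy [th <= 1] and [th * l <= L]: the latter covers [z <= l], where the
   trivial bound 1 is used, and both together cover [z > l]. Adding 1 to [D] keeps [l]
   nonnegative. *)
pose th := L / (L + l); have th0 : 0 < th by rewrite divr_gt0.
have th1 : th <= 1 by rewrite ler_pdivrMr// mul1r lerDl.
have thl : th * l <= L.
  by rewrite /th mulrAC ler_pdivrMr// ler_pM2l// lerDr ltW.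
exists (th * b) => [|x y x0 y1 yD]; first exact: mulr_gt0.
set z := b * x; have z0 : 0 <= z by rewrite mulr_ge0// ltW.
rewrite E18 -expRD -mulrA -/z; have [zl|lz] := leP z l.
  apply: (le_trans y1); rewrite -[leLHS]expR0 ler_expR subr_ge0.
  by apply: le_trans thl; rewrite ler_pM2l.
apply: (le_trans yD); apply: (@le_trans _ _ ((D + 1) * expR (- z))).
  by rewrite ler_wpM2r ?expR_ge0// lerDl.
have -> : D + 1 = expR l by rewrite lnK// posrE.
rewrite -expRD ler_expR.
have h : (1 - th) * (l - z) <= 0.
  by rewrite mulr_ge0_le0 ?subr_ge0// subr_le0 ltW.
by lra.
Qed.

(** Compensates the rounding of [S * c ^ (- 1 / H)] to the integer [M]: the ratio [r] is at least
    1/2, and [(1 / 2) ^ (1 + h) >= 1 / 4]. *)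
Lemma deviation_profile_scale (R : realType) (h r v : R) : 0 < h < 1 -> 2^-1 <= r -> 0 <= v ->
  4^-1 * deviation_profile h v <= deviation_profile h (r * v).
Proof.
move=> /andP[h0 h1] r2 v0; have r0 : 0 <= r by exact: le_trans r2.
have p4 : 4^-1 <= r `^ (1 + h).
  apply: (@le_trans _ _ (2^-1 `^ (1 + h))).
    have -> : 4^-1 = 2^-1 `^ 2 :> R by rewrite powR_mulrn// expr2 -invfM -natrM.
    rewrite ger_powR ?invr_gt0 ?invf_le1 ?ler1n//; first by rewrite ltr0n.
    by lra.
  by apply: ge0_ler_powR; rewrite ?nnegrE ?invr_ge0//; lra.
rewrite /deviation_profile le_min; apply/andP; split.
  rewrite powRM//; apply: ler_pM; rewrite ?invr_ge0 ?le_min ?powR_ge0 ?sqr_ge0//.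
  by rewrite ge_min lexx.
rewrite exprMn; apply: ler_pM; rewrite ?invr_ge0 ?le_min ?powR_ge0 ?sqr_ge0//.
  by rewrite (_ : 4^-1 = 2^-1 ^+ 2) ?lerXn2r ?nnegrE ?invr_ge0// expr2 -invfM -natrM.
by rewrite ge_min lexx orbT.
Qed.

(** * Scaling back to the truncated variation *)

Section truncated_variation.
Context (R : realType) (H : R).
Hypothesis hH : 0 < H < 2^-1.

Let H0 : 0 < H. Proof. by case/andP: hH. Qed.

Let h01 : 0 < 2 * H < 1.
Proof. by case/andP: hH => h0 h1; apply/andP; split; lra. Qed.

Let Hu : H^-1 * (2 * H) = 2.
Proof. by rewrite mulrCA mulVf ?mulr1// gt_eqF. Qed.

Context d (T : measurableType d) (P : probability T R) (W : R -> {RV P >-> R}).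
Hypothesis fbm : fractional_brownian_motion H W.
Context (S c : R).
Hypotheses (S0 : 0 < S) (c0 : 0 < c) (cS : c <= S `^ H).

Local Notation S' := (S * c `^ (- H^-1)).
Local Notation h := (2 * H).

Let S'0 : 0 < S'. Proof. by rewrite mulr_gt0// powR_gt0. Qed.

Let S'1 : 1 <= S'.
Proof.
have : c `^ H^-1 <= (S `^ H) `^ H^-1.
  by apply: ge0_ler_powR; rewrite ?nnegrE ?invr_ge0 ?powR_ge0 ?(ltW H0) ?(ltW c0).
rewrite -powRrM mulfV ?gt_eqF// powRr1 ?(ltW S0)// => hc.
by rewrite powRN ler_pdivlMr ?powR_gt0// mul1r.
Qed.

(** Rounding up loses at most a factor 2, because [c <= S ^ H] makes [S'] at least 1. *)
Let M : nat := (Num.truncn S').+1.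

Let MR : S' <= M%:R. Proof. by rewrite ltW// truncnS_gt. Qed.

Let M2 : M%:R <= 2 * S'.
Proof.
have l : (Num.truncn S')%:R <= S' by rewrite truncn_le// ltW.
by rewrite /M -natr1; apply: le_trans (lerD l S'1) _; rewrite -mulr2n mulr_natl.
Qed.

(** Self-similarity: dividing the path by [c] amounts to stretching the time interval to length
    [S'], as [c ^- 2 * S ^ h = S' ^ h]. *)
Let kkS a : a ^+ 2 = 1 -> (a / c) ^+ 2 * S `^ h <= M%:R `^ h.
Proof.
move=> a1; apply: (@le_trans _ _ (S' `^ h)); last first.
  by apply: ge0_ler_powR; rewrite ?nnegrE ?(ltW S'0) ?mulr_ge0 ?(ltW H0).
rewrite powRM ?powR_ge0 ?(ltW S0)// -powRrM mulNr Hu powRN powR_mulrn ?(ltW c0)//.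
by rewrite exprMn a1 mul1r exprVn mulrC.
Qed.

(** The sign [a] covers both truncated variations. The bound [p] is abstract and [hp] includes
    [y <= 1], so that the prefactor can be absorbed afterwards. *)
Lemma UTV_deviation (a v p : R) : a ^+ 2 = 1 -> 0 < v ->
  (forall y : R, y <= 1 ->
    y <= deviation_prefactor R * expR (- (4^-1 * deviation_rate h * (S' * deviation_profile h v))) ->
    y <= p) ->
  (deviation_prob P (fun w => UTV c (fun t => (a * W t w)%R) 0 S) (S * c `^ (1 - H^-1) * v)%R <= p%:E)%E.
Proof.
move=> a1 v0 hp.
pose X t w := a / c * W t w.
have fX : fbm_family P X ((a / c) ^+ 2) h := fbm_familyP fbm (a / c).
have kk0 : 0 <= (a / c) ^+ 2 by exact: sqr_ge0.
have M0 : (0 < M)%N by [].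
have Mp : (0 : R) < M%:R by rewrite ltr0n.
have fE w t : a * W t w = c * X t w by rewrite /X; field; rewrite gt_eqF.
pose F m w := @grid_UTV _ T R X S M m w.
have mF m : measurable_fun setT (F m) by exact: (measurable_grid_UTV _ _ fX S0).
have iF m : P.-integrable setT (EFin \o F m) by exact: (grid_UTV_integrable _ _ fX S0).
apply: (@deviation_of_supremum _ _ _ P _ (fun m w => c * F m w) (c * (chain_const h * M%:R))).
- by move=> m; exact: measurable_funM.
- by move=> m w; rewrite mulr_ge0 ?(ltW c0)// grid_UTV_ge0.
- by move=> w m n mn; rewrite ler_pM2l//; apply: grid_UTV_le.
- by move=> m; apply: integrable_mulR.
- move=> m; rewrite RintegralZl// ler_pM2l//.
  exact: (grid_UTV_expectation m fX h01 S0 M0 (kkS a1)).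
- by move=> m w; apply: (@grid_UTV_le_UTV _ T R X S M S0 M0 c w (fun t => a * W t w) c0 (fE w)).
- apply: filterS (fbm_continuous fbm) => w cW.
  apply: (@UTV_le_grid _ T R X S M S0 M0 c w (fun t => a * W t w) c0 (fE w)).
  by move=> x; apply: cvgM; [exact: cvg_cst|exact: cW].
move=> m.
(* The grid estimate measures deviations in units of [M], the statement in units of [S']. *)
set v' := S' / M%:R * v.
have v'0 : 0 < v' by rewrite mulr_gt0// divr_gt0.
have uE : S * c `^ (1 - H^-1) * v = c * (M%:R * v').
  rewrite powRD ?(gt_eqF c0) ?implybT// powRr1 ?(ltW c0)// /v'.
  by field; rewrite gt_eqF.
pose A := [set w | M%:R * v' < `|F m w - \int[P]_w' F m w'|]%R.
have -> : [set w | S * c `^ (1 - H^-1) * v < `|c * F m w - \int[P]_w' (c * F m w')|]%R = A.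
  by apply/eq_set => w; rewrite RintegralZl// -mulrBr normrM (gtr0_norm c0) uE ltr_pM2l.
have mA : measurable A.
  by apply: measurable_gtr; apply: measurableT_comp => //; exact: measurable_funB.
have hb : (P A <= (deviation_prefactor R * expR (- (deviation_rate h * M%:R * deviation_profile h v')))%:E)%E.
  exact: (grid_UTV_deviation h01 m fX kk0 S0 M0 (kkS a1) v'0).
have PA : P A = (fine (P A))%:E by rewrite fineK// fin_num_measure.
rewrite PA lee_fin; apply: hp; first by rewrite -lee_fin -PA probability_le1.
rewrite -lee_fin -PA; apply: (le_trans hb); rewrite lee_fin.
rewrite ler_pM2l ?deviation_prefactor_gt0// ler_expR lerN2.
rewrite -[leLHS]mulrA mulrCA -[leRHS]mulrA ler_pM2l ?deviation_rate_gt0//.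
rewrite mulrCA; apply: ler_pM => //.
- exact: ltW.
- by rewrite mulr_ge0// deviation_profile_ge0.
apply: deviation_profile_scale => //; last exact: ltW.
by rewrite ler_pdivlMr// mulrC ler_pdivrMr// mulrC.
Qed.
End truncated_variation.

Lemma DTV_UTV (R : realType) (c : R) (f : R -> R) (s t : R) :
  DTV c f s t = UTV c (fun x => -1 * f x) s t.
Proof.
have e (n : nat) (a b : nat -> R) : \sum_(i < n.+1) Num.max (f (a i) - f (b i) - c) 0 =
    \sum_(i < n.+1) Num.max (-1 * f (b i) - -1 * f (a i) - c) 0.
  by apply: eq_bigr => i _; congr Num.max; ring.
rewrite /DTV /UTV; congr ereal_sup; apply/seteqP; split => _ [n [a [b [ch ->]]]].
  by exists n, a, b; rewrite e.
by exists n, a, b; rewrite -e.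
Qed.

Lemma deviation_profile_min (R : realType) (h v : R) : 0 < h < 1 -> 0 < v ->
  v `^ (1 + h) * Num.min 1 v `^ (1 - h) = deviation_profile h v.
Proof.
move=> /andP[h0 h1] v0; rewrite /deviation_profile -(powR_mulrn 2 (ltW v0)).
have [v1|v1] := leP 1 v.
  by rewrite powR1 mulr1 min_l// ler_powR//; lra.
rewrite -powRD; last by rewrite (gt_eqF v0) implybT.
rewrite (_ : 1 + h + (1 - h) = 2%:R); last by ring.
by rewrite min_r// ger_powR ?v0 ?(ltW v1)//; lra.
Qed.

Lemma concentration_of_profile d (T : measurableType d) (R : realType) (P : probability T R)
    (H A B S c : R) (X : T -> \bar R) : 0 < H < 2^-1 -> 0 < S -> 0 < c ->
  (forall v, 0 < v -> (deviation_prob P X (S * c `^ (1 - H^-1) * v) <=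
     (A * expR (- (B * (S * c `^ (- H^-1) * deviation_profile (2 * H) v))))%:E)%E) ->
  truncated_variation_concentration P H A B S c X.
Proof.
move=> /andP[H0 H2] S0 c0 hv; split=> [u u0|v v0]; last first.
  by have := hv v v0; rewrite !mulrA.
set K := S * c `^ (1 - H^-1).
have K0 : 0 < K by rewrite mulr_gt0// powR_gt0.
have v0 : 0 < u / K by rewrite divr_gt0.
have uE : K * (u / K) = u by rewrite mulrC divfK// gt_eqF.
have := hv _ v0; rewrite -/K uE => /le_trans; apply; apply: le_of_eq.
congr (A * expR (- _))%:E.
have h01 : 0 < 2 * H < 1 by apply/andP; split; lra.
rewrite -(deviation_profile_min h01 v0).
have -> : Num.min K u = K * Num.min 1 (u / K) by rewrite minr_pMr ?(ltW K0)// mulr1 uE.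
move: v0 uE; set V := u / K => v0 uE.
have m0 : 0 <= Num.min 1 V by rewrite le_min ler01 ltW.
have -> : u `^ (1 + 2 * H) = K `^ (1 + 2 * H) * V `^ (1 + 2 * H).
  by rewrite -powRM ?(ltW K0) ?(ltW v0)// uE.
rewrite powRM ?(ltW K0)//.
have KK : K `^ (1 + 2 * H) * K `^ (1 - 2 * H) = K ^+ 2.
  rewrite -powRD ?(gt_eqF K0) ?implybT// -powR_mulrn ?(ltW K0)//; congr (_ `^ _); by ring.
(* The unit of deviation [K] equals [c] times [S * c ^ (- 1 / H)]; with its square, the prefactors
   of the two parametrizations agree. *)
have SK : S^-1 * c `^ (H^-1 - 2) * K ^+ 2 = S * c `^ (- H^-1).
  have cc : c `^ (H^-1 - 2) * c `^ (1 - H^-1) ^+ 2 = c `^ (- H^-1).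
    rewrite -powR_mulrn ?powR_ge0// -powRrM -powRD ?(gt_eqF c0) ?implybT//.
    by congr (_ `^ _); ring.
  rewrite /K exprMn -cc; field; rewrite gt_eqF//.
rewrite -SK -KK; move: (K `^ _) (K `^ _) => k1 k2; ring.
Qed.

Theorem theorem2p2 (R : realType) (H : R) (hH : 0 < H < 2^-1) :
  exists A B : R, 0 < A <= 18 /\ 0 < B /\
    forall (d : measure_display) (T : measurableType d) (P : probability T R)
      (W : R -> {RV P >-> R}),
    fractional_brownian_motion H W ->
    forall S c : R, 0 < S -> 0 < c <= S `^ H ->
      truncated_variation_concentration P H A B S c
        (fun w => UTV c (fun t => W t w) 0 S) /\
      truncated_variation_concentration P H A B S c
        (fun w => DTV c (fun t => W t w) 0 S).
Proof.
have h01 : 0 < 2 * H < 1 by case/andP: hH => h0 h1; apply/andP; split; lra.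
have rate0 : 0 < 4^-1 * deviation_rate (2 * H).
  by apply: mulr_gt0; [rewrite invr_gt0 ltr0n|exact: deviation_rate_gt0].
have [B B0 hB] := absorb_prefactor (deviation_prefactor_gt0 R) rate0.
exists 18, B; split; first by rewrite ltr0n lexx.
split=> // d T P W fbm S c S0 /andP[c0 cS].
have hp (v : R) : 0 < v -> forall y : R, y <= 1 ->
    y <= deviation_prefactor R * expR (- (4^-1 * deviation_rate (2 * H) *
      (S * c `^ (- H^-1) * deviation_profile (2 * H) v))) ->
    y <= 18 * expR (- (B * (S * c `^ (- H^-1) * deviation_profile (2 * H) v))).
  move=> v0 y; apply: hB.
  by rewrite mulr_ge0 ?deviation_profile_ge0// mulr_ge0 ?powR_ge0// ltW.
split; apply: concentration_of_profile => // v v0.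
  have := @UTV_deviation R H hH d T P W fbm S c S0 c0 cS 1 v _ (expr1n _ 2) v0 (hp v v0).
  by under [X in deviation_prob P X _]eq_fun do under [X in UTV _ X _ _]eq_fun do rewrite mul1r.
under [X in deviation_prob P X _]eq_fun do rewrite DTV_UTV.
apply: (@UTV_deviation R H hH d T P W fbm S c S0 c0 cS (-1) v _ _ v0 (hp v v0)).
by rewrite sqrrN expr1n.
Qed.
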